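(* Let $I$ be a set and let $S\colon\mathbb{N}^2\to I$ be a map satisfying the $C$-condition. Let $X$ be an arbitrary bounded real random variable such that $\mathrm{Var}(X)=1$. Let $\{X_i\}_{i\in I}$ be independent copies of $X$ and, for $n\in\mathbb{N}$, let $H_n^S=[X_{S(i,j)}]_{1\le i,j\le n}$ be the corresponding random $n\times n$ $S$-patterned matrix. Then, with probability $1$, $\widehat{\mu}(H_n^S/\sqrt{n})$ converges weakly to the Wigner semi-circular law $\gamma_{sc}$ as $n\to\infty$.
   Context: $\mathbb{N}=\{1,2,\ldots\}$ and $[n]=\{1,\ldots,n\}$. For $i\in I$ put $S_i^{(n)}=\{(x,y)\in[n]^2: S(x,y)=i\}$. The map $S$ satisfies the $C$-condition if: (C1) (symmetry) $S(x,y)=S(y,x)$ for all $x,y\in\mathbb{N}$; (C2) (coordinatewise injectivity) for every fixed $y\in\mathbb{N}$ the map $S(\cdot,y)$ is injective; (C3) (small dimension assumption) $\sum_{i\in I}|S_i^{(n)}|^2=o(n^3)$ as $n\to\infty$, equivalently $\lim_{n\to\infty} n^{-3}\,\#\{(x,y,z,w)\in[n]^4: S(x,y)=S(z,w)\}=0$. For a symmetric $n\times n$ real matrix $A$ with eigenvalues $\lambda_1(A)\ge\cdots\ge\lambda_n(A)$, the spectral measure is $\widehat{\mu}(A)=\frac1n\sum_{j=1}^n\delta_{\lambda_j(A)}$. The standard Wigner semi-circular law is $d\gamma_{sc}(x)=\mathbf{1}_{[-2,2]}(x)\,\frac{\sqrt{4-x^2}}{2\pi}\,dx$. *)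

(* Defs.v *)
From HB Require Import structures.
From mathcomp Require Import all_boot all_order all_algebra.
From mathcomp Require Import finmap sesquilinear spectral complex.
From mathcomp Require Import all_classical all_reals all_analysis.
From mathcomp Require Import measurable_realfun.
Set Implicit Arguments.
Unset Strict Implicit.
Unset Printing Implicit Defensive.
Import Order.TTheory GRing.Theory Num.Theory.
Import numFieldNormedType.Exports.
Local Open Scope classical_set_scope.
Local Open Scope ring_scope.

(* A map S : N^2 -> I on N = {1, 2, ...} is represented by S : nat -> nat -> I
   whose values at pairs with a zero coordinate are never used; i : 'I_n stands
   for the element i.+1 of [n]. *)

Definition level_set (I : choiceType) (S : nat -> nat -> I) (n : nat) (i : I) :
    {set 'I_n * 'I_n} :=
  [set p : 'I_n * 'I_n | S p.1.+1 p.2.+1 == i]%SET.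

Record C_condition (R : realType) (I : choiceType) (S : nat -> nat -> I) :
    Prop := {
  C_symmetric : forall x y : nat, (0 < x)%N -> (0 < y)%N -> S x y = S y x ;
  C_injective : forall y : nat, (0 < y)%N ->
    {in [pred x | (0 < x)%N] &, injective (fun x => S x y)} ;
  (* finitely supported sum: only finitely many level sets are nonempty *)
  C_small_dimension :
    (fun n : nat => \sum_(i \in [set: I]) (#|level_set S n i|%:R ^+ 2 : R^o))
      =o_\oo (fun n : nat => n%:R ^+ 3 : R^o)
}.

Definition patterned_matrix (R : Type) (I : Type) (S : nat -> nat -> I)
    (x : I -> R) (n : nat) : 'M[R]_n :=
  \matrix_(i < n, j < n) x (S i.+1 j.+1).

Section Probability.
Context d (T : measurableType d) (R : realType) (P : probability T R).

Definition mutually_independent (I : choiceType) (X : I -> {RV P >-> R}) :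
    Prop :=
  forall (J : {fset I}) (B : I -> set R),
    (forall i, i \in J -> measurable (B i)) ->
    P (\bigcap_(i in [set` J]) (X i @^-1` B i)) =
    (\prod_(i <- J) P (X i @^-1` B i))%E.

Definition same_law d' (T' : measurableType d') (P' : probability T' R)
    (X : {RV P >-> R}) (Y : {RV P' >-> R}) : Prop :=
  forall A : set R, measurable A -> distribution P X A = distribution P' Y A.

Definition as_bounded (X : {RV P >-> R}) : Prop :=
  exists M : R, {ae P, forall w, `|X w| <= M}.

End Probability.

Lemma char_poly_conj (F : fieldType) n (P D : 'M[F]_n) : P \in unitmx ->
  char_poly (invmx P *m D *m P) = char_poly D.
Proof.
move=> uP; rewrite /char_poly /char_poly_mx.
have uPX : map_mx polyC P \in unitmx by rewrite map_unitmx.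
have -> : 'X%:M - map_mx polyC (invmx P *m D *m P) =
   invmx (map_mx polyC P) *m ('X%:M - map_mx polyC D) *m map_mx polyC P.
  rewrite mulmxBr mulmxBl !map_mxM/= map_invmx; congr (_ - _).
  by rewrite scalar_mxC -mulmxA mulVmx// mulmx1.
by rewrite !det_mulmx mulrAC -det_mulmx mulVmx// det1 mul1r.
Qed.

Section SpectralMeasure.
Context (R : realType).

Definition is_spectrum n (A : 'M[R]_n) (l : n.-tuple R) : Prop :=
  sorted >=%R l /\ char_poly A = \prod_(a <- l) ('X - a%:P).

Definition eigenvalues n (A : 'M[R]_n) : n.-tuple R :=
  xget [tuple of nseq n 0] [set l | is_spectrum A l].

Lemma eigenvaluesP n (A : 'M[R]_n) : A^T = A -> is_spectrum A (eigenvalues A).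
Proof.
move=> sA; rewrite /eigenvalues.
suff [l lP] : exists l, is_spectrum A l by exact: (xgetPex _ (ex_intro _ l lP)).
pose f : {rmorphism R -> R[i]} := real_complex R.
pose B := map_mx f A.
have hB : B \is hermsymmx.
  apply: realsym_hermsym.
    by apply/is_hermitianmxP; rewrite expr0 scale1r map_mx_id// /B map_trmx sA.
  by apply/mxOverP => i j; rewrite mxE; apply/complex_realP; exists (A i j).
have /hermitian_normalmx /orthomx_spectralP BE := hB.
have /mxOverP dR := hermitian_spectral_diag_real hB.
pose r := [seq complex.Re (spectral_diag B 0 i) | i <- enum 'I_n].
have sr : size (sort >=%R r) == n by rewrite size_sort size_map size_enum_ord.
exists (Tuple sr); split => /=.
  by apply: sort_sorted => x y; exact: le_total.
apply: (map_poly_inj f); rewrite map_char_poly -/B BE.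
rewrite char_poly_conj ?spectral_unit// char_poly_trig; last first.
  exact: diag_mx_is_trig.
rewrite rmorph_prod (perm_big r) ?perm_sort//= big_map big_enum/=.
apply: eq_bigr => i _.
rewrite mxE eqxx mulr1n rmorphB/= map_polyX map_polyC/=; congr (_ - _%:P).
by rewrite RRe_real.
Qed.

Definition spectral_measure n (A : 'M[R]_n) : {measure set R -> \bar R} :=
  mscale (n%:R^-1)%:nng (msum (fun j => \d_((eigenvalues A)`_j)) n).

End SpectralMeasure.

Section Semicircle.
Context (R : realType).

Definition semicircle_pdf (x : R) : R :=
  \1_`[-2, 2] x * (Num.sqrt (4 - x ^+ 2) / (2 * pi)).

Definition semicircle (A : set R) : \bar R :=
  (\int[lebesgue_measure]_(x in A) (semicircle_pdf x)%:E)%E.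

Lemma semicircle_pdf_ge0 x : 0 <= semicircle_pdf x.
Proof.
by rewrite /semicircle_pdf mulr_ge0 ?indicE// divr_ge0 ?sqrtr_ge0// mulr_ge0 ?pi_ge0.
Qed.

Lemma measurable_semicircle_pdf : measurable_fun setT semicircle_pdf.
Proof.
apply: measurable_funM; first exact: measurable_indic.
apply: measurable_funM => //.
have msqrt : measurable_fun setT (@Num.sqrt R).
  exact: continuous_measurable_fun (@sqrt_continuous R).
refine (measurableT_comp (g := fun x : R => 4 - x ^+ 2) msqrt _).
by apply: measurable_funB => //; exact: measurable_funX.
Qed.

Let semicircle0 : semicircle set0 = 0%E.
Proof. by rewrite /semicircle integral_set0. Qed.

Let semicircle_ge0 A : (0 <= semicircle A)%E.
Proof. by apply: integral_ge0 => x _; rewrite lee_fin semicircle_pdf_ge0. Qed.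

Let semicircle_sigma_additive : semi_sigma_additive semicircle.
Proof.
move=> /= F mF tF mUF; rewrite /semicircle; apply: cvg_toP.
  apply: ereal_nondecreasing_is_cvgn => m n mn.
  apply: lee_sum_nneg_natr => // k _ _; apply: integral_ge0 => /= x Fkx.
  by rewrite lee_fin semicircle_pdf_ge0.
rewrite ge0_integral_bigcup//=.
- apply/measurable_funTS/measurableT_comp => //.
  exact: measurable_semicircle_pdf.
- by move=> x _; rewrite lee_fin semicircle_pdf_ge0.
Qed.

HB.instance Definition _ := isMeasure.Build _ _ _
  semicircle semicircle0 semicircle_ge0 semicircle_sigma_additive.

End Semicircle.
Arguments semicircle {R}.

Definition weak_cvg (R : realType)
    (mu : nat -> {measure set R -> \bar R})
    (nu : {measure set R -> \bar R}) : Prop :=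
  forall f : R -> R, continuous f -> bounded_fun (f : R -> R^o) ->
    (\int[mu n]_x (f x)%:E @[n --> \oo] --> \int[nu]_x (f x)%:E)%E.

(* Main.v *)
Require Import Defs.
From mathcomp Require Import all_boot all_order all_algebra zify.
Set Implicit Arguments.
Unset Strict Implicit.
Unset Printing Implicit Defensive.

(* Let H be the matrix built from the clipped and centred entries. Expanding
   tr H^k gives a sum over closed walks of [n], each edge (x, y) carrying the
   colour S(x, y); a walk contributes only if every colour occurs at least twice.
   - Walks whose colour word reduces to the empty word by cancelling adjacent
     equal letters backtrack all the way, and are counted exactly by walks on the
     n-regular tree; after normalization this tends to the number of walks of
     length k from 0 to 0 on the half line, the k-th semicircle moment.
   - The other walks either have a colour of multiplicity at least 3, or contain
     two crossing pairs of colours, and the small dimension assumption makes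
     them negligible.
   - The variance of tr H^k is O(n^(k+1)), because in two linked closed walks
     either a colour is used only once by one of them or one has multiplicity at
     least 4. Hence the moments converge almost surely along n = j^2.
   - An arbitrary n lies between consecutive squares j^2 and (j+1)^2: the original
     matrix of size n and the centred one of size j^2 agree, as quadratic forms,
     on a subspace of codimension O(sqrt n), so eigenvalue averages of monotone
     functions with values in [0, 1] differ by O(1 / sqrt n). These functions
     determine weak convergence. *)

(** Squares appear because, normalized by n^(1 + k/2), the trace of H^k has variance O(1/n):
    summable along n = j^2, but not along all n. The gap between consecutive squares is O(sqrt n),
    small against the n eigenvalues. The walk expansion needs a colour used once to contribute 0,
    while the mean of X is arbitrary; hence the centring. It subtracts a rank-one matrix, invisible
    on vectors orthogonal to the constants, at the price of one dimension. With a nonzero mean the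
    normalized matrix has an eigenvalue of order sqrt n, so moments of the original matrix need not
    converge: the comparison has to go through bounded test functions. Comparing eigenvalues means
    comparing counting functions, which is why only monotone functions are controlled at first; a
    bounded continuous function is then approximated, up to a tail, by differences of monotone ones.
    X is bounded only almost surely; clipping makes all integrands bounded everywhere, so that
    integrability is never an issue. *)

(** * Exploration of coloured walks *)

Section Exploration.
Variables (E V : finType) (I : eqType) (col : V -> V -> I) (pi t : E -> E).
Hypothesis colC : forall x y, col x y = col y x.
Hypothesis col_inj : forall y, injective (col^~ y).

(* A walk is given by its vertices; the edge [e] joins [v (pi e)] to [v e]. *)
Definition edge_colour (v : {ffun E -> V}) (e : E) : I := col (v (pi e)) (v e).

(** Only an implication: edges with different labels may share a colour. This enlarges the set of
    walks, which is harmless for upper bounds. *)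
Definition follows (v : {ffun E -> V}) : bool :=
  [forall e, forall e', (t e == t e') ==> (edge_colour v e == edge_colour v e')].

Definition known_colours (D : {set E}) : {set E} :=
  [set t e | e in [set e in D | pi e \in D]].

(** The free positions [G] depend on [D] and [t], not on the walk; this is what turns [m] into a
    factor #|V| ^ m. *)
Definition determined_by (D : {set E}) (m : nat) : Prop :=
  exists2 G : {set E}, #|G| <= m &
    forall v w, follows v -> follows w -> {in D :|: G, v =1 w} -> v =1 w.

Lemma followsP v e e' : follows v -> t e = t e' ->
  edge_colour v e = edge_colour v e'.
Proof. by move=> /forallP/(_ e)/forallP/(_ e')/implyP h /eqP/h/eqP. Qed.

Lemma determined_byW D m m' : m <= m' -> determined_by D m -> determined_by D m'.
Proof. by move=> mm' [G Gm GP]; exists G => //; exact: leq_trans mm'. Qed.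

(* A vertex adjacent to [D] is either forced, by coordinatewise injectivity,
   when the colour of the edge leading to it is already known, or is one more
   free choice which makes a new colour known. *)
Lemma determined_by_step (D : {set E}) m e y : (e \in D) != (pi e \in D) ->
  y = (if e \in D then pi e else e) ->
  determined_by (y |: D) m ->
  determined_by D (m + (t e \notin known_colours D)).
Proof.
move=> De yE [G Gm GP]; case: (boolP (t e \in _)) => [/imsetP[e0 e0K te]|tK] /=.
  move: e0K; rewrite inE => /andP[e0D pe0D].
  exists G; first by rewrite addn0.
  move=> v w fv fw vw; apply: GP => // x.
  rewrite !inE -orbA => /predU1P[->|xDG]; last by apply: vw; rewrite inE.
  have vwD z : z \in D -> v z = w z by move=> zD; apply: vw; rewrite inE zD.
  have := followsP fw te; have := followsP fv te.
  rewrite /edge_colour (vwD _ e0D) (vwD _ pe0D) => <-.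
  rewrite yE; move: De; case: ifPn => eD /= peD.
    by rewrite (vwD _ eD) => /col_inj.
  have {}peD : pi e \in D by move: peD; case: (pi e \in D).
  by rewrite (vwD _ peD) ![col (w (pi e)) _]colC => /col_inj.
exists (y |: G).
  by rewrite (leq_trans (leq_card_setU _ _))// cards1 addnC leq_add2r.
by move=> v w fv fw vw; apply: GP => // x; rewrite -setUA setUCA; exact: vw.
Qed.

Lemma known_colours_sub (D D' : {set E}) : D \subset D' ->
  known_colours D \subset known_colours D'.
Proof.
move=> DD'; apply/imsetS/fintype.subsetP => e; rewrite !inE => /andP[eD peD].
by rewrite !(fintype.subsetP DD').
Qed.

(** Since the iterates of [pi] reach [D], some edge always enters the unexplored part from [D]. Each
    free choice makes a new label known, so there are at most as many choices as labels unknown at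
    the start. *)
Lemma exploration (D : {set E}) : (forall x, exists m, iter m pi x \in D) ->
  determined_by D (#|t @: setT| - #|known_colours D|).
Proof.
have [n] := ubnP #|~: D|; elim: n D => // n IH D Dn reach.
have [DT|DT] := eqVneq D setT.
  exists set0; first by rewrite cards0.
  by move=> v w _ _ vw x; apply: vw; rewrite DT !inE.
have [x _ xD] : exists2 x, x \in [set: E] & x \notin D.
  by apply/subsetPn; rewrite subTset.
have [e eD peD] : exists2 e, e \notin D & pi e \in D.
  have [m] := reach x; elim: m x xD => /= [x /negbTE-> //|m IHm x xD].
  rewrite -iterS iterSr; case: (boolP (pi x \in D)) => [|xD' /IHm]; last exact.
  by exists x.
have st := @determined_by_step D (#|t @: setT| - #|known_colours (e |: D)|) e e.
apply: determined_byW (st _ _ _); last 3 first.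
- by rewrite (negbTE eD) peD.
- by rewrite (negbTE eD).
- apply: IH; last by move=> z; have [m mD] := reach z; exists m; rewrite inE mD orbT.
  rewrite -ltnS (leq_trans _ Dn)// ltnS proper_card// properE setCS subsetUr/=.
  by apply/subsetPn; exists e; rewrite !inE ?eqxx ?eD.
have sub : t e |: known_colours D \subset known_colours (e |: D).
  rewrite subUset known_colours_sub ?subsetUr// andbT sub1set.
  by apply: imset_f; rewrite !inE eqxx peD orbT.
have := subset_leq_card sub; rewrite cardsU1.
have := subset_leq_card (imsetS t (subsetT [set x in e |: D | pi x \in e |: D])).
rewrite -/(known_colours _); lia.
Qed.

(* [D] is extended to [F] along the edges of [A] only, none of which has the
   colour of the edge [c]; as both endpoints of [c] end up in [F] anyway, the
   colour of [c] costs nothing. *)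
Lemma exploration_closing (c : E) (A D F : {set E}) :
  c \in F -> pi c \in F -> D \subset F -> {in A, forall e, t e != t c} ->
  (forall D' : {set E}, D \subset D' -> D' \proper F ->
    exists e, [/\ e \in A, e \in F, pi e \in F & (e \in D') != (pi e \in D')]) ->
  (forall x, exists m, iter m pi x \in F) ->
  determined_by D (#|t @: setT|.-1 -
    #|[set t e | e in [set e in D | (pi e \in D) && (e \in A)]]|).
Proof.
move=> cF pcF DF fresh reach /exploration.
set K := fun D : {set E} => [set t e | e in [set e in D | (pi e \in D) && (e \in A)]].
rewrite -/(K D) => HF.
have KS (D1 D2 : {set E}) : D1 \subset D2 -> K D1 \subset K D2.
  move=> DD'; apply/imsetS/fintype.subsetP => e; rewrite !inE => /and3P[? ? ->].
  by rewrite !(fintype.subsetP DD').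
have KK (D1 : {set E}) : K D1 \subset known_colours D1.
  by apply/imsetS/fintype.subsetP => e; rewrite !inE => /and3P[-> ->].
have tcK D1 : t c \notin K D1.
  apply/imsetP => -[e]; rewrite inE => /and3P[_ _ eA] /esym/eqP.
  by apply/negP; exact: fresh.
have [n] := ubnP #|F :\: D|; elim: n D DF reach => // n IH D DF reach Dn.
have [DT|DT] := eqVneq D F.
  rewrite DT; apply: determined_byW HF.
  (* The gain of one: both ends of [c] are in [F], so its label is known at the end without having
     been paid for. *)
  have sub : t c |: K F \subset known_colours F.
    rewrite subUset KK andbT sub1set; apply: imset_f.
    by rewrite inE cF.
  by have := subset_leq_card sub; rewrite cardsU1 tcK; lia.
have pDF : D \proper F by rewrite properEneq DT.
have [e [eA eF peF eD]] := reach D (subxx _) pDF.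
set y := if e \in D then pi e else e.
have yF : y \in F by rewrite /y; case: ifP.
have yD : y \notin D by move: eD; rewrite /y; case: ifPn => // _; case: (_ \in _).
have st := @determined_by_step D (#|t @: setT|.-1 - #|K (y |: D)|) e y eD erefl.
apply: determined_byW (st _); last first.
  apply: IH.
  - by rewrite subUset sub1set yF.
  - by move=> D' /subUsetP[_ DD']; exact: reach.
  - rewrite -ltnS (leq_trans _ Dn)// ltnS proper_card// properE setDS ?subsetUr//=.
    by apply/subsetPn; exists y; rewrite !inE ?eqxx ?yD ?yF.
have sub : t e |: K D \subset K (y |: D).
  rewrite subUset KS ?subsetUr// andbT sub1set; apply: imset_f.
  move: eD; rewrite !inE eA andbT /y; case: ifPn; rewrite ?eqxx ?orbT//= => _.
  by case: (pi e \in D); rewrite ?orbT.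
have := subset_leq_card sub; rewrite cardsU1.
(* As [t c] is not in [K], this guarantees that the natural-number subtraction does not truncate. *)
have : #|t c |: K (y |: D)| <= #|t @: setT|.
  by apply/subset_leq_card; rewrite subUset sub1set imset_f ?inE// imsetS ?subsetT.
rewrite cardsU1 tcK.
have : (t e \notin known_colours D) <= (t e \notin K D).
  case: (boolP (t e \in K D)) => [/(fintype.subsetP (KK _))->//|_].
  exact: leq_b1.
move: #|_| #|_| #|_| (_ \notin _) (_ \notin _) => p q r b1 b2.
clear; case: b1; case: b2; lia.
Qed.

(** [r] records the values on [D]; a constraint on them, such as a colour coincidence, enters
    through [Q]. *)
Lemma card_follows (R : finType) (r : {ffun E -> V} -> R) (Q : {set R}) (D : {set E}) m :
  0 < #|V| -> determined_by D m ->
  (forall v, follows v -> r v \in Q) ->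
  (forall v w, r v = r w -> {in D, v =1 w}) ->
  #|[set v | follows v]| <= #|Q| * #|V| ^ m.
Proof.
move=> V0 [G Gm GP] rQ rD.
pose f (v : {ffun E -> V}) := (r v, [ffun i : 'I_#|G| => v (enum_val i)]).
have fi : {in [set v | follows v] &, injective f}.
  move=> v w; rewrite !inE => fv fw [rvw /ffunP Gvw].
  apply/ffunP/GP => // x; rewrite inE => /orP[|xG]; first exact: rD.
  by have := Gvw (enum_rank_in xG x); rewrite !ffunE enum_rankK_in.
rewrite -(card_in_imset fi).
apply: (@leq_trans #|setX Q [set: {ffun 'I_#|G| -> V}]|).
  apply/subset_leq_card/fintype.subsetP => p /imsetP[v]; rewrite inE => fv ->.
  by rewrite !inE /f/= andbT rQ.
by rewrite cardsX cardsT card_ffun card_ord leq_mul2l leq_pexp2l ?orbT.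
Qed.

End Exploration.

(** * Colour patterns of walks *)

Section Patterns.
Variables (E V : finType) (I : eqType) (col : V -> V -> I) (pi : E -> E).
Hypothesis colC : forall x y, col x y = col y x.
Hypothesis col_inj : forall y, injective (col^~ y).

Local Notation colour := (edge_colour col pi).

Definition colour_class (v : {ffun E -> V}) (e : E) : {set E} :=
  [set e' | colour v e' == colour v e].

Definition pattern (v : {ffun E -> V}) : {ffun E -> E} :=
  [ffun e => odflt e [pick e' in colour_class v e]].

Lemma patternP v e e' :
  (pattern v e == pattern v e') = (colour v e == colour v e').
Proof.
rewrite !ffunE; apply/eqP/eqP => [|cee']; last first.
  have -> : colour_class v e = colour_class v e' by rewrite /colour_class cee'.
  by case: pickP => // /(_ e'); rewrite inE eqxx.
case: pickP => [x|/(_ e)]; rewrite inE ?eqxx//= => /eqP <-.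
by case: pickP => [y|/(_ e')]; rewrite inE ?eqxx//= => /eqP <- ->.
Qed.

Lemma follows_pattern v : follows col pi (pattern v) v.
Proof.
by apply/forallP => e; apply/forallP => e'; apply/implyP; rewrite patternP.
Qed.

Lemma colour_classE v e :
  colour_class v e = [set e' | pattern v e' == pattern v e].
Proof. by apply/setP => x; rewrite !inE patternP. Qed.

Lemma card_patternwise (P : pred {ffun E -> V}) K :
  (forall v0, P v0 -> #|[set v | P v && (pattern v == pattern v0)]| <= K) ->
  #|[set v | P v]| <= #|E| ^ #|E| * K.
Proof.
move=> h; rewrite -card_ffun -sum1_card (partition_big pattern predT)//= -sum_nat_const.
apply: leq_sum => t _.
rewrite sum1dep_card; have [->|] := eqVneq [set v | (v \in [set v | P v]) && (pattern v == t)] set0.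
  by rewrite cards0.
move=> /set0Pn[v]; rewrite !inE => /andP[Pv /eqP <-].
by under eq_finset do rewrite inE; exact: h.
Qed.

Lemma card_colours v :
  #|E| = \sum_(r in pattern v @: setT) #|[set e | pattern v e == r]|.
Proof.
rewrite -sum1_card (partition_big (pattern v) (mem (pattern v @: setT))) /=.
  by apply: eq_bigr => r _; rewrite sum1dep_card.
by move=> e _; apply: imset_f.
Qed.

Definition ncolours v := #|pattern v @: setT|.

Lemma ncolours_le v : (forall e, 1 < #|colour_class v e|) ->
  2 * ncolours v <= #|E|.
Proof.
move=> h; rewrite (card_colours v) mulnC -sum_nat_const; apply: leq_sum.
by move=> _ /imsetP[e _ ->]; rewrite -colour_classE.
Qed.

Lemma ncolours_lt v e0 m : (forall e, 1 < #|colour_class v e|) ->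
  m + 2 <= #|colour_class v e0| -> 2 * ncolours v + m <= #|E|.
Proof.
move=> h h0; have e0P : pattern v e0 \in pattern v @: setT by exact: imset_f.
rewrite (card_colours v) (bigD1 (pattern v e0))//= -colour_classE.
rewrite /ncolours (cardsD1 (pattern v e0)) e0P.
suff : 2 * #|pattern v @: setT :\ pattern v e0| <=
  \sum_(i in pattern v @: setT | i != pattern v e0)
     #|[set e | pattern v e == i]| by lia.
rewrite mulnC -sum_nat_const.
rewrite [leqRHS](eq_bigl (mem (pattern v @: setT :\ pattern v e0))); last first.
  by move=> r; rewrite !inE andbC.
apply: leq_sum => r /setD1P[_ /imsetP[e _ ->]].
by rewrite -colour_classE.
Qed.

Lemma ncolours_eq v : (forall e, #|colour_class v e| = 2) ->
  2 * ncolours v = #|E|.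
Proof.
move=> h; rewrite (card_colours v) mulnC -sum_nat_const; apply: eq_bigr.
by move=> _ /imsetP[e _ ->]; rewrite -colour_classE h.
Qed.

End Patterns.

Lemma boundary (d : pred nat) m n : m <= n -> d m != d n ->
  exists i, m < i <= n /\ d i.-1 != d i.
Proof.
move=> /subnK <-; elim: (n - m) => [|p IH]; first by rewrite eqxx.
have [<- /IH[i [mi di]]|de _] := eqVneq (d (p + m)) (d (p.+1 + m)).
  by exists i; split => //; lia.
by exists (p.+1 + m); split => //; lia.
Qed.

(** * Cyclic order of the edges of a closed walk *)

Section Cycle.
Variable k : nat.

Lemma iter_ord_pred (x y : 'I_k) : exists m, iter m (@ord_pred k) x = y.
Proof.
(* [x] steps back lead to 0, and [k - y] further ones to [y]. *)
exists (x + (k - y)); apply: val_inj => /=.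
have it m : val (iter m (@ord_pred k) x) = (x + m * k.-1) %% k.
  elim: m => [|m IH]; first by rewrite addn0 modn_small.
  rewrite iterS /= IH -subn1 -addnBA; last exact: leq_ltn_trans (leq0n x) (ltn_ord x).
  by rewrite subn1 modnDml mulSn [(k.-1 + _)%N]addnC addnA.
rewrite -/(val _) it.
have -> : x + (x + (k - y)) * k.-1 = (x + (k - y)).-1 * k + y.
  move: (nat_of_ord x) (nat_of_ord y) (ltn_ord x) (ltn_ord y) => i j.
  case: k => // k' ? ? /=; nia.
by rewrite modnMDl modn_small.
Qed.

Lemma ord_pred_gt0 (x : 'I_k) : 0 < x -> ord_pred x = x.-1 :> nat.
Proof.
case: k x => [[]//|k' x] x0 /=; have -> : (x + k'.+1).-1 = x.-1 + k'.+1 by lia.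
by rewrite modnDr modn_small//; have := ltn_ord x; lia.
Qed.

(** Membership in [D] changes between [a] and [x] and between [x] and [b]. Choosing the stretch
    according to the side of [c] on which [x] lies avoids the edge [c]. *)
Lemma interval_boundary (a b c x : 'I_k) (D : {set 'I_k}) :
  a < c -> c < b -> a \in D -> b \in D -> a <= x <= b -> x \notin D ->
  exists e : 'I_k, [/\ a < e <= b, e != c & (e \in D) != (ord_pred e \in D)].
Proof.
move=> ac cb aD bD /andP[ax xb] xD.
pose d i := insubd x i \in D.
have dE (y : 'I_k) : d y = (y \in D) by rewrite /d valKd.
suff [e [aeb ec de]] : exists e, [/\ a < e <= b, e != c & d e.-1 != d e].
  have ek : e < k by case/andP: aeb => _ /leq_ltn_trans; apply.
  exists (Ordinal ek); split=> //; rewrite -!dE eq_sym ord_pred_gt0//=.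
  by case/andP: aeb; case: (e).
have [xc|cx] := ltnP x c.
  have [e [aex de]] := @boundary d a x ax ltac:(by rewrite !dE aD (negbTE xD)).
  by exists e; split => //; lia.
have [e [aex de]] := @boundary d x b xb ltac:(by rewrite !dE bD (negbTE xD)).
by exists e; split => //; lia.
Qed.

End Cycle.

(** * Counting closed walks with a multiple colour or with crossing colours *)

Section ClosedWalks.
Variables (V : finType) (I : eqType) (col : V -> V -> I) (k : nat).
Hypothesis colC : forall x y, col x y = col y x.
Hypothesis col_inj : forall y, injective (col^~ y).
Hypothesis V0 : 0 < #|V|.

Local Notation walk := {ffun 'I_k -> V}.
Local Notation pi := (@ord_pred k).
Local Notation colour := (edge_colour col pi).
Local Notation class := (colour_class col pi).

(** A colour of multiplicity 3 leaves at most (k - 1)/2 colours. With the base vertex this gives the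
    exponent, which falls short of the main order 1 + k/2 by at least one half. *)
Lemma card_walks_multiple :
  #|[set v : walk | [forall e, 1 < #|class v e|] && [exists e, 2 < #|class v e|]]|
  <= k ^ k * #|V| ^ (k.-1)./2.+1.
Proof.
have cpw := @card_patternwise 'I_k _ _ col pi.
rewrite card_ord in cpw; apply: cpw => v0 /andP[/forallP h1 /existsP[e0 h2]].
have := @exploration _ _ _ col pi (pattern col pi v0) colC col_inj [set e0].
case=> [x|G Gm GP]; first by have [m <-] := iter_ord_pred x e0; exists m; rewrite inE.
have D : determined_by col pi (pattern col pi v0) [set e0] (k.-1)./2.
  exists G => //; apply: leq_trans Gm _; apply: leq_trans (leq_subr _ _) _.
  rewrite -/(ncolours col pi v0) geq_half_double -mul2n.
  by have := @ncolours_lt _ _ _ _ _ v0 e0 1 h1 h2; rewrite card_ord; move: (ncolours _ _ _) => m; lia.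
have := @card_follows _ _ _ col pi _ V (fun v => v e0) setT _ _ V0 D.
rewrite cardsT expnS => /(_ (fun _ _ => in_setT _)) card_fol.
apply: leq_trans (card_fol _); last first.
  by move=> v w vw x; rewrite inE => /eqP->.
apply/subset_leq_card/fintype.subsetP => v; rewrite !inE => /andP[_ /eqP <-].
exact: follows_pattern.
Qed.

(** When every colour occurs exactly twice, the partner of [c] lies outside [a, b], so the pairs of
    [a] and of [c] interlace. *)
Definition crossing (v : walk) :=
  exists a b c : 'I_k, [/\ a < c < b, colour v a = colour v b &
    forall e : 'I_k, a <= e <= b -> e != c -> colour v e != colour v c].

Definition colour_coincidences : {set (V * V) * (V * V)} :=
  [set p | col p.1.1 p.1.2 == col p.2.1 p.2.2].

(* The edges [a] and [b] of equal colour are a coincidence, counted by the small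
   dimension assumption. Walking from [a] forwards and from [b] backwards up to
   the edge [c] determines both endpoints of [c], so the colour of [c] is free
   of charge: with [k./2] colours only [k./2 - 2] further choices remain. *)
Lemma card_crossing_walks (P : pred walk) :
  (forall v, P v -> (forall e, #|class v e| = 2) /\ crossing v) ->
  #|[set v | P v]| <= k ^ k * ((3 < k) * #|colour_coincidences| * #|V| ^ (k./2 - 2)).
Proof.
move=> hP; have cpw := @card_patternwise 'I_k _ _ col pi.
rewrite card_ord in cpw; apply: cpw => v0 /hP[h2 [a [b [c [/andP[ac cb] cab ccol]]]]].
have := ncolours_eq h2; rewrite card_ord => nc.
set t := pattern col pi v0; have tE e e' : (t e == t e') = (colour v0 e == colour v0 e').
  exact: patternP.
(* Two distinct colours occur twice each. The factor excludes the values of [k] for which [k./2 - 2]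
   would truncate. *)
have -> : 3 < k.
  suff : 1 < ncolours col pi v0 by lia.
  have /subset_leq_card : [set t a; t c] \subset t @: setT.
    by apply/fintype.subsetP => x; rewrite !inE => /orP[]/eqP->; exact: imset_f.
  by rewrite cards2 tE ccol ?leqnn ?(ltnW (ltn_trans ac cb))// -val_eqE neq_ltn ac.
(* [D] contains the ends of the two edges of equal colour, [F] all vertices from [pi a] to [b], and
   [A] the edges that may be followed, that is all but [c]. *)
rewrite mul1n; pose D := [set pi a; a; pi b; b].
pose F := [set e : 'I_k | a <= e <= b] :|: [set pi a].
pose A := [set e : 'I_k | a <= e <= b] :\ c.
have predE (x : 'I_k) : a < x -> pi x = x.-1 :> nat.
  by move=> ax; apply: ord_pred_gt0; lia.
have det := @exploration_closing _ _ _ col pi t colC col_inj c A D F.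
have {}det : determined_by col pi t D (k./2 - 2).
  apply: determined_byW (det _ _ _ _ _ _).
  - rewrite -/(ncolours col pi v0).
    have -> : ncolours col pi v0 = k./2 by lia.
    (* One label is saved by [c], and one by [a], whose two ends are in [D] from the start. *)
    rewrite -subn1 -subnDA leq_sub2l// -[2]/(1 + 1) leq_add2l card_gt0.
    apply/set0Pn; exists (t a); apply: imset_f; rewrite !inE !eqxx !orbT/=.
    by apply/andP; split; [rewrite -val_eqE /=|]; lia.
  - by rewrite !inE; lia.
  - by rewrite !inE predE//; lia.
  - apply/fintype.subsetP => x; rewrite !inE -!orbA => /or4P[]/eqP->; rewrite ?eqxx ?orbT//.
    + by rewrite leqnn; lia.
    + by rewrite predE; lia.
    + by rewrite leqnn; lia.
  - by move=> e; rewrite !inE => /andP[ec eab]; rewrite tE ccol.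
  - move=> D' DD' /properP[_ [x xF xD']].
    have aD' : a \in D' by apply: (fintype.subsetP DD'); rewrite !inE eqxx orbT.
    have paD' : pi a \in D' by apply: (fintype.subsetP DD'); rewrite !inE eqxx.
    have bD' : b \in D' by apply: (fintype.subsetP DD'); rewrite !inE eqxx !orbT.
    have xab : a <= x <= b.
      by move: xF; rewrite !inE => /orP[//|/eqP xE]; rewrite xE paD' in xD'.
    have Fi (e : 'I_k) : a <= e <= b -> e \in F by rewrite inE => h; rewrite inE h.
    have [e [/andP[ae eb] ec De]] := interval_boundary ac cb aD' bD' xab xD'.
    exists e; split=> //.
    + by rewrite !inE ec (ltnW ae) eb.
    + by apply: Fi; rewrite (ltnW ae) eb.
    + by apply: Fi; rewrite predE// -ltnS prednK ?ae ?(leq_trans (leq_pred _))// (leq_ltn_trans _ ae).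
  - move=> x; have [m xm] := iter_ord_pred x a; exists m.
    by rewrite xm !inE leqnn (ltnW (ltn_trans ac cb)).
pose r (v : walk) := ((v (pi a), v a), (v (pi b), v b)).
have := @card_follows _ _ _ col pi t _ r colour_coincidences _ _ V0 det.
move=> card_fol; apply: leq_trans (card_fol _ _).
- apply/subset_leq_card/fintype.subsetP => v; rewrite !inE => /andP[_ /eqP <-].
  exact: follows_pattern.
- move=> v fv; rewrite inE /=; apply/eqP.
  by apply: (followsP (e := a) (e' := b) fv); apply/eqP; rewrite tE cab.
- move=> v w [? ? ? ?] x; rewrite !inE -!orbA.
  by case/or4P => /eqP->.
Qed.

End ClosedWalks.

(** * Counting linked pairs of closed walks *)

Section TwoCycles.
Variables (V : finType) (I : eqType) (col : V -> V -> I) (k : nat).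
Hypothesis colC : forall x y, col x y = col y x.
Hypothesis col_inj : forall y, injective (col^~ y).
Hypothesis V0 : 0 < #|V|.

Definition sum_pred (e : 'I_k + 'I_k) : 'I_k + 'I_k :=
  match e with inl i => inl (ord_pred i) | inr i => inr (ord_pred i) end.

Local Notation walk := {ffun 'I_k + 'I_k -> V}.
Local Notation colour := (edge_colour col sum_pred).
Local Notation class := (colour_class col sum_pred).

Section OneCycle.
Variables i j : 'I_k -> 'I_k + 'I_k.
Hypotheses (ipi : forall x, sum_pred (i x) = i (ord_pred x)).
Hypotheses (jpi : forall x, sum_pred (j x) = j (ord_pred x)).
Hypothesis ijP : forall e, (exists x, e = i x) \/ (exists x, e = j x).

(* If a colour occurs only once in a cycle, this cycle can be explored starting
   at the end of that edge and the edge itself closes the cycle for free. *)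
Lemma determined_by_single (v0 : walk) (c : 'I_k) :
  (forall e, 1 < #|class v0 e|) ->
  (forall x, x != c -> colour v0 (i x) != colour v0 (i c)) ->
  determined_by col sum_pred (pattern col sum_pred v0) [set i c; j c] k.-1.
Proof.
move=> h1 hc; set t := pattern col sum_pred v0.
have tE e e' : (t e == t e') = (colour v0 e == colour v0 e') by exact: patternP.
pose A := [set i x | x in [set~ c]].
pose F := j c |: [set i x | x in setT].
have iF x : i x \in F by rewrite !inE imset_f ?orbT ?inE.
have jt m x : iter m sum_pred (j x) = j (iter m (@ord_pred k) x).
  by elim: m => //= m ->.
have det := @exploration_closing _ _ _ col sum_pred t colC col_inj (i c) A [set i c; j c] F.
apply: determined_byW (det _ _ _ _ _ _).
- apply: leq_trans (leq_subr _ _) _; rewrite -/(ncolours col sum_pred v0).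
  by have := ncolours_le h1; rewrite card_sum card_ord; lia.
- exact: iF.
- by rewrite ipi; exact: iF.
- by apply/fintype.subsetP => x; rewrite !inE => /orP[/eqP->|->//]; rewrite imset_f ?orbT ?inE.
- by move=> _ /imsetP[x xc ->]; rewrite tE hc//; move: xc; rewrite !inE.
- move=> D' DD' /properP[_ [z + zD']] => /setU1P[zE|/imsetP[x _ zE]].
    by rewrite zE (fintype.subsetP DD') ?inE ?eqxx ?orbT in zD'.
  have {zE zD'}xD' : i x \notin D' by rewrite -zE.
  have ic : i c \in D' by rewrite (fintype.subsetP DD') ?inE ?eqxx.
  have [m] := iter_ord_pred x c; elim: m x xD' => [x xD' /= xc|m IH x xD'].
    by rewrite -xc (negbTE xD') in ic.
  rewrite iterSr => xc.
  have [pxD'|/IH] := boolP (i (ord_pred x) \in D'); last exact.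
  exists (i x); split => //; rewrite ?ipi//; last by rewrite pxD' (negbTE xD').
  apply: imset_f; rewrite in_setC1; apply/eqP => xc0.
  by move: xD'; rewrite xc0 ic.
- move=> e; have [[x ->]|[x ->]] := ijP e; first by exists 0; exact: iF.
  have [m xm] := iter_ord_pred x c.
  by exists m; rewrite jt xm !inE eqxx.
Qed.

End OneCycle.

(** Two base vertices and up to [k] colours on 2k edges would only give the exponent k + 2, the
    order of the squared mean. Linking saves one choice: either one cycle closes for free, or a
    colour of multiplicity 4 leaves at most k - 1 colours. *)
Lemma card_linked_walks :
  #|[set v : walk | [forall e, 1 < #|class v e|] &&
     [exists p : 'I_k * 'I_k, colour v (inl p.1) == colour v (inr p.2)]]|
  <= (k + k) ^ (k + k) * #|V| ^ k.+1.
Proof.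
have cpw := @card_patternwise ('I_k + 'I_k)%type _ _ col sum_pred.
rewrite card_sum card_ord in cpw; apply: cpw => v0.
move=> /andP[/forallP/= h1 /existsP/=[[e1 e2] /= /eqP h12]].
have k0 : 0 < k by apply: leq_ltn_trans (ltn_ord e1).
suff [x [y det]] : exists x y, determined_by col sum_pred
    (pattern col sum_pred v0) [set inl x; inr y] k.-1.
  pose r (v : walk) := (v (inl x), v (inr y)).
  have := @card_follows _ _ _ col sum_pred _ _ r setT _ _ V0 det.
  rewrite cardsT card_prod => /(_ (fun _ _ => in_setT _)) card_fol.
  have -> : #|V| ^ k.+1 = #|V| * #|V| * #|V| ^ k.-1.
    by rewrite -mulnA -!expnS prednK.
  apply: leq_trans (card_fol _); last first.
    by move=> v w [? ?] z; rewrite !inE => /orP[]/eqP->.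
  apply/subset_leq_card/fintype.subsetP => v; rewrite !inE => /andP[_ /eqP <-].
  exact: follows_pattern.
have lr (e : 'I_k + 'I_k) : (exists x, e = inl x) \/ (exists x, e = inr x).
  by case: e => x; [left|right]; exists x.
have [/existsP[c /forallP hc]|h3] := boolP [exists c, forall x : 'I_k, (x != c) ==>
    (colour v0 (inl x) != colour v0 (inl c))].
  exists c, c; apply: (@determined_by_single inl inr) => // x; exact: (implyP (hc x)).
have [/existsP[c /forallP hc]|h4] := boolP [exists c, forall x : 'I_k, (x != c) ==>
    (colour v0 (inr x) != colour v0 (inr c))].
  exists c, c; rewrite setUC; apply: (@determined_by_single inr inl) => // x; last exact: (implyP (hc x)).
  by case: (lr x); [right|left].
have /forallPn[f1] : ~~ [forall x : 'I_k, (x != e1) ==> (colour v0 (inl x) != colour v0 (inl e1))].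
  by move: h3; rewrite negb_exists => /forallP/(_ e1).
rewrite negb_imply negbK => /andP[f1e1 /eqP cf1].
have /forallPn[f2] : ~~ [forall x : 'I_k, (x != e2) ==> (colour v0 (inr x) != colour v0 (inr e2))].
  by move: h4; rewrite negb_exists => /forallP/(_ e2).
rewrite negb_imply negbK => /andP[f2e2 /eqP cf2].
exists e1, e2; apply: determined_byW (exploration _ _ _ _) => //.
  apply: leq_trans (leq_subr _ _) _; rewrite -/(ncolours col sum_pred v0).
  suff /(ncolours_lt h1) : 2 + 2 <= #|class v0 (inl e1)|.
    by rewrite card_sum card_ord; move: (ncolours _ _ _) => m; lia.
  have <- : #|[set inl e1; inl f1] :|: [set inr e2; inr f2] : {set 'I_k + 'I_k}| = 2 + 2.
    rewrite cardsU.
    have -> : [set inl e1; inl f1] :&: [set inr e2; inr f2] = set0 :> {set 'I_k + 'I_k}.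
      by apply/setP => -[] y; rewrite !inE ?andbF.
    by rewrite cards0 subn0 !cards2 eq_sym f1e1 eq_sym f2e2.
  apply/subset_leq_card/fintype.subsetP => e; rewrite !inE -!orbA.
  by case/or4P => /eqP->; rewrite ?cf1 ?cf2 -?h12.
move=> [x|x].
  have [m xm] := iter_ord_pred x e1; exists m.
  suff -> : iter m sum_pred (inl x) = inl e1 by rewrite !inE eqxx.
  by rewrite -xm; elim: m {xm} => //= m ->.
have [m xm] := iter_ord_pred x e2; exists m.
suff -> : iter m sum_pred (inr x) = inr e2 by rewrite !inE eqxx.
by rewrite -xm; elim: m {xm} => //= m ->.
Qed.

End TwoCycles.

Section LinkedWeights.
Variables (R : numDomainType) (V : finType) (I : eqType) (col : V -> V -> I).
Variables (k : nat) (F : {ffun 'I_k + 'I_k -> V} -> R) (B : R).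
Hypothesis colC : forall x y, col x y = col y x.
Hypothesis col_inj : forall y, injective (col^~ y).
Hypothesis V0 : 0 < #|V|.
Local Notation colour := (edge_colour col (@sum_pred k)).
Local Notation class := (colour_class col (@sum_pred k)).
Local Open Scope ring_scope.
Import Order.TTheory GRing.Theory Num.Theory.
Hypothesis FB : forall v, `|F v| <= B.
Hypothesis F0 : forall v e, #|class v e| = 1%N -> F v = 0.
Hypothesis F_unlinked : forall v,
  (forall e e', colour v (inl e) != colour v (inr e')) -> F v = 0.

(** Meant for [F] the covariance of the products of entries along two walks. *)
Lemma linked_weights :
  `|\sum_v F v| <= B * ((k + k) ^ (k + k) * #|V| ^ k.+1)%:R.
Proof.
have B0 : 0 <= B by apply: le_trans (FB [ffun=> enum_val (Ordinal V0)]).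
pose b := [set v : {ffun 'I_k + 'I_k -> V} | [forall e, (1 < #|class v e|)%N] &&
     [exists p : 'I_k * 'I_k, colour v (inl p.1) == colour v (inr p.2)]].
apply: (@le_trans _ _ (B * #|b|%:R)); last first.
  by rewrite ler_wpM2l// ler_nat; exact: card_linked_walks.
apply: le_trans (ler_norm_sum _ _ _) _.
rewrite -sum1_card natr_sum [X in _ <= _ * X]big_mkcond mulr_sumr /=.
apply: ler_sum => v _.
case: ifPn => [_|]; first by rewrite mulr1.
rewrite inE negb_and mulr0 normr_le0 => /orP[/forallPn[e]|].
  rewrite -leqNgt => le1; apply/eqP/(F0 (e := e)).
  by apply/eqP; rewrite eqn_leq le1 card_gt0; apply/set0Pn; exists e; rewrite inE.
rewrite negb_exists => /forallP h; apply/eqP/F_unlinked => e e'.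
exact: (h (e, e')).
Qed.

End LinkedWeights.

(** * Reducible colour words *)

Section Words.
Variable I : eqType.
Implicit Types (w st : seq I).

(** Multiplication by a generator in the free product of groups of order 2 indexed by the colours;
    the stack is the reduced word, last letter first. *)
Definition push st (x : I) : seq I :=
  if st is y :: st' then if x == y then st' else x :: st else [:: x].

Definition reduce st w := foldl push st w.

Lemma count_mem1_nth x0 y w i j : count_mem y w <= 1 -> i < j < size w ->
  nth x0 w i = y -> nth x0 w j != y.
Proof.
move=> yw /andP[ij jw] iy; apply/negP => /eqP jy; move: yw.
rewrite -(cat_take_drop j w) count_cat leqNgt => /negP; apply.
rewrite -[2]/(1 + 1) leq_add// -has_count has_pred1.
  by rewrite -iy -(nth_take x0 ij) mem_nth// size_take jw.
by rewrite (drop_nth x0 jw) jy inE eqxx.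
Qed.

Definition crossing_word x0 w := exists a b c,
  [/\ a < c < b, b < size w, nth x0 w a = nth x0 w b &
      forall e, a <= e <= b -> e != c -> nth x0 w e != nth x0 w c].

(* As long as no two colours cross, the stack consists of the colours seen
   exactly once, the latest one on top. *)
Lemma reduce_crossing x0 w : (forall y, count_mem y w <= 2) ->
  reduce [::] w = rev [seq y <- w | count_mem y w == 1] \/ crossing_word x0 w.
Proof.
elim/last_ind: w => [|w x IH] c2; first by left.
have cE y : count_mem y (rcons w x) = count_mem y w + (x == y).
  by rewrite -cats1 count_cat /= addn0.
have {}IH : reduce [::] w = rev [seq y <- w | count_mem y w == 1] \/ crossing_word x0 w.
  by apply: IH => y; have := c2 y; rewrite cE; lia.
case: IH => [rw|[a [b [c [/andP[ac cb] bw ab ec]]]]]; last first.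
  right; exists a, b, c.
  have nE e : e < size w -> nth x0 (rcons w x) e = nth x0 w e.
    by move=> ew; rewrite nth_rcons ew.
  split; [by rewrite ac|by rewrite size_rcons ltnS ltnW| |].
    by rewrite !nE//; lia.
  by move=> e eab ne; rewrite !nE ?ec//; lia.
have reducer : reduce [::] (rcons w x) = push (rev [seq y <- w | count_mem y w == 1]) x.
  by rewrite -rw /reduce -cats1 foldl_cat.
have [xw|xw] := boolP (x \in w); last first.
  left; rewrite reducer filter_rcons cE eqxx.
  have -> : count_mem x w = 0 by apply/eqP; rewrite -leqn0 leqNgt -has_count has_pred1.
  rewrite /= rev_rcons.
  have -> : [seq y <- w | count_mem y (rcons w x) == 1] = [seq y <- w | count_mem y w == 1].
    by apply: eq_in_filter => y yw; rewrite cE; have [xy|_] := eqVneq x y; rewrite ?addn0// xy yw in xw *.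
  case E : (rev _) => [//|y s] /=; case: eqP => // xy.
  have : y \in rev [seq y <- w | count_mem y w == 1] by rewrite E inE eqxx.
  by rewrite mem_rev mem_filter -xy (negbTE xw) andbF.
have xw1 : count_mem x w = 1.
  have : 0 < count_mem x w by rewrite -has_count has_pred1.
  by have := c2 x; rewrite cE eqxx; lia.
move: xw rw reducer xw1 c2 cE => /splitPr[w1 w2] rw reducer xw1 c2 cE.
have [xw1' xw2] : x \notin w1 /\ x \notin w2.
  move: xw1; rewrite count_cat /= eqxx.
  by rewrite -!has_pred1 !has_count; lia.
set P := fun y => count_mem y (w1 ++ x :: w2) == 1.
have PE y : y != x -> (count_mem y (rcons (w1 ++ x :: w2) x) == 1) = P y.
  by move=> yx; rewrite cE [x == y]eq_sym (negbTE yx) addn0.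
(* The letters above [x] on the stack are those of [w2] seen once. If there are none, [x] is on top
   and gets cancelled; otherwise such a [y] lies between the two occurrences of [x] without being
   repeated, which is a crossing. *)
have [/hasP[y yw2 Py]|] := boolP (has P w2); last first.
  rewrite has_filter negbK => /eqP w20; left; rewrite reducer.
  rewrite filter_rcons cE eqxx xw1 /= !filter_cat /= cE eqxx xw1 /=.
  have Pw s : x \notin s -> [seq y <- s | count_mem y (rcons (w1 ++ x :: w2) x) == 1] =
      [seq y <- s | P y].
    by move=> xs; apply: eq_in_filter => y ys; rewrite PE//; apply: contraNneq xs => <-.
  by rewrite !Pw// w20 cats0 cats1 rev_rcons /= eqxx.
right; have yx : y != x by apply: contraNneq xw2 => <-.
set w0 := w1 ++ x :: w2.
exists (size w1), (size w0), (size w1 + (index y w2).+1).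
have iy : index y w2 < size w2 by rewrite index_mem.
have sw : size w0 = size w1 + (size w2).+1 by rewrite size_cat.
have nc : nth x0 (rcons w0 x) (size w1 + (index y w2).+1) = y.
  by rewrite nth_rcons sw ltn_add2l ltnS iy nth_cat ltnNge leq_addr/= addKn /= nth_index.
rewrite nc; split; rewrite ?size_rcons//.
- by rewrite sw ltn_add2l ltnS iy; lia.
- have w10 : size w1 < size w0 by rewrite sw; lia.
  by rewrite !nth_rcons ltnn eqxx w10 nth_cat ltnn subnn.
move=> e /andP[ae eb] ec.
have [->|eb'] := eqVneq e (size w0); first by rewrite nth_rcons ltnn eqxx eq_sym.
have {eb eb'}ew : e < size w0 by lia.
rewrite nth_rcons ew; move: nc; rewrite nth_rcons sw ltn_add2l ltnS iy => nc.
have [lt|gt|eq] := ltngtP e (size w1 + (index y w2).+1).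
- apply/negP => /eqP ny.
  have yw0 : count_mem y w0 <= 1 by rewrite (eqP Py).
  have lt' : e < size w1 + (index y w2).+1 < size w0 by rewrite lt sw; lia.
  by have := count_mem1_nth yw0 lt' ny; rewrite nc eqxx.
- by apply: (count_mem1_nth _ _ nc); rewrite ?(eqP Py)// gt.
- by rewrite eq eqxx in ec.
Qed.

End Words.

Section Reducible.
Variables (V : finType) (I : eqType) (col : V -> V -> I).
Hypothesis colC : forall x y, col x y = col y x.
Hypothesis col_inj : forall y, injective (col^~ y).

(** The stack, read as colours of successive edges, is a route from the current vertex [u] back to
    the root [z]. *)
Fixpoint backtracks (u : V) (st : seq I) (z : V) : Prop :=
  if st is c :: st' then exists2 x, col u x = c & backtracks x st' z else u = z.

(* By symmetry and coordinatewise injectivity, an edge having the colour on top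
   of the stack leads back to the previous vertex. *)
Lemma backtracks_push u st z x : backtracks u st z ->
  backtracks x (push st (col u x)) z.
Proof.
case: st => [|c st] /= => [uz|[y cy yz]]; first by exists u.
case: eqP => [cc|_]; last by exists u => //; exists y.
suff -> : x = y by [].
by apply: (@col_inj u); rewrite /= ![col _ u]colC cc.
Qed.

Lemma backtracks_reduce u st z s : backtracks u st z ->
  backtracks (last u s) (reduce st (pairmap col u s)) z.
Proof. by elim: s u st => //= x s IH u st /(@backtracks_push _ _ _ x)/IH. Qed.

(* Walks of length k in the n-regular rooted tree from depth j to the root. *)
Fixpoint tree_walks (n k j : nat) : nat :=
  if k is k'.+1 then
    if j is j'.+1 then tree_walks n k' j' + n.-1 * tree_walks n k' j.+1
    else n * tree_walks n k' 1
  else j == 0.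

Lemma sum_tuple_cons (T : Type) (idx : T) (op : Monoid.com_law idx) k (F : seq V -> T) :
  \big[op/idx]_(s : k.+1.-tuple V) F s = \big[op/idx]_x \big[op/idx]_(s : k.-tuple V) F (x :: s).
Proof.
rewrite pair_bigA /= (reindex (fun p : V * k.-tuple V => [tuple of p.1 :: p.2]))//.
exists (fun s : k.+1.-tuple V => (thead s, [tuple of behead s])) => [[x s] _|s _] /=.
  by congr (_, _); apply: val_inj.
by rewrite [RHS]tuple_eta.
Qed.

(** With a nonempty stack exactly one next vertex cancels its top, and the #|V| - 1 others lengthen
    it. The height of the stack thus behaves like the depth in the regular tree, whatever the
    colouring. *)
Lemma card_reducible_tuples k u st z : backtracks u st z ->
  \sum_(s : k.-tuple V) (reduce st (pairmap col u s) == [::] : nat) =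
  tree_walks #|V| k (size st).
Proof.
elim: k u st => [|k IH] u st uz.
  rewrite (eq_bigr (fun _ => (st == [::]) : nat)); last first.
    by move=> s _; rewrite tuple0.
  by rewrite sum_nat_const card_tuple expn0 mul1n -size_eq0.
rewrite (sum_tuple_cons _ _ (fun s => (reduce st (pairmap col u s) == [::] : nat))).
rewrite /=; under eq_bigr => x _ do rewrite (IH _ _ (backtracks_push x uz)).
case: st uz => [_|c st [y uy _]] /=; first by rewrite sum_nat_const.
rewrite (bigD1 y)//= uy eqxx; congr (_ + _).
under eq_bigr => x xy.
  rewrite ifN; last by rewrite -uy ![col u _]colC; apply: contraNneq xy => /col_inj->.
  over.
by rewrite /= sum_nat_const cardC1.
Qed.

(** A walk from [u] with reducible colour word ends at [u] by [backtracks_reduce]; summing over all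
    starting points therefore counts precisely the closed walks. *)
Lemma card_reducible_closed (x0 : V) k : 0 < k ->
  \sum_(s : k.-tuple V) (reduce [::] (pairmap col (last x0 s) s) == [::] : nat) =
  #|V| * tree_walks #|V| k 0.
Proof.
case: k => // k _.
transitivity (\sum_u \sum_(s : k.+1.-tuple V) (reduce [::] (pairmap col u s) == [::] : nat)).
  rewrite exchange_big; apply: eq_bigr => s _ /=.
  rewrite (bigD1 (last x0 s))//= big1 ?addn0// => u uE.
  case: eqP => // r0; have := @backtracks_reduce u [::] u s erefl.
  rewrite r0 /= => lu; move: uE; rewrite -{1}lu.
  by case: s {r0 lu} => -[|x s]//= _; rewrite eqxx.
under eq_bigr => u _ do rewrite (@card_reducible_tuples _ u [::] u)//.
by rewrite sum_nat_const.
Qed.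

End Reducible.

Section ReducibleWalks.
Variables (V : finType) (I : eqType) (col : V -> V -> I) (k : nat).
Hypothesis colC : forall x y, col x y = col y x.
Hypothesis col_inj : forall y, injective (col^~ y).

Local Notation walk := {ffun 'I_k -> V}.
Local Notation pi := (@ord_pred k).
Local Notation colour := (edge_colour col pi).
Local Notation class := (colour_class col pi).

Definition colour_word (v : walk) : seq I := codom (colour v).

Definition reducible (v : walk) : bool := reduce [::] (colour_word v) == [::].

Lemma nth_colour_word c0 v (e : 'I_k) : nth c0 (colour_word v) e = colour v e.
Proof.
by rewrite /colour_word codomE (nth_map e) ?size_enum_ord// nth_ord_enum.
Qed.

Lemma size_colour_word v : size (colour_word v) = k.
Proof. by rewrite size_codom card_ord. Qed.

Lemma count_colour_word v y :
  count_mem y (colour_word v) = #|[set e | colour v e == y]|.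
Proof.
by rewrite /colour_word codomE count_map enumT cardsE cardE size_filter.
Qed.

Lemma colour_wordE x0 (s : k.-tuple V) :
  colour_word [ffun i => tnth s i] = pairmap col (last x0 s) s.
Proof.
apply: (@eq_from_nth _ (col x0 x0)) => [|i].
  by rewrite size_colour_word size_pairmap size_tuple.
rewrite size_colour_word => ik.
rewrite -[i]/(nat_of_ord (Ordinal ik)) nth_colour_word (nth_pairmap x0) ?size_tuple//.
rewrite /edge_colour !ffunE !(tnth_nth x0) /=; congr col.
case: i ik => [|i] ik /=.
  rewrite add0n modn_small ?prednK//.
  by rewrite -nth_last size_tuple.
rewrite modnDr modn_small//; exact: ltnW.
Qed.

Lemma card_reducible : 0 < k ->
  #|[set v | reducible v]| = #|V| * tree_walks #|V| k 0.
Proof.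
move=> k0; case: (pickP V) => [x0 _|V0]; last first.
  have V00 : #|V| = 0 by apply: eq_card0.
  by rewrite V00 mul0n; apply/eqP; rewrite -leqn0 (leq_trans (max_card _))// card_ffun card_ord V00 exp0n.
rewrite -(card_reducible_closed colC col_inj x0 k0) -sum1dep_card big_mkcond /=.
rewrite (reindex (fun s : k.-tuple V => [ffun i => tnth s i]))/=.
  apply: eq_bigr => s _; rewrite /reducible (colour_wordE x0).
  by case: (_ == _).
exists (fun v : walk => [tuple v i | i < k]) => [s _|v _].
  by apply: eq_from_tnth => i; rewrite tnth_mktuple ffunE.
by apply/ffunP => i; rewrite ffunE tnth_mktuple.
Qed.

(** Cancellation removes letters in equal pairs. Hence in a reducible word every multiplicity is
    even. *)
Lemma odd_count_reduce st (w : seq I) y :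
  odd (count_mem y (reduce st w)) = odd (count_mem y st) (+) odd (count_mem y w).
Proof.
elim: w st => [|x w IH] st /=; first by rewrite addbF.
rewrite IH oddD addbA; congr (_ (+) _).
case: st => [|z st] /=; first by rewrite addn0.
case: eqP => [->|_] /=; rewrite !oddD; last by rewrite addbC.
by rewrite addbC addbA addbb.
Qed.

Lemma reducible_class v e : reducible v -> 1 < #|class v e|.
Proof.
move=> /eqP r0; have := odd_count_reduce [::] (colour_word v) (colour v e).
rewrite r0 /= count_colour_word => odd0.
have : 0 < #|class v e| by apply/card_gt0P; exists e; rewrite inE.
by move: odd0; rewrite -/(class v e); case: #|_| => [|[]].
Qed.

(** With all multiplicities equal to 2 no letter occurs once, so the first alternative of
    [reduce_crossing] would make the reduced word empty. *)
Lemma irreducible_crossing v : (forall e, #|class v e| = 2) -> ~~ reducible v ->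
  crossing col v.
Proof.
move=> h2 rv; have [c0 _|k0] := pickP 'I_k; last first.
  move: rv; rewrite /reducible; suff -> : colour_word v = [::] by [].
  apply/size0nil; rewrite size_colour_word.
  by have := @eq_card0 _ _ k0; rewrite card_ord.
have count2 y : y \in colour_word v -> count_mem y (colour_word v) = 2.
  by move=> /codomP[e ->]; rewrite count_colour_word; exact: h2.
have c2 y : count_mem y (colour_word v) <= 2.
  have [/count2->//|yv] := boolP (y \in colour_word v).
  by rewrite leqNgt; apply: contra yv => /ltnW/ltnW; rewrite -has_count has_pred1.
case: (reduce_crossing (colour v c0) c2) => [rw|[a [b [c [/andP[ac cb] bw ab ec]]]]].
  case/eqP: rv; rewrite rw (@eq_in_filter _ _ pred0) ?filter_pred0//.
  by move=> y /count2->.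
rewrite size_colour_word in bw.
have nw := nth_colour_word (colour v c0) v.
pose b' := Ordinal bw; pose c' := Ordinal (ltn_trans cb bw).
pose a' := Ordinal (ltn_trans ac (ltn_ord c')).
exists a', b', c'; split; first by rewrite ac.
  by rewrite -(nw a') -(nw b').
by move=> e eab ec'; rewrite -(nw e) -(nw c'); exact: ec.
Qed.

End ReducibleWalks.

(** * Weighted sums over closed walks *)

Section WeightedWalks.
Variables (R : numDomainType) (V : finType) (I : eqType) (col : V -> V -> I).
Variables (k : nat) (wt : {ffun 'I_k -> V} -> R) (B : R).
Hypothesis colC : forall x y, col x y = col y x.
Hypothesis col_inj : forall y, injective (col^~ y).
Hypotheses (k0 : 0 < k) (V0 : 0 < #|V|).
Local Notation class := (colour_class col (@ord_pred k)).
Local Open Scope ring_scope.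
Import Order.TTheory GRing.Theory Num.Theory.
Hypothesis wtB : forall v, `|wt v| <= B.
Hypothesis wt0 : forall v e, #|class v e| = 1%N -> wt v = 0.
Hypothesis wt1 : forall v, (forall e, #|class v e| = 2%N) -> wt v = 1.

(** The weight is compared with the indicator of reducible walks. They agree except on walks with a
    multiple colour and on irreducible walks with all multiplicities 2, where they differ by at most
    B + 1. *)
Lemma weighted_walks :
  `|\sum_v wt v - (#|V| * tree_walks #|V| k 0)%:R| <=
  (B + 1) * (k ^ k * (#|V| ^ (k.-1)./2.+1 +
     (3 < k) * #|colour_coincidences col| * #|V| ^ (k./2 - 2)))%:R.
Proof.
pose b1 := [set v : {ffun 'I_k -> V} |
  [forall e, (1 < #|class v e|)%N] && [exists e, (2 < #|class v e|)%N]].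
pose b2 := [set v : {ffun 'I_k -> V} |
  [forall e, #|class v e| == 2%N] && ~~ reducible col v].
have B0 : 0 <= B by apply: le_trans (wtB [ffun=> enum_val (Ordinal V0)]).
have b1_le := card_walks_multiple k colC col_inj V0.
have b2_le : (#|b2| <= k ^ k * ((3 < k) * #|colour_coincidences col| * #|V| ^ (k./2 - 2)))%N.
  apply: card_crossing_walks => // v /andP[/forallP h2 rv].
  have {}h2 e : #|class v e| = 2%N by exact/eqP.
  by split => //; exact: irreducible_crossing.
apply: (@le_trans _ _ ((B + 1) * (#|b1| + #|b2|)%:R)); last first.
  by rewrite ler_wpM2l ?addr_ge0// ler_nat mulnDr leq_add.
rewrite -(card_reducible colC col_inj k0) -sum1dep_card natr_sum [X in _ - X]big_mkcond /= -sumrB.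
apply: le_trans (ler_norm_sum _ _ _) _.
have cardE' (b : {set {ffun 'I_k -> V}}) : #|b|%:R = \sum_v (v \in b)%:R :> R.
  by rewrite -sum1_card natr_sum big_mkcond; apply: eq_bigr => v _; case: ifP.
rewrite natrD !cardE' -big_split mulr_sumr /=.
apply: ler_sum => v _.
have [/forallP/= h1|] := boolP [forall e, (1 < #|class v e|)%N]; last first.
  move=> /forallPn[e]; rewrite -leqNgt => le1.
  have e1 : #|class v e| = 1%N.
    by apply/eqP; rewrite eqn_leq le1 card_gt0; apply/set0Pn; exists e; rewrite inE.
  rewrite (wt0 e1) ifN ?subrr ?normr0 ?mulr_ge0 ?addr_ge0//.
  by apply: contraL le1 => /(reducible_class e); rewrite -ltnNge.
have bnd : `|wt v - (if reducible col v then 1 else 0)| <= B + 1.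
  by rewrite (le_trans (ler_normB _ _))// lerD//; case: ifP; rewrite ?normr1 ?normr0.
have [vb1|] := boolP (v \in b1).
  by apply: le_trans bnd _; rewrite ler_peMr ?addr_ge0// lerDl.
rewrite inE => /negbTE.
have -> /= : [forall e, (1 < #|class v e|)%N] by exact/forallP.
move=> /negbT; rewrite negb_exists => /forallP/= h3.
have h2 e : #|class v e| = 2%N by apply/eqP; rewrite eqn_leq h1 leqNgt h3.
have [vb2|] := boolP (v \in b2).
  by rewrite add0r mulr1.
rewrite inE.
have -> /= : [forall e, #|class v e| == 2%N] by apply/forallP => e; apply/eqP.
by rewrite negbK => ->; rewrite wt1// subrr normr0 mulr_ge0 ?addr_ge0.
Qed.

End WeightedWalks.

From HB Require Import structures.
From mathcomp Require Import finmap sesquilinear spectral complex.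
From mathcomp Require Import all_classical all_reals all_analysis.
From mathcomp Require Import measurable_realfun ring lra.
Import Order.TTheory GRing.Theory Num.Theory.
Import numFieldNormedType.Exports.
Local Open Scope classical_set_scope.
Local Open Scope ring_scope.

(** * Limit of the expected moments *)

(* Walks of length k on the half line from [j] to [0]; for [j = 0] these are the
   moments of the semicircle law. *)
Fixpoint half_line_walks (k j : nat) : nat :=
  if k is k'.+1 then
    if j is j'.+1 then (half_line_walks k' j' + half_line_walks k' j.+1)%N
    else half_line_walks k' 1
  else j == 0%N.

Section TreeWalks.
Variable R : realType.

Lemma cvg_natV : (fun n => n%:R^-1 : R) @ \oo --> (0 : R).
Proof.
by rewrite -(cvg_shiftS (fun n : nat => n%:R^-1 : R^o)) /=; exact: cvg_harmonic.
Qed.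

Lemma cvg_sqrt_natV : (fun n => (Num.sqrt n%:R)^-1 : R) @ \oo --> (0 : R).
Proof.
rewrite -[X in _ --> X](@sqrtr0 R); under eq_fun do rewrite -sqrtrV//.
by apply: continuous_cvg cvg_natV; exact: sqrt_continuous.
Qed.

(** The factor sqrt(n)^j balances the two directions: a step away from the root has about n choices
    and a step towards it only one, but after rescaling both have weight tending to 1. The
    recurrence then becomes that of the half line, up to the factor 1 - 1/n. *)
Lemma cvg_tree_walks k j :
  (fun n => (tree_walks n k j)%:R * Num.sqrt n%:R ^+ j / Num.sqrt n%:R ^+ k : R)
    @ \oo --> ((half_line_walks k j)%:R : R).
Proof.
have sqrn (n : nat) : Num.sqrt n%:R ^+ 2 = n%:R :> R by rewrite sqr_sqrtr.
have s0 (n : nat) : (0 < n)%N -> Num.sqrt n%:R != 0 :> R.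
  by move=> n0; rewrite sqrtr_eq0 -ltNge ltr0n.
elim: k j => [|k IH] [|j] /=.
- under eq_fun do rewrite !expr0 mulr1 divr1; exact: cvg_cst.
- under eq_fun do rewrite mul0r mul0r; exact: cvg_cst.
- apply: cvg_trans (IH 1%N); apply: near_eq_cvg; near=> n.
  have n0 : (0 < n)%N by near: n; exact: nbhs_infty_gt.
  rewrite natrM; have := s0 _ n0; have := sqrn n; set s := Num.sqrt _ => <- s1.
  by rewrite expr0 expr1 [s ^+ k.+1]exprS; field; rewrite s1 expf_neq0.
- rewrite natrD.
  have c1 : (fun n : nat => 1 - n%:R^-1 : R) @ \oo --> (1 : R).
    rewrite -[X in _ --> X]subr0; apply: cvgB; first exact: cvg_cst.
    exact: cvg_natV.
  have := cvgD (IH j) (cvgM c1 (IH j.+2)); rewrite mul1r => lim.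
  apply: cvg_trans (lim _ _); apply: near_eq_cvg; near=> n.
  have n0 : (0 < n)%N by near: n; exact: nbhs_infty_gt.
  rewrite fctE /= natrD natrM -subn1 natrB//.
  have := s0 _ n0; have := sqrn n; set s := Num.sqrt _ => <- s1.
  by rewrite [s ^+ j.+2]exprS [s ^+ j.+1]exprS [s ^+ k.+1]exprS; field; rewrite s1 expf_neq0.
Unshelve. all: by end_near. Qed.

End TreeWalks.

Section Coincidences.
Variables (R : realType) (I : choiceType) (S : nat -> nat -> I).
Hypothesis HS : C_condition R S.

Definition colour n (x y : 'I_n) : I := S x.+1 y.+1.

Lemma colourC n (x y : 'I_n) : colour x y = colour y x.
Proof. exact: (C_symmetric HS). Qed.

Lemma colour_inj n (y : 'I_n) : injective ((@colour n)^~ y).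
Proof.
move=> x x' /(C_injective HS (ltn0Sn _)) e.
by apply: val_inj; apply: succn_inj; apply: e.
Qed.

(** The square of the size of a level set counts the pairs of positions in it. The list [s] of
    colours that occur contains the support of the sum. *)
Lemma sum_level_sets n :
  \sum_(i \in [set: I]) (#|level_set S n i|%:R ^+ 2 : R) =
  #|colour_coincidences (@colour n)|%:R.
Proof.
pose s : seq I := undup [seq colour p.1 p.2 | p : 'I_n * 'I_n <- enum predT].
rewrite (fsbigE s) ?undup_uniq//; last first.
  move=> i _; rewrite mem_undup => /mapP hs.
  have -> : level_set S n i = finset.set0.
    apply/finset.setP => p; rewrite !inE; apply/negbTE/eqP => pi.
    by apply: hs; exists p; rewrite ?mem_enum// -pi.
  by rewrite cards0 expr0n.
transitivity (\sum_(i <- s) \sum_(p : ('I_n * 'I_n) * ('I_n * 'I_n) |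
    (colour p.1.1 p.1.2 == i) && (colour p.2.1 p.2.2 == i)) (1%:R : R)).
  rewrite big_mkcond; apply: eq_bigr => i _; rewrite in_setT.
  rewrite -natr_sum sum1dep_card -natrX; congr (_ %:R).
  by rewrite -mulnn -cardsX; apply: eq_card => p; rewrite !inE.
rewrite (exchange_big_dep (mem (colour_coincidences (@colour n))))/=; last first.
  by move=> i p _ /andP[/eqP e1 /eqP e2]; rewrite inE e1 e2.
rewrite -sum1_card natr_sum; apply: eq_bigr => p; rewrite inE => /eqP pE.
rewrite -natr_sum sum1_count -pE; congr (_ %:R).
under eq_count do rewrite andbb eq_sym.
rewrite (count_uniq_mem _ (undup_uniq _)) mem_undup.
suff -> : colour p.1.1 p.1.2 \in [seq colour q.1 q.2 | q : 'I_n * 'I_n <- enum predT] by [].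
by apply/mapP; exists p.1; rewrite ?mem_enum.
Qed.

Lemma cvg_coincidences :
  (fun n => #|colour_coincidences (@colour n)|%:R / n%:R ^+ 3 : R) @ \oo --> (0 : R).
Proof.
apply/cvgrPdist_le => e e0.
have /eqoP := C_small_dimension HS.
move=> /(_ _ e0); apply: filterS => n /=.
rewrite sum_level_sets sub0r normrN => h.
have [->|n0] := posnP n; first by rewrite expr0n/= invr0 mulr0 normr0 ltW.
by rewrite [leLHS]normrM normfV ler_pdivrMr// normr_gt0 expf_neq0// pnatr_eq0 -lt0n.
Qed.

End Coincidences.

Section ExpectedMoments.
Variables (R : realType) (I : choiceType) (S : nat -> nat -> I).
Hypothesis HS : C_condition R S.
Variables (k : nat) (wt : forall n, {ffun 'I_k -> 'I_n} -> R) (B : R).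
Hypothesis k0 : (0 < k)%N.
Local Notation class n := (colour_class (@colour _ S n) (@ord_pred k)).
Hypothesis wtB : forall n (v : {ffun 'I_k -> 'I_n}), `|wt v| <= B.
Hypothesis wt0 : forall n (v : {ffun 'I_k -> 'I_n}) e,
  #|class n v e| = 1%N -> wt v = 0.
Hypothesis wt1 : forall n (v : {ffun 'I_k -> 'I_n}),
  (forall e, #|class n v e| = 2%N) -> wt v = 1.

(** Divided by n^(1 + k/2), the error terms of [weighted_walks] are at most of order n^(-1/2) for
    multiple colours and coincidences / n^3 for crossings. Powers of sqrt n treat even and odd [k]
    together. *)
Lemma cvg_weighted_walks :
  (fun n => (\sum_(v : {ffun 'I_k -> 'I_n}) wt v) / (n%:R * Num.sqrt n%:R ^+ k) : R)
    @ \oo --> ((half_line_walks k 0)%:R : R).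
Proof.
have err : (fun n : nat => (B + 1) * (k ^ k)%:R * ((Num.sqrt n%:R)^-1 +
     #|colour_coincidences (@colour _ S n)|%:R / n%:R ^+ 3) : R) @ \oo --> (0 : R).
  rewrite -[X in _ --> X](mulr0 ((B + 1) * (k ^ k)%:R)); apply: cvgM.
    exact: cvg_cst.
  rewrite -[X in _ --> X]addr0; apply: cvgD; last exact: cvg_coincidences.
  exact: cvg_sqrt_natV.
apply/cvgrPdist_le => e e0.
have e20 : 0 < e / 2 by rewrite divr_gt0.
have := @cvg_tree_walks R k 0 => /cvgrPdist_le /(_ _ e20) tw.
move/cvgrPdist_le : err => /(_ _ e20) err.
near=> n.
have n0 : (0 < n)%N by near: n; exact: nbhs_infty_gt.
have := @weighted_walks R 'I_n I (@colour _ S n) k (@wt n) B (@colourC _ _ _ HS n) (@colour_inj _ _ _ HS n) k0.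
rewrite card_ord => /(_ n0 (@wtB n) (@wt0 n) (@wt1 n)).
set T := \sum_v _ => TP.
have : `|(half_line_walks k 0)%:R - (tree_walks n k 0)%:R * Num.sqrt n%:R ^+ 0 / Num.sqrt n%:R ^+ k| <= e / 2 :> R.
  by near: n.
have : `|0 - (B + 1) * (k ^ k)%:R * ((Num.sqrt n%:R)^-1 +
     #|colour_coincidences (@colour _ S n)|%:R / n%:R ^+ 3) | <= e / 2 :> R by near: n.
have B0 : 0 <= B by apply: le_trans (wtB [ffun=> Ordinal n0]).
have s1 : 1 <= Num.sqrt n%:R :> R by rewrite -[leLHS]sqrtr1 ler_wsqrtr// ler1n.
have sE : n%:R = Num.sqrt n%:R ^+ 2 :> R by rewrite sqr_sqrtr.
move: s1 sE; set s := Num.sqrt _ => s1 sE.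
have s0 : 0 < s by exact: lt_le_trans s1.
rewrite sub0r normrN ger0_norm; last first.
  by rewrite !mulr_ge0 ?addr_ge0 ?invr_ge0 ?(ltW s0)// divr_ge0.
rewrite expr0 mulr1 => err_n tw_n.
rewrite [e]splitr.
have -> : (half_line_walks k 0)%:R - T / (n%:R * s ^+ k) =
   ((half_line_walks k 0)%:R - (tree_walks n k 0)%:R / s ^+ k) -
   (T - (n * tree_walks n k 0)%:R) / (n%:R * s ^+ k).
  by rewrite natrM sE; field; rewrite expf_neq0 lt0r_neq0.
apply: le_trans (ler_normB _ _) _; apply: lerD => //.
have ns0 : 0 < n%:R * s ^+ k by rewrite mulr_gt0 ?ltr0n ?exprn_gt0.
rewrite normrM normfV [X in _ / X]gtr0_norm//.
apply: le_trans err_n; rewrite ler_pdivrMr//; apply: le_trans TP _.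
rewrite natrM [leLHS]mulrA -[leRHS]mulrA.
rewrite ler_wpM2l ?mulr_ge0 ?addr_ge0//.
rewrite mulrDl natrD lerD//.
  rewrite natrX exprS mulrCA ler_wpM2l//.
  rewrite mulrC ler_pdivlMr// sE -exprM -exprSr ler_weXn2l//; lia.
case: ltnP => k3; last by rewrite !mul0n mulr_ge0 ?(ltW ns0)// divr_ge0.
rewrite mul1n natrM -mulrA ler_wpM2l// mulrC ler_pdivlMr ?exprn_gt0 ?ltr0n//.
rewrite natrX sE -!exprM -!exprD ler_weXn2l//; lia.
Unshelve. all: by end_near. Qed.

End ExpectedMoments.

(** * Independence *)

Section BoundedMeasurable.
Context d (T : measurableType d) (R : realType).
Implicit Types f g : T -> R.

Definition bounded_measurable f :=
  measurable_fun setT f /\ exists M, forall w, `|f w| <= M.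

Lemma bounded_measurable_cst (c : R) : bounded_measurable (fun=> c).
Proof. by split => //; exists `|c|. Qed.

Lemma bounded_measurableD f g : bounded_measurable f -> bounded_measurable g ->
  bounded_measurable (fun w => f w + g w).
Proof.
move=> [mf [M fM]] [mg [N gN]]; split; first exact: measurable_funD.
by exists (M + N) => w; rewrite (le_trans (ler_normD _ _))// lerD.
Qed.

Lemma bounded_measurableM f g : bounded_measurable f -> bounded_measurable g ->
  bounded_measurable (fun w => f w * g w).
Proof.
move=> [mf [M fM]] [mg [N gN]]; split; first exact: measurable_funM.
by exists (M * N) => w; rewrite normrM ler_pM.
Qed.

Lemma bounded_measurableZ (c : R) f : bounded_measurable f ->
  bounded_measurable (fun w => c * f w).
Proof. by move=> ?; apply: bounded_measurableM => //; exact: bounded_measurable_cst. Qed.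

Lemma bounded_measurableB f g : bounded_measurable f -> bounded_measurable g ->
  bounded_measurable (fun w => f w - g w).
Proof.
move=> [mf [M fM]] [mg [N gN]]; split; first exact: measurable_funB.
by exists (M + N) => w; rewrite (le_trans (ler_normB _ _))// lerD.
Qed.

Lemma bounded_measurable_sum (A : Type) (s : seq A) (F : A -> T -> R) :
  (forall a, bounded_measurable (F a)) ->
  bounded_measurable (fun w => \sum_(a <- s) F a w).
Proof.
move=> mF; elim: s => [|a s IH].
  by under eq_fun do rewrite big_nil; exact: bounded_measurable_cst.
by under eq_fun do rewrite big_cons; exact: bounded_measurableD.
Qed.

Lemma bounded_measurable_prod (A : Type) (s : seq A) (F : A -> T -> R) :
  (forall a, bounded_measurable (F a)) ->
  bounded_measurable (fun w => \prod_(a <- s) F a w).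
Proof.
move=> mF; elim: s => [|a s IH].
  by under eq_fun do rewrite big_nil; exact: bounded_measurable_cst.
by under eq_fun do rewrite big_cons; exact: bounded_measurableM.
Qed.

Lemma bounded_measurableX f n : bounded_measurable f ->
  bounded_measurable (fun w => f w ^+ n).
Proof.
move=> mf; elim: n => [|n IH].
  by under eq_fun do rewrite expr0; exact: bounded_measurable_cst.
by under eq_fun do rewrite exprS; exact: bounded_measurableM.
Qed.

Lemma bounded_measurable_indic (A : set T) : measurable A ->
  bounded_measurable (\1_A : T -> R).
Proof.
move=> mA; split; first exact: measurable_indic.
by exists 1 => w; rewrite indicE; case: (_ \in _); rewrite ?normr1 ?normr0.
Qed.

End BoundedMeasurable.

Lemma bounded_measurable_comp d d' (T : measurableType d) (T' : measurableType d')
    (R : realType) (g : T' -> R) (f : T -> T') :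
  measurable_fun setT f -> bounded_measurable g ->
  bounded_measurable (fun w => g (f w)).
Proof.
by move=> mf [mg [M gM]]; split; [exact: measurableT_comp|exists M].
Qed.

Section Expectation.
Context d (T : measurableType d) (R : realType) (P : probability T R).
Local Notation Ex f := (Rintegral P setT f).
Local Notation bm := (@bounded_measurable d T R).
Implicit Types f g : T -> R.

Lemma bounded_measurable_integrable f : bm f -> P.-integrable setT (EFin \o f).
Proof.
move=> [mf [M fM]]; apply: measurable_bounded_integrable => //.
  by rewrite -ge0_fin_numE//; exact: fin_num_measure.
by exists M; split; [exact: num_real|move=> x Mx w _; exact: le_trans (fM w) (ltW Mx)].
Qed.

Local Notation bmi := bounded_measurable_integrable.

Lemma Ex_cst (c : R) : Ex (fun=> c) = c.
Proof.
rewrite Rintegral_cst//; transitivity (c * fine (P setT)) => //.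
by rewrite probability_setT mulr1.
Qed.

Lemma ExD f g : bm f -> bm g -> Ex (fun w => f w + g w) = Ex f + Ex g.
Proof. by move=> ? ?; rewrite RintegralD//; exact: bmi. Qed.

Lemma ExB f g : bm f -> bm g -> Ex (fun w => f w - g w) = Ex f - Ex g.
Proof. by move=> ? ?; rewrite RintegralB//; exact: bmi. Qed.

Lemma ExZ c f : bm f -> Ex (fun w => c * f w) = c * Ex f.
Proof. by move=> ?; rewrite RintegralZl//; exact: bmi. Qed.

Lemma Ex_sum (A : Type) (s : seq A) (F : A -> T -> R) : (forall a, bm (F a)) ->
  Ex (fun w => \sum_(a <- s) F a w) = \sum_(a <- s) Ex (F a).
Proof.
move=> mF; elim: s => [|a s IH].
  by under eq_fun do rewrite big_nil; rewrite big_nil Ex_cst.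
under eq_fun do rewrite big_cons.
by rewrite big_cons -IH ExD//; exact: bounded_measurable_sum.
Qed.

Lemma Ex_le f g : bm f -> bm g -> (forall w, f w <= g w) -> Ex f <= Ex g.
Proof. by move=> ? ? fg; apply: le_Rintegral => //; exact: bmi. Qed.

Lemma Ex_norm f M : bm f -> (forall w, `|f w| <= M) -> `|Ex f| <= M.
Proof.
move=> mf fM; have cM := bounded_measurable_cst T M.
rewrite ler_norml -{2}(Ex_cst M) -[X in X <= _ <= _]Ex_cst.
by apply/andP; split; apply: Ex_le => //; try exact: bounded_measurable_cst;
  move=> w; have := fM w; rewrite ler_norml => /andP[].
Qed.

Lemma Ex_indic (A : set T) : measurable A -> Ex (\1_A) = fine (P A).
Proof. by move=> mA; rewrite /Rintegral integral_indic// setIT. Qed.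

End Expectation.

(** The sum of indicators is the integer part of [x]. *)
Lemma staircase (R : realType) (x : R) (n : nat) : 0 <= x <= n%:R ->
  `|x - \sum_(i < n) \1_[set y | i.+1%:R <= y] x| <= 1.
Proof.
move=> /andP[x0 xn].
have tn : (Num.truncn x <= n)%N by rewrite -(ler_nat R) (le_trans _ xn)// truncn_le.
have -> : \sum_(i < n) \1_[set y | i.+1%:R <= y] x = (Num.truncn x)%:R :> R.
  transitivity (\sum_(i < n) (if (i < Num.truncn x)%N then 1 else 0 : R)).
    apply: eq_bigr => i _; rewrite indicE truncn_gt_nat.
    by case: ifPn => xi; [rewrite mem_set|rewrite memNset//; exact/negP].
  by rewrite -big_mkcond /= -(big_ord_widen n (fun=> 1 : R) tn) sumr_const card_ord.
rewrite ger0_norm ?subr_ge0 ?truncn_le//.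
have := truncnS_gt x; rewrite -natr1; lra.
Qed.

Section BoundedFunctional.
Context d (T : measurableType d) (R : realType).

(** The uniform constant [C] expresses continuity for the supremum norm. The notion serves both for
    factorization under independence and for integration against the semicircle density. *)
Definition bounded_functional (L : (T -> R) -> R) := [/\
  forall f g, bounded_measurable f -> bounded_measurable g ->
    L (fun x => f x + g x) = L f + L g,
  forall c f, bounded_measurable f -> L (fun x => c * f x) = c * L f &
  exists C, forall f M, bounded_measurable f -> (forall x, `|f x| <= M) ->
    `|L f| <= C * M].

(* Indicators determine [L] since staircases approximate uniformly. *)
Lemma bounded_functional_eq0 (L : (T -> R) -> R) (phi : T -> R) :
  bounded_functional L -> (forall B, measurable B -> L (\1_B) = 0) ->
  bounded_measurable phi -> L phi = 0.
Proof.
move=> [LD LZ [C LC]] L0 bphi; have [mphi [M0 phiM0]] := bphi.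
pose M := `|M0| + 1; have M_gt0 : 0 < M by rewrite ltr_pwDr.
have phiM y : `|phi y| <= M by rewrite (le_trans (phiM0 y))// (le_trans (ler_norm _))// lerDl.
pose N := `|C| + 1; have N_gt0 : 0 < N by rewrite ltr_pwDr.
apply/eqP; rewrite -normr_le0; apply/ler_addgt0Pl => e e0; rewrite addr0.
(* A staircase with [n] steps across [-M, M] has mesh 2M/n, and this [n] makes [N] times the mesh
   smaller than [e]. *)
pose n := (Num.truncn (2 * M * N / e)).+1.
have nP : 2 * M * N / e < n%:R by exact: truncnS_gt.
have n0 : 0 < n%:R :> R by [].
pose c := 2 * M / n%:R.
have c0 : 0 < c by rewrite divr_gt0// mulr_gt0.
have nc : n%:R * c = 2 * M by rewrite /c mulrC divfK// gt_eqF.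
pose B (i : 'I_n) := (fun y => (phi y + M) / c) @^-1` [set y | i.+1%:R <= y].
have mB i : measurable (B i).
  rewrite /B -[X in measurable X]setTI.
  have mf : measurable_fun setT (fun y => (phi y + M) / c).
    by apply: measurable_funM => //; apply: measurable_funD.
  apply: mf => //.
  rewrite (_ : [set y : R | _] = `[i.+1%:R, +oo[%classic)//.
  by apply/seteqP; split => y /=; rewrite in_itv/= andbT.
have bI i : bounded_measurable (\1_(B i) : T -> R) by exact: bounded_measurable_indic.
pose S y : R := \sum_(i < n) \1_(B i) y.
have bS : bounded_measurable S by exact: bounded_measurable_sum.
have LS : L S = 0.
  rewrite /S; elim: (index_enum _) => [|i s IH].
    under eq_fun do rewrite big_nil.
    have := LZ 0 (\1_setT) (bounded_measurable_indic _ measurableT).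
    by rewrite mul0r; under eq_fun do rewrite mul0r.
  under eq_fun do rewrite big_cons.
  by rewrite LD ?IH ?L0 ?addr0//; exact: bounded_measurable_sum.
(* The staircase approximates the nonnegative function phi + M; the constant is written as an
   indicator, so that [L0] applies to it too. *)
pose phin y := c * S y + (- M) * \1_setT y.
have b1 : bounded_measurable (\1_setT : T -> R).
  exact: bounded_measurable_indic.
have bphin : bounded_measurable phin.
  by apply: bounded_measurableD; exact: bounded_measurableZ.
have Lphin : L phin = 0.
  rewrite LD; [|exact: bounded_measurableZ..].
  by rewrite !LZ// LS L0// !mulr0 addr0.
have close y : `|phi y - phin y| <= c.
  have := @staircase R ((phi y + M) / c) n.
  have := phiM y; rewrite ler_norml => /andP[My yM].
  have -> : (phi y + M) / c <= n%:R.
    by rewrite ler_pdivrMr// nc; lra.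
  have -> : 0 <= (phi y + M) / c by rewrite divr_ge0 ?(ltW c0)//; lra.
  move=> /(_ erefl) h.
  have -> : phi y - phin y = c * ((phi y + M) / c - S y).
    by rewrite /phin indicT/=; field; rewrite gt_eqF.
  by rewrite normrM gtr0_norm// ler_piMr ?(ltW c0).
have -> : L phi = L (fun y => (phi y - phin y) + phin y).
  by congr L; apply/funext => y; rewrite subrK.
rewrite LD ?Lphin ?addr0//; last exact: bounded_measurableB.
apply: le_trans (LC _ _ (bounded_measurableB bphi bphin) close) _.
apply: (@le_trans _ _ (N * c)).
  by rewrite ler_wpM2r ?(ltW c0)// (le_trans (ler_norm _))// lerDl.
by rewrite /c; move: nP; rewrite ltr_pdivrMr// mulrA ler_pdivrMr//; lra.
Qed.

End BoundedFunctional.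

Section Decoupling.
Context d (T : measurableType d) (R : realType) (P : probability T R).
Local Notation Ex f := (Rintegral P setT f).

(** For fixed [Z] and [Y] the defect of factorization is a bounded functional of [phi], and it
    vanishes on indicators by assumption. *)
Lemma Ex_decouple (Z Y : T -> R) (phi : R -> R) :
  bounded_measurable Z -> measurable_fun setT Y -> bounded_measurable phi ->
  (forall B : set R, measurable B ->
    Ex (fun w => Z w * \1_B (Y w)) = Ex Z * Ex (fun w => \1_B (Y w))) ->
  Ex (fun w => Z w * phi (Y w)) = Ex Z * Ex (fun w => phi (Y w)).
Proof.
move=> bZ mY bphi ind; have [N ZN] := bZ.2.
have bY f : bounded_measurable f -> bounded_measurable (fun w => f (Y w)).
  exact: bounded_measurable_comp.
have bZY f : bounded_measurable f -> bounded_measurable (fun w => Z w * f (Y w)).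
  by move=> bf; apply: bounded_measurableM => //; exact: bY.
pose L f := Ex (fun w => Z w * f (Y w)) - Ex Z * Ex (fun w => f (Y w)).
suff : L phi = 0 by move/eqP; rewrite subr_eq0 => /eqP.
apply: bounded_functional_eq0 => //; last first.
  by move=> B mB; rewrite /L ind// subrr.
rewrite /L; split.
- move=> f g bf bg; under eq_fun do rewrite mulrDr.
  rewrite !ExD//; do ?[exact: bY|exact: bZY].
  by ring.
- move=> c f bf; under eq_fun do rewrite mulrCA.
  rewrite !ExZ//; do 1?[exact: bZY|exact: bY]; ring.
- exists (N + `|Ex Z|) => f M bf fM.
  rewrite (le_trans (ler_normB _ _))// mulrDl lerD//.
    apply: Ex_norm; first exact: bZY.
    by move=> w; rewrite normrM ler_pM.
  by rewrite normrM ler_wpM2l// Ex_norm//; exact: bY.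
Qed.

Variables (I : choiceType) (X : I -> {RV P >-> R}).
Hypothesis X_indep : mutually_independent X.

(** Independence is given for events, so the factors are generalized one at a time: induction on a
    list [A] outside of which every factor is an indicator, with [Ex_decouple] at each step. *)
Lemma Ex_prod_indep (J : seq I) (phi : I -> R -> R) : uniq J ->
  (forall i, bounded_measurable (phi i)) ->
  Ex (fun w => \prod_(i <- J) phi i (X i w)) =
  \prod_(i <- J) Ex (fun w => phi i (X i w)).
Proof.
move=> uJ.
have on_J (f g : I -> R -> R) : (forall i, i \in J -> f i = g i) ->
    Ex (fun w => \prod_(i <- J) f i (X i w)) = \prod_(i <- J) Ex (fun w => f i (X i w)) ->
    Ex (fun w => \prod_(i <- J) g i (X i w)) = \prod_(i <- J) Ex (fun w => g i (X i w)).
  move=> fg.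
  have -> : (fun w => \prod_(i <- J) f i (X i w)) = (fun w => \prod_(i <- J) g i (X i w)).
    by apply/funext => w; apply: eq_big_seq => i iJ; rewrite fg.
  by move=> ->; apply: eq_big_seq => i iJ; rewrite fg.
suff prod_on (A : seq I) (psi : I -> R -> R) : (forall i, bounded_measurable (psi i)) ->
    (forall i, i \notin A -> exists2 B, measurable B & psi i = \1_B) ->
    Ex (fun w => \prod_(i <- J) psi i (X i w)) =
    \prod_(i <- J) Ex (fun w => psi i (X i w)).
  (* Off [J] the functions can be changed freely; with a constant indicator there, [J] itself serves
     as [A]. *)
  move=> bphi; apply: (on_J (fun i => if i \in J then phi i else \1_setT)).
    by move=> i ->.
  apply: (prod_on J (fun i => if i \in J then phi i else \1_setT)).
    by move=> i; case: ifP => // _; exact: bounded_measurable_indic.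
  by move=> i /negbTE ->; exists setT.
elim: A psi => [|a A IH] psi bpsi iA.
  have /choice[B HB] : forall i, exists B, measurable B /\ psi i = \1_B.
    by move=> i; have [B ? ?] := iA i isT; exists B.
  pose J' := [fset i in J]%fset.
  have J'P : perm_eq J J'.
    by apply: uniq_perm => // i; rewrite !inE.
  have mX i : measurable (X i @^-1` B i).
    have mXi : measurable_fun setT (X i) by [].
    by rewrite -[Y in measurable Y]setTI; exact: mXi measurableT _ (HB i).1.
  have mC : measurable (\bigcap_(i in [set` J']) (X i @^-1` B i)).
    by apply: fin_bigcap_measurable => // i _; exact: mX.
  transitivity (Ex (\1_(\bigcap_(i in [set` J']) (X i @^-1` B i)))).
    congr (Rintegral _ _ _); apply/funext => w.
    have [wB|] := boolP (w \in \bigcap_(i in [set` J']) (X i @^-1` B i)).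
      rewrite indicE wB big1_seq// => i /= iJ.
      move/set_mem : wB => /(_ i); rewrite /= inE => /(_ iJ) wB.
      by rewrite (HB i).2 indicE mem_set.
    move=> wB; rewrite indicE (negbTE wB).
    have [i iJ Bi] : exists2 i, i \in J & ~ B i (X i w).
      apply: contrapT => h; move/negP : wB; apply; apply/mem_set => i /=.
      by rewrite inE => iJ; apply: contrapT => Bi; apply: h; exists i.
    by rewrite (big_rem i)//= (HB i).2 indicE memNset// mul0r.
  rewrite Ex_indic// X_indep; last by move=> i _; exact: (HB i).1.
  rewrite -(perm_big _ J'P).
  rewrite (eq_bigr (fun i => (Ex (fun w => psi i (X i w)))%:E)) ?prodEFin//.
  move=> i _; rewrite (HB i).2 (_ : (fun w => _) = \1_(X i @^-1` B i))//.
  by rewrite Ex_indic// fineK// fin_num_measure.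
pose upd f i := if i == a then f else psi i.
have bupd f : bounded_measurable f -> forall i, bounded_measurable (upd f i).
  by move=> bf i; rewrite /upd; case: ifP.
have iupd (B : set R) : measurable B -> forall i, i \notin A ->
    exists2 B', measurable B' & upd \1_B i = \1_B'.
  move=> mB i iA'; rewrite /upd; case: eqVneq => [_|ia]; first by exists B.
  by apply: iA; rewrite inE negb_or ia.
have updE f i : i != a -> upd f i = psi i by rewrite /upd => /negbTE ->.
have [aJ|aJ] := boolP (a \in J); last first.
  apply: (on_J (upd \1_setT)).
    by move=> i iJ; rewrite updE//; apply: contraNneq aJ => <-.
  apply: IH; last exact: iupd.
  by apply: bupd; exact: bounded_measurable_indic.
set Z := fun w => \prod_(i <- J | i != a) psi i (X i w).
have split f w : \prod_(i <- J) upd f i (X i w) = Z w * f (X a w).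
  rewrite (bigD1_seq a)//= /upd eqxx mulrC; congr (_ * _).
  by apply: eq_bigr => i /negbTE ->.
have splitE f : \prod_(i <- J) Ex (fun w => upd f i (X i w)) =
    (\prod_(i <- J | i != a) Ex (fun w => psi i (X i w))) * Ex (fun w => f (X a w)).
  rewrite (bigD1_seq a)//= mulrC; congr (_ * _); last by rewrite /upd eqxx.
  by apply: eq_bigr => i ia; rewrite updE.
have psiE : psi = upd (psi a) by apply/funext => i; rewrite /upd; case: eqVneq => [->|].
have bX i : bounded_measurable (fun w => psi i (X i w)).
  by apply: bounded_measurable_comp.
have indB (B : set R) : measurable B ->
    Ex (fun w => Z w * \1_B (X a w)) =
    (\prod_(i <- J | i != a) Ex (fun w => psi i (X i w))) * Ex (fun w => \1_B (X a w)).
  move=> mB; have := IH (upd \1_B) (bupd _ (bounded_measurable_indic _ mB)) (iupd _ mB).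
  by rewrite splitE => <-; congr (Rintegral _ _ _); apply/funext => w; rewrite split.
have EZ : Ex Z = \prod_(i <- J | i != a) Ex (fun w => psi i (X i w)).
  have := indB setT measurableT.
  under eq_fun do rewrite indicT /= mulr1.
  by under [X in _ = _ * Rintegral _ _ X -> _]eq_fun do rewrite indicT /=; rewrite Ex_cst mulr1.
rewrite psiE splitE -EZ.
under eq_fun do rewrite split.
apply: Ex_decouple => //.
- rewrite /Z; under eq_fun do rewrite -big_filter.
  exact: bounded_measurable_prod.
- by move=> B mB; rewrite indB// EZ.
Qed.

End Decoupling.

(** * Expectations of products of entries *)

Section Weights.
Context d (T : measurableType d) (R : realType) (P : probability T R).
Variables (I : choiceType) (X : I -> {RV P >-> R}) (psi : R -> R) (B : R) (mu : nat -> R).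
Local Notation Ex f := (Rintegral P setT f).
Hypothesis X_indep : mutually_independent X.
Hypothesis mpsi : measurable_fun setT psi.
Hypothesis psiB : forall y, `|psi y| <= B.
Hypothesis muE : forall i p, Ex (fun w => psi (X i w) ^+ p) = mu p.
Hypothesis mu1 : mu 1 = 0.
Hypothesis mu2 : mu 2 = 1.

Lemma bounded_measurable_psi : bounded_measurable psi.
Proof. by split => //; exists B. Qed.

Lemma bounded_measurable_psiX i : bounded_measurable (fun w => psi (X i w)).
Proof. by apply: bounded_measurable_comp => //; exact: bounded_measurable_psi. Qed.

Definition weight (E : finType) (c : E -> I) : R :=
  Ex (fun w => \prod_e psi (X (c e) w)).

(** Edges are grouped by colour. Allowing [J] to contain absent colours lets two walks and their
    union share one list in [weight_unlinked]. *)
Lemma weightE (E : finType) (c : E -> I) (J : seq I) : uniq J ->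
  (forall e, c e \in J) -> weight c = \prod_(i <- J) mu #|[set e | c e == i]%SET|.
Proof.
move=> uJ cJ; have -> : weight c = Ex (fun w =>
    \prod_(i <- J) psi (X i w) ^+ #|[set e | c e == i]%SET|).
  congr (Rintegral _ _ _); apply/funext => w.
  transitivity (\prod_e \prod_(i <- J | c e == i) psi (X i w)).
    apply: eq_bigr => e _; rewrite big_mkcond (bigD1_seq (c e))//= eqxx.
    by rewrite big1 ?mulr1// => i; rewrite eq_sym => /negbTE ->.
  rewrite (exchange_big_dep predT)//=; apply: eq_bigr => i _.
  by rewrite prodr_const cardsE.
rewrite (@Ex_prod_indep _ _ _ _ _ _ X_indep J (fun i y => psi y ^+ #|[set e | c e == i]%SET|))//.
  by apply: eq_bigr => i _; rewrite muE.
by move=> i; apply: bounded_measurableX; exact: bounded_measurable_psi.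
Qed.

Lemma weight_bound (E : finType) (c : E -> I) : `|weight c| <= B ^+ #|E|.
Proof.
apply: Ex_norm.
  by apply: bounded_measurable_prod => e; exact: bounded_measurable_psiX.
move=> w; rewrite normr_prod -prodr_const; apply: ler_prod => e _.
by rewrite normr_ge0 psiB.
Qed.

Lemma weight_single (E : finType) (c : E -> I) e0 :
  #|[set e | c e == c e0]%SET| = 1%N -> weight c = 0.
Proof.
move=> c1; rewrite (@weightE _ _ (undup (codom c))) ?undup_uniq//; last first.
  by move=> e; rewrite mem_undup codom_f.
by rewrite (big_rem (c e0)) ?mem_undup ?codom_f//= c1 mu1 mul0r.
Qed.

Lemma weight_pairs (E : finType) (c : E -> I) :
  (forall e0, #|[set e | c e == c e0]%SET| = 2%N) -> weight c = 1.
Proof.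
move=> c2; rewrite (@weightE _ _ (undup (codom c))) ?undup_uniq//; last first.
  by move=> e; rewrite mem_undup codom_f.
by rewrite big1_seq// => i /=; rewrite mem_undup => /codomP[e ->]; rewrite c2.
Qed.

Lemma weight_unlinked (E1 E2 : finType) (c : E1 + E2 -> I) :
  (forall e e', c (inl e) != c (inr e')) ->
  weight c = weight (c \o inl) * weight (c \o inr).
Proof.
(* That [mu 0] is 1 is read off [muE] at some index. Without any index there are no edges and all
   products are empty. *)
move=> cc; have [i0|nI] := pselect (exists i : I, True); last first.
  have e1 (F : finType) (f : F -> I) : weight f = 1.
    rewrite /weight (_ : (fun w => _) = fun=> 1) ?Ex_cst//.
    by apply/funext => w; rewrite big1// => e; case: nI; exists (f e).
  by rewrite !e1 mulr1.
have mu0 : mu 0 = 1 by case: i0 => i _; rewrite -(muE i) Ex_cst.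
have uJ := undup_uniq (codom c).
have cJ e : c e \in undup (codom c) by rewrite mem_undup codom_f.
rewrite !(weightE uJ)//; try by move=> e; exact: cJ.
rewrite -big_split; apply: eq_bigr => i _ /=.
have -> : #|[set e | c e == i]%SET| =
    (#|[set e | c (inl e) == i]%SET| + #|[set e | c (inr e) == i]%SET|)%N.
  by rewrite -!sum1dep_card big_sumType.
have [[e ei]|h] := pselect (exists e, c (inl e) = i).
  suff -> : #|[set e | c (inr e) == i]%SET| = 0%N by rewrite addn0 mu0 mulr1.
  by apply: eq_card0 => e'; rewrite inE -ei eq_sym (negbTE (cc _ _)).
suff -> : #|[set e | c (inl e) == i]%SET| = 0%N by rewrite add0n mu0 mul1r.
by apply: eq_card0 => e'; rewrite inE; apply/negbTE/eqP => ei; apply: h; exists e'.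
Qed.

End Weights.

(** * Traces of powers as sums over closed walks *)

Section Traces.
Variable R : comNzRingType.

Definition mxpow n (A : 'M[R]_n) k : 'M[R]_n := iter k (mulmx A) 1%:M.

Lemma mxpowE n (A : 'M[R]_n) k i j : mxpow A k i j =
  \sum_(s : k.-tuple 'I_n | last i s == j) \prod_(a <- pairmap A i s) a.
Proof.
rewrite big_mkcond; elim: k i => [|k IH] i /=.
  rewrite (eq_bigr (fun=> (i == j)%:R)); last first.
    by move=> s _; rewrite tuple0 /= big_nil; case: eqP.
  by rewrite sumr_const card_tuple expn0 mxE.
rewrite (sum_tuple_cons _ _ (fun s => if last i s == j then \prod_(a <- pairmap A i s) a else 0)).
rewrite mxE; apply: eq_bigr => y _; rewrite IH mulr_sumr; apply: eq_bigr => s _ /=.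
by rewrite big_cons; case: ifP; rewrite ?mulr0.
Qed.

Lemma mxtrace_mxpow n (A : 'M[R]_n) k : (0 < k)%N ->
  \tr (mxpow A k) =
  \sum_(v : {ffun 'I_k -> 'I_n}) \prod_(e < k) A (v (ord_pred e)) (v e).
Proof.
case: n A => [|n] A k0.
  rewrite /mxtrace big_ord0 big1// => v _; have [] := v (Ordinal k0); by [].
rewrite /mxtrace; under eq_bigr do rewrite mxpowE big_mkcond /=.
rewrite exchange_big (reindex (fun s : k.-tuple 'I_n.+1 => [ffun i => tnth s i])) /=.
  apply: eq_bigr => s _; rewrite (bigD1 (last ord0 s))//= [X in _ + X]big1 => [|i iE].
    have -> : last (last ord0 s) s = last ord0 s.
      by case: s => -[|x s] //= sk; rewrite -(eqP sk) in k0.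
    rewrite eqxx addr0 -(colour_wordE A ord0) big_map big_enum/=.
    by [].
  rewrite ifN//; apply: contraNneq iE => <-; apply/eqP.
  by case: s => -[|x s] //= sk; rewrite -(eqP sk) in k0.
exists (fun v : {ffun 'I_k -> 'I_n.+1} => [tuple v i | i < k]) => [s _|v _].
  by apply: eq_from_tnth => i; rewrite tnth_mktuple ffunE.
by apply/ffunP => i; rewrite ffunE tnth_mktuple.
Qed.

End Traces.

(** * Variance and almost sure convergence along squares *)

Section AlmostSure.
Context d (T : measurableType d) (R : realType) (P : probability T R).
Local Notation Ex f := (Rintegral P setT f).

(** The second moments are summable, so the series of squares has finite integral, is finite almost
    everywhere, and its terms tend to 0. *)
Lemma ae_cvg0 (Y : nat -> T -> R) (K : R) :
  (forall m, bounded_measurable (Y m)) ->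
  (forall m, Ex (fun w => Y m w ^+ 2) <= K / m.+1%:R ^+ 2) ->
  {ae P, forall w, (fun m => Y m w) @ \oo --> (0 : R)}.
Proof.
move=> bY YK.
have bY2 m : bounded_measurable (fun w => Y m w ^+ 2) by exact: bounded_measurableX.
have K0 : 0 <= K.
  have := YK 0%N; rewrite expr1n divr1; apply: le_trans.
  by apply: Rintegral_ge0 => w _; exact: sqr_ge0.
pose F m w := (Y m w ^+ 2)%:E.
have F0 m w : (0 <= F m w)%E by rewrite lee_fin sqr_ge0.
have mF m : measurable_fun setT (F m) by apply/measurable_EFinP; exact: (bY2 m).1.
have part N : \sum_(m < N) K / m.+1%:R ^+ 2 <= 2 * K.
  (* Strengthened to telescope through 1/(N + 1)^2 <= 1/N - 1/(N + 1); at N = 0 the inverse is 0 by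
     convention. *)
  suff : \sum_(m < N) K / m.+1%:R ^+ 2 <= 2 * K - K / N%:R.
    by move=> h; apply: le_trans h _; rewrite gerBl divr_ge0.
  elim: N => [|[|N] IH].
  - by rewrite big_ord0 invr0 mulr0 subr0 mulr_ge0.
  - by rewrite big_ord_recl big_ord0 expr1n divr1; lra.
  rewrite big_ord_recr /=; apply: le_trans (lerD IH (lexx _)) _.
  have a0 : 0 < N.+1%:R :> R by [].
  rewrite -[N.+2%:R]natr1; move: N.+1%:R a0 => a a0.
  have a1 : 0 < a + 1 by lra.
  rewrite -subr_ge0.
  have -> : 2 * K - K / (a + 1) - (2 * K - K / a + K / (a + 1) ^+ 2) =
    K / (a * (a + 1) ^+ 2).
    by field; rewrite !gt_eqF.
  by rewrite divr_ge0// mulr_ge0 ?ltW// exprn_gt0.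
have intS : (\int[P]_w (\sum_(m <oo) F m w) < +oo)%E.
  rewrite integral_nneseries//.
  apply: (@le_lt_trans _ _ (2 * K)%:E); last by rewrite ltry.
  apply: lime_le; first by apply: is_cvg_nneseries => n _ _; exact: integral_ge0.
  near=> N; apply: (@le_trans _ _ (\sum_(0 <= m < N) (K / m.+1%:R ^+ 2)%:E)%E).
    apply: lee_sum => m _.
    rewrite -(@fineK _ (\int[P]_x F m x)%E) ?lee_fin; first exact: YK.
    exact: integrable_fin_num (bounded_measurable_integrable P (bY2 m)).
  by rewrite sumEFin lee_fin big_mkord.
have mS : measurable_fun setT (fun w => \sum_(m <oo) F m w)%E.
  by apply: ge0_emeasurable_sum.
have : P.-integrable setT (fun w => \sum_(m <oo) F m w)%E.
  apply/integrableP; split => //.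
  by under eq_integral => w _ do rewrite gee0_abs ?nneseries_ge0//.
move=> /(integrable_ae measurableT); apply: filterS => w /(_ I) fin.
have : (fun m => Y m w ^+ 2) @ \oo --> (0 : R).
  apply: (@cvg_series_cvg_0 _ R^o); apply: nondecreasing_is_cvgn.
    by apply: nondecreasing_series => m _ _; exact: sqr_ge0.
  exists (fine (\sum_(m <oo) F m w)%E) => _ [N _ <-].
  rewrite /series /= -lee_fin fineK// -sumEFin.
  by apply: (@nneseries_lim_ge _ (F ^~ w) xpredT 0%N N) => m _ _; exact: F0.
move=> c0; apply/cvgrPdist_lt => e e0.
have e20 : 0 < e ^+ 2 by rewrite exprn_gt0.
move/cvgrPdist_lt : c0 => /(_ _ e20); apply: filterS => m.
rewrite !sub0r !normrN normrX ltr_pXn2r ?nnegrE//; exact: ltW.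
Unshelve. all: by end_near. Qed.

End AlmostSure.

Section Variance.
Context d (T : measurableType d) (R : realType) (P : probability T R).
Variables (I : choiceType) (X : I -> {RV P >-> R}) (psi : R -> R) (B : R) (mu : nat -> R).
Local Notation Ex f := (Rintegral P setT f).
Hypothesis X_indep : mutually_independent X.
Hypothesis mpsi : measurable_fun setT psi.
Hypothesis psiB : forall y, `|psi y| <= B.
Hypothesis muE : forall i p, Ex (fun w => psi (X i w) ^+ p) = mu p.
Hypothesis mu1 : mu 1 = 0.
Hypothesis mu2 : mu 2 = 1.
Variable S : nat -> nat -> I.
Hypothesis HS : C_condition R S.
Variable k : nat.
Hypothesis k0 : (0 < k)%N.

Local Notation weight := (weight X psi).

Definition walk_colour n (v : {ffun 'I_k -> 'I_n}) : 'I_k -> I :=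
  edge_colour (@colour I S n) (@ord_pred k) v.

Definition trace_power n (w : T) : R :=
  \tr (mxpow (patterned_matrix S (fun i => psi (X i w)) n) k).

Lemma trace_powerE n w : trace_power n w =
  \sum_(v : {ffun 'I_k -> 'I_n}) \prod_e psi (X (walk_colour v e) w).
Proof.
rewrite /trace_power mxtrace_mxpow//; apply: eq_bigr => v _.
by apply: eq_bigr => e _; rewrite mxE.
Qed.

Lemma bounded_measurable_walk n (v : {ffun 'I_k -> 'I_n}) :
  bounded_measurable (fun w => \prod_e psi (X (walk_colour v e) w)).
Proof.
by apply: bounded_measurable_prod => e; exact: (bounded_measurable_psiX X mpsi psiB _).
Qed.

Lemma bounded_measurable_trace n : bounded_measurable (trace_power n).
Proof.
rewrite (_ : trace_power n = fun w => \sum_(v : {ffun 'I_k -> 'I_n})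
  \prod_e psi (X (walk_colour v e) w)); last by apply/funext => w; exact: trace_powerE.
by apply: bounded_measurable_sum => v; exact: bounded_measurable_walk.
Qed.

Lemma Ex_trace_power n : Ex (trace_power n) =
  \sum_(v : {ffun 'I_k -> 'I_n}) weight (walk_colour v).
Proof.
rewrite -Ex_sum; last exact: bounded_measurable_walk.
by congr (Rintegral _ _ _); apply/funext => w; rewrite trace_powerE.
Qed.

Lemma cvg_Ex_trace_power :
  (fun n => Ex (trace_power n) / (n%:R * Num.sqrt n%:R ^+ k)) @ \oo
    --> ((half_line_walks k 0)%:R : R).
Proof.
under eq_fun do rewrite Ex_trace_power.
apply: (@cvg_weighted_walks R I S HS k (fun n v => weight (walk_colour v)) (B ^+ k)) => //.
- by move=> n v; have := weight_bound X mpsi psiB (walk_colour v); rewrite card_ord.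
- by move=> n v e; exact: (weight_single X_indep mpsi psiB muE mu1).
- by move=> n v; exact: (weight_pairs X_indep mpsi psiB muE mu2).
Qed.

Definition left_walk n (v : {ffun 'I_k + 'I_k -> 'I_n}) : {ffun 'I_k -> 'I_n} :=
  [ffun i => v (inl i)].
Definition right_walk n (v : {ffun 'I_k + 'I_k -> 'I_n}) : {ffun 'I_k -> 'I_n} :=
  [ffun i => v (inr i)].

Definition walks_colour n (v : {ffun 'I_k + 'I_k -> 'I_n}) : 'I_k + 'I_k -> I :=
  edge_colour (@colour I S n) (@sum_pred k) v.

Lemma walks_colour_inl n (v : {ffun 'I_k + 'I_k -> 'I_n}) :
  walks_colour v \o inl = walk_colour (left_walk v).
Proof. by apply/funext => e; rewrite /walk_colour /edge_colour /left_walk /right_walk !ffunE. Qed.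

Lemma walks_colour_inr n (v : {ffun 'I_k + 'I_k -> 'I_n}) :
  walks_colour v \o inr = walk_colour (right_walk v).
Proof. by apply/funext => e; rewrite /walk_colour /edge_colour /left_walk /right_walk !ffunE. Qed.

Lemma sum_walk_pairs n (F : {ffun 'I_k -> 'I_n} -> {ffun 'I_k -> 'I_n} -> R) :
  \sum_v1 \sum_v2 F v1 v2 =
  \sum_(v : {ffun 'I_k + 'I_k -> 'I_n}) F (left_walk v) (right_walk v).
Proof.
rewrite pair_bigA (reindex (fun v : {ffun 'I_k + 'I_k -> 'I_n} => (left_walk v, right_walk v)))//.
exists (fun p : {ffun 'I_k -> 'I_n} * {ffun 'I_k -> 'I_n} =>
    [ffun e => match e with inl i => p.1 i | inr i => p.2 i end]) => [v _|[v1 v2] _].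
  by apply/ffunP => -[i|i]; rewrite /left_walk /right_walk !ffunE /= ?ffunE.

by congr (_, _); apply/ffunP => i; rewrite /left_walk /right_walk !ffunE.
Qed.

(** The variance is a sum of covariances over pairs of walks, seen as one walk on two disjoint
    cycles. A colour used once kills both the joint weight and the weight of the walk carrying it;
    unlinked walks are uncorrelated by independence. *)
Lemma variance_trace_power n : (0 < n)%N ->
  Ex (fun w => (trace_power n w - Ex (trace_power n)) ^+ 2) <=
  2 * B ^+ (k + k) * ((k + k) ^ (k + k) * n ^ k.+1)%:R.
Proof.
move=> n0; set m := Ex (trace_power n).
have -> : Ex (fun w => (trace_power n w - m) ^+ 2) =
    \sum_(v : {ffun 'I_k + 'I_k -> 'I_n}) (weight (walks_colour v) -
       weight (walk_colour (left_walk v)) * weight (walk_colour (right_walk v))).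
  have bT := bounded_measurable_trace n.
  have bT2 : bounded_measurable (fun w => trace_power n w ^+ 2) by exact: bounded_measurableX.
  transitivity (Ex (fun w => trace_power n w ^+ 2) - m ^+ 2).
    rewrite (_ : (fun w => _ ^+ 2) =
      (fun w => (trace_power n w ^+ 2 - (2 * m) * trace_power n w) + m ^+ 2)); last first.
      by apply/funext => w; ring.
    have bmT : bounded_measurable (fun w => (2 * m) * trace_power n w).
      exact: bounded_measurableZ.
    rewrite ExD; [|exact: bounded_measurableB|exact: bounded_measurable_cst].
    by rewrite ExB// ExZ// Ex_cst -/m; ring.
  rewrite sumrB; congr (_ - _).
    rewrite (_ : (fun w => _ ^+ 2) = (fun w => \sum_(v : {ffun 'I_k + 'I_k -> 'I_n})
        \prod_e psi (X (walks_colour v e) w))).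
      rewrite Ex_sum// => v.
      by apply: bounded_measurable_prod => e; exact: (bounded_measurable_psiX X mpsi psiB _).
    apply/funext => w; rewrite expr2 !trace_powerE big_distrl/=.
    under eq_bigr do rewrite big_distrr/=.
    rewrite sum_walk_pairs; apply: eq_bigr => v _.
    by rewrite big_sumType -walks_colour_inl -walks_colour_inr.
  rewrite /m Ex_trace_power expr2 big_distrl/=.
  under eq_bigr do rewrite big_distrr/=.
  by rewrite sum_walk_pairs.
apply: le_trans (ler_norm _) _.
have := @linked_weights R 'I_n I (@colour I S n) k (fun v => weight (walks_colour v) -
       weight (walk_colour (left_walk v)) * weight (walk_colour (right_walk v)))
   (2 * B ^+ (k + k)) (@colourC _ _ _ HS n) (@colour_inj _ _ _ HS n).
rewrite card_ord => /(_ n0); apply.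
- move=> v; rewrite (le_trans (ler_normB _ _))// mulr_natl mulr2n lerD//.
    by have := weight_bound X mpsi psiB (walks_colour v); rewrite card_sum card_ord.
  rewrite normrM exprD; have wb u := weight_bound X mpsi psiB (@walk_colour n u).
  by rewrite card_ord in wb; rewrite ler_pM.
- move=> v e ve.
  rewrite (weight_single X_indep mpsi psiB muE mu1 (e0 := e) (c := walks_colour v))//.
  rewrite -walks_colour_inl -walks_colour_inr sub0r.
  have sub (i : 'I_k -> 'I_k + 'I_k) (e' : 'I_k) : injective i -> i e' = e ->
      weight (walks_colour v \o i) = 0.
    move=> ii ie; apply: (weight_single X_indep mpsi psiB muE mu1 (e0 := e')).
    apply/eqP; rewrite eqn_leq; apply/andP; split.
      rewrite -ve -(card_imset _ ii); apply/subset_leq_card/fintype.subsetP => z.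
      by move=> /imsetP[y]; rewrite !inE /= ie => /eqP ye ->; rewrite -/(walks_colour v _) ye.
    by rewrite card_gt0; apply/finset.set0Pn; exists e'; rewrite inE.
  by case: e ve sub => e ve sub; [rewrite (sub inl e)//|rewrite (sub inr e)//];
     rewrite ?mul0r ?mulr0 ?oppr0//; [exact: inl_inj|exact: inr_inj].
- move=> v h; rewrite (weight_unlinked X_indep mpsi psiB muE (c := walks_colour v))//.
  by rewrite walks_colour_inl walks_colour_inr subrr.
Qed.

Lemma ae_cvg_trace_power :
  {ae P, forall w,
    (fun m : nat => trace_power (m.+1 ^ 2)%N w /
      ((m.+1 ^ 2)%:R * Num.sqrt (m.+1 ^ 2)%:R ^+ k)) @ \oo
    --> ((half_line_walks k 0)%:R : R)}.
Proof.
pose nrm n : R := n%:R * Num.sqrt n%:R ^+ k.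
pose Y m w := (trace_power (m.+1 ^ 2)%N w - Ex (trace_power (m.+1 ^ 2)%N)) / nrm (m.+1 ^ 2)%N.
have bY m : bounded_measurable (Y m).
  apply: bounded_measurableM; last exact: bounded_measurable_cst.
  by apply: bounded_measurableB; [exact: bounded_measurable_trace|exact: bounded_measurable_cst].
have sq : (fun m => (m.+1 ^ 2)%N) @ \oo --> \oo.
  apply/cvgnyPge => A; near=> m.
  have mA : (A <= m)%N by near: m; exact: nbhs_infty_ge.
  by rewrite (leq_trans mA)// (leq_trans (leqnSn m))// expnS expn1 leq_pmulr.
have := @ae_cvg0 _ _ _ P Y (2 * B ^+ (k + k) * ((k + k) ^ (k + k))%:R) bY.
case=> [m|N [mN N0 YN]].
  rewrite (_ : (fun w => _) = (fun w => (nrm (m.+1 ^ 2)%N)^-2 *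
      (trace_power (m.+1 ^ 2)%N w - Ex (trace_power (m.+1 ^ 2)%N)) ^+ 2)); last first.
    by apply/funext => w; rewrite /Y exprMn exprVn mulrC.
  rewrite ExZ; last first.
    apply: bounded_measurableX; apply: bounded_measurableB.
      exact: bounded_measurable_trace.
    exact: bounded_measurable_cst.
  set N := (m.+1 ^ 2)%N; have N0 : (0 < N)%N by rewrite expn_gt0.
  have nrm0 : 0 < nrm N by rewrite mulr_gt0 ?ltr0n// exprn_gt0// sqrtr_gt0 ltr0n.
  rewrite mulrC ler_pdivrMr ?exprn_gt0//; apply: le_trans (variance_trace_power N0) _.
  rewrite natrM [leLHS]mulrA -[leRHS]mulrA ler_wpM2l//.
    by rewrite mulr_ge0// mulr_ge0// exprn_even_ge0// oddD addbb.
  (* Against N^(k + 1) this leaves 1/N = 1/(m + 1)^2, hence a summable bound. *)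
  have -> : nrm N ^+ 2 = N%:R ^+ k.+2.
    by rewrite /nrm exprMn -exprM mulnC exprM sqr_sqrtr// -exprD.
  have -> : m.+1%:R ^+ 2 = N%:R :> R by rewrite -natrX.
  by rewrite natrX [_ ^+ k.+2]exprS mulKf// pnatr_eq0 -lt0n.
exists N; split=> // w Yw; apply: YN => Y0; apply: Yw => /=.
have lim := cvgD Y0 (cvg_comp _ _ sq cvg_Ex_trace_power).
rewrite add0r in lim; apply: cvg_trans (lim _); apply: near_eq_cvg.
by near=> m; rewrite fctE /Y /= -mulrDl subrK.
Unshelve. all: by end_near. Qed.

End Variance.

(** * Eigenvalue comparison *)

Section Spectral.
Variable R : realType.
Local Open Scope sesquilinear_scope.
Local Open Scope ring_scope.
Local Notation C := R[i].
Local Notation f := (real_complex R).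

(** The matrix is diagonalized over the complex numbers as a hermitian one. Its diagonal is real,
    and comparing characteristic polynomials identifies it with [eigenvalues] up to order. *)
Lemma real_spectral n (A : 'M[R]_n) : A^T = A ->
  exists (U : 'M[C]_n) (d : 'rV[R]_n), [/\ U \is unitarymx,
    map_mx f A = U^t* *m diag_mx (map_mx f d) *m U &
    perm_eq (eigenvalues A) [seq d 0 i | i <- enum 'I_n]].
Proof.
move=> sA; pose B := map_mx f A.
have hB : B \is hermsymmx.
  apply: realsym_hermsym.
    by apply/is_hermitianmxP; rewrite expr0 scale1r map_mx_id// /B map_trmx sA.
  by apply/mxOverP => i j; rewrite mxE; apply/complex_realP; exists (A i j).
have /hermitian_normalmx /orthomx_spectralP BE := hB.
have /mxOverP dR := hermitian_spectral_diag_real hB.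
have uU := spectral_unitarymx B.
pose d := \row_i complex.Re (spectral_diag B 0 i).
have dE : map_mx f d = spectral_diag B.
  by apply/rowP => i; rewrite !mxE RRe_real.
exists (spectralmx B), d; rewrite dE; split => //.
  by rewrite -invmx_unitary.
apply: prod_XsubC_eq; rewrite big_map big_enum /=.
rewrite -(eigenvaluesP sA).2; apply: (map_poly_inj f).
rewrite map_char_poly -/B BE char_poly_conj ?spectral_unit//.
rewrite char_poly_trig; last exact: diag_mx_is_trig.
rewrite rmorph_prod/=; apply: eq_bigr => i _.
rewrite mxE eqxx mulr1n rmorphB/= map_polyX map_polyC/= -dE.
by congr (_ - _%:P); rewrite !mxE.
Qed.

Lemma map_mxpow n (A : 'M[R]_n) k : map_mx f (mxpow A k) = mxpow (map_mx f A) k.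
Proof. by elim: k => [|k IH]; rewrite ?map_mx1//= map_mxM IH. Qed.

Lemma mxtrace_eigenvalues n (A : 'M[R]_n) k : A^T = A ->
  \tr (mxpow A k) = \sum_(a <- eigenvalues A) a ^+ k.
Proof.
move=> sA; have [U [d [uU AE pd]]] := real_spectral sA.
have UU : U *m U^t* = 1%:M by exact/unitarymxP.
rewrite (perm_big _ pd) big_map big_enum /=.
apply: (@complexI R); rewrite -[LHS]/(f _) -[RHS]/(f _) -trace_map_mx map_mxpow [RHS]rmorph_sum /=.
have -> : mxpow (map_mx f A) k = U^t* *m diag_mx (map_mx f (map_mx (fun x => x ^+ k) d)) *m U.
  elim: k => [|k IH] /=.
    rewrite (_ : diag_mx _ = 1%:M).
      by rewrite mulmx1; apply/esym/mulmx1C.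
    by apply/matrixP => i j; rewrite !mxE expr0 rmorph1.
  rewrite IH AE -!mulmxA; congr (_ *m _).
  rewrite [U *m (_ *m _)]mulmxA UU mul1mx !mulmxA; congr (_ *m _).
  rewrite mulmx_diag; congr diag_mx.
  by apply/rowP => i; rewrite !mxE exprS rmorphM.
rewrite mxtrace_mulC mulmxA UU mul1mx mxtrace_diag.
by apply: eq_bigr => i _; rewrite !mxE.
Qed.

Definition eig_above n (A : 'M[R]_n) (x : R) := count (fun a => x < a) (eigenvalues A).

Lemma quad_diag n (y : 'rV[C]_n) (d : 'rV[R]_n) :
  (y *m diag_mx (map_mx f d) *m y^t*) 0 0 = \sum_i f (d 0 i) * (`|y 0 i| ^+ 2).
Proof.
rewrite mul_mx_diag mxE; apply: eq_bigr => i _.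
by rewrite !mxE normCK mulrAC mulrC.
Qed.

(* If the inequality failed, a dimension count would give a nonzero [u] with
   [u *m W] in the span of the eigenvectors of [A] above [s * y] and [u *m W'] in
   the span of those of [B] up to [y], where the two quadratic forms disagree. *)
Lemma eig_above_compression n N w (A : 'M[R]_n) (B : 'M[R]_N)
    (W : 'M[R]_(w, n)) (W' : 'M[R]_(w, N)) (s y : R) :
  A^T = A -> B^T = B -> row_free W -> 0 < s ->
  W *m A *m W^T = s *: (W' *m B *m W'^T) -> W *m W^T = W' *m W'^T ->
  (eig_above A (s * y) <= eig_above B y + (n - w))%N.
Proof.
move=> sA sB fW s0 qAB nAB.
have [U [d [uU AE pA]]] := real_spectral sA.
have [U' [d' [uU' BE pB]]] := real_spectral sB.
have wn : (w <= n)%N by rewrite -(eqP fW) rank_leq_col.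
rewrite /eig_above (permP pA) (permP pB).
rewrite [X in (X <= _)%N]count_map [X in (_ <= X + _)%N]count_map.
(* These index the coordinates that have to vanish. If the claim failed, they would impose fewer
   than [w] linear conditions on a row vector of length [w]. *)
pose S1 := [set i | ~~ (s * y < d 0 i)]%SET; pose S2 := [set j | y < d' 0 j]%SET.
have cnt m (r : 'rV[R]_m) (p : pred R) :
    count (preim (r 0) p) (enum 'I_m) = #|[set i | p (r 0 i)]%SET|.
  by rewrite enumT cardsE cardE size_filter.
rewrite !cnt -/S2 leqNgt; apply/negP => lt.
have S1n : (#|[set i | (s * y < d 0 i)%R]%SET| + #|S1| = n)%N.
  have -> : S1 = (~: [set i | (s * y < d 0 i)%R])%SET by apply/finset.setP => i; rewrite !inE.
  by rewrite cardsC card_ord.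
have S12 : (#|S1| + #|S2| < w)%N by lia.
have UU : U^t* *m U = 1%:M by apply: mulmx1C; exact/unitarymxP.
have UU' : U'^t* *m U' = 1%:M by apply: mulmx1C; exact/unitarymxP.
pose Wc := map_mx f W; pose W'c := map_mx f W'.
pose Y := Wc *m U^t*; pose Y' := W'c *m U'^t*.
pose M := row_mx (\matrix_(i < w, j < #|S1|) Y i (enum_val j))
   (\matrix_(i < w, j < #|S2|) Y' i (enum_val j)).
have kM : kermx M != 0.
  rewrite kermx_eq0 /row_free neq_ltn (leq_ltn_trans (rank_leq_col _))//.
pose u := nz_row (kermx M).
have u0 : u != 0 by rewrite nz_row_eq0.
have /sub_kermxP uM : (u <= kermx M)%MS by exact: nz_row_sub.
pose y1 := u *m Y; pose y2 := u *m Y'.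
move: uM; rewrite mul_mx_row => /eqP; rewrite row_mx_eq0 => /andP[/eqP uM1 /eqP uM2].
have y1S i : i \in S1 -> y1 0 i = 0.
  move=> iS; move/rowP : uM1 => /(_ (enum_rank_in iS i)); rewrite mxE [RHS]mxE => <-; rewrite mxE.
  by apply: eq_bigr => k _; rewrite [in RHS]mxE enum_rankK_in.
have y2S i : i \in S2 -> y2 0 i = 0.
  move=> iS; move/rowP : uM2 => /(_ (enum_rank_in iS i)); rewrite mxE [RHS]mxE => <-; rewrite mxE.
  by apply: eq_bigr => k _; rewrite [in RHS]mxE enum_rankK_in.
have adjE m p (Z : 'M[R]_(m, p)) : (map_mx f Z)^t* = map_mx f Z^T.
  by apply/matrixP => i j; rewrite !mxE; apply: conj_Creal; apply/complex_realP; exists (Z j i).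
have adjM m p q (Z1 : 'M[C]_(m, p)) (Z2 : 'M[C]_(p, q)) : (Z1 *m Z2)^t* = Z2^t* *m Z1^t*.
  by rewrite trmx_mul map_mxM.
have y1E : y1^t* = U *m map_mx f W^T *m u^t*.
  by rewrite /y1 /Y !adjM trmxCK adjE.
have y2E : y2^t* = U' *m map_mx f W'^T *m u^t*.
  by rewrite /y2 /Y' !adjM trmxCK adjE.
have nrm : y1 *m y1^t* = y2 *m y2^t*.
  rewrite y1E y2E /y1 /y2 /Y /Y'.
  rewrite !mulmxA -[_ *m U^t* *m U]mulmxA -[_ *m U'^t* *m U']mulmxA UU UU' !mulmx1.
  by rewrite -![u *m _ *m _]mulmxA /Wc /W'c -!map_mxM nAB.
have quad : y1 *m diag_mx (map_mx f d) *m y1^t* =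
    f s *: (y2 *m diag_mx (map_mx f d') *m y2^t*).
  have -> : y1 *m diag_mx (map_mx f d) *m y1^t* = u *m map_mx f (W *m A *m W^T) *m u^t*.
    by rewrite y1E /y1 /Y !map_mxM AE /Wc !mulmxA.
  have -> : y2 *m diag_mx (map_mx f d') *m y2^t* = u *m map_mx f (W' *m B *m W'^T) *m u^t*.
    by rewrite y2E /y2 /Y' !map_mxM BE /W'c !mulmxA.
  by rewrite qAB map_mxZ -scalemxAr -scalemxAl.
have id1 m (z : 'rV[C]_m) : (z *m z^t*) 0 0 = \sum_i (`|z 0 i| ^+ 2).
  by rewrite mxE; apply: eq_bigr => i _; rewrite !mxE normCK.
have Q12 : \sum_i (`|y1 0 i| ^+ 2) = \sum_i (`|y2 0 i| ^+ 2) by rewrite -!id1 nrm.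
have E12 : \sum_i f (d 0 i) * (`|y1 0 i| ^+ 2) = f s * \sum_i f (d' 0 i) * (`|y2 0 i| ^+ 2).
  by rewrite -!quad_diag quad mxE.
have y1n0 : y1 != 0.
  apply: contraNneq u0 => y10.
  have : y1 *m U = 0 by rewrite y10 mul0mx.
  rewrite /y1 /Y !mulmxA -mulmxA UU mulmx1 => /eqP.
  by rewrite mulmx_free_eq0 // row_free_map.
(* Strict because [y1] has a nonzero coordinate, necessarily outside [S1], where the factor is
   positive. *)
have pos1 : 0 < \sum_i f (d 0 i - s * y) * (`|y1 0 i| ^+ 2).
  have [i yi] : exists i, y1 0 i != 0.
    apply/existsP; apply: contraNT y1n0; rewrite negb_exists => /forallP h.
    by apply/eqP/rowP => i; rewrite [RHS]mxE; have := h i; rewrite negbK => /eqP.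
  have term_ge0 j : 0 <= f (d 0 j - s * y) * (`|y1 0 j| ^+ 2).
    have [/y1S->|] := boolP (j \in S1); first by rewrite normr0 expr0n mulr0.
    by rewrite inE negbK => lj; rewrite mulr_ge0 ?exprn_ge0// lecR subr_ge0 ltW.
  rewrite (bigD1 i)//= ltr_pwDl ?sumr_ge0//.
  rewrite mulr_gt0 ?exprn_gt0 ?normr_gt0// ltcR subr_gt0.
  by have := contra_neqN (@y1S i) yi; rewrite inE negbK.
have pos2 : 0 <= \sum_i f (y - d' 0 i) * (`|y2 0 i| ^+ 2).
  apply: sumr_ge0 => j _.
  have [/y2S->|] := boolP (j \in S2); first by rewrite normr0 expr0n mulr0.
  by rewrite inE -leNgt => lj; rewrite mulr_ge0 ?exprn_ge0// lecR subr_ge0.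
have := lt_le_trans pos1 (_ : _ <= 0); rewrite ltxx => h; suff: false by []; apply: h.
have -> : \sum_i f (d 0 i - s * y) * (`|y1 0 i| ^+ 2) =
    - (f s * \sum_i f (y - d' 0 i) * (`|y2 0 i| ^+ 2)).
  under eq_bigr do rewrite rmorphB mulrBl.
  under [X in _ = - (_ * X)]eq_bigr do rewrite rmorphB mulrBl.
  rewrite !sumrB -!mulr_sumr E12 Q12 rmorphM; ring.
by rewrite oppr_le0 mulr_ge0// lecR ltW.
Qed.

End Spectral.

Section SortedSums.
Variable R : realType.

(** Take for y the entry of [lb] at [i]: at most [i] entries of [lb] exceed it, whereas a failure
    would give r + i + 1 entries of [la] above s * y. *)
Lemma sorted_shift (la lb : seq R) (s : R) (r : nat) : 0 < s ->
  sorted >=%R la -> sorted >=%R lb -> 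
  (forall y, (count (fun a => s * y < a)%R la <= count (fun b => y < b)%R lb + r)%N) ->
  forall i, (r + i < size la)%N -> (i < size lb)%N ->
  nth 0 la (r + i) <= s * nth 0 lb i.
Proof.
move=> s0 sla slb h i ila ilb; rewrite leNgt; apply/negP => lt.
have := h (nth 0 lb i).
have tr : transitive (>=%R : rel R) by move=> x y z xy yz; exact: le_trans yz xy.
have ca : (r + i < count (fun a => s * nth 0 lb i < a)%R la)%N.
  rewrite -(cat_take_drop (r + i).+1 la) count_cat (leq_trans _ (leq_addr _ _))//.
  suff : all (fun a => s * nth 0 lb i < a) (take (r + i).+1 la).
    by rewrite all_count => /eqP ->; rewrite size_takel.
  apply/(all_nthP 0) => j.
  rewrite size_takel// => ji; rewrite nth_take//; apply: lt_le_trans lt _.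
  by apply: (sorted_leq_nth tr (@lexx _ _)) => //; rewrite inE (leq_trans ji).
have cb : (count (fun b => nth 0 lb i < b)%R lb <= i)%N.
  rewrite -[X in count _ X](cat_take_drop i lb) count_cat.
  rewrite [X in (_ + X <= _)%N](_ : _ = 0%N).
    by rewrite addn0 (leq_trans (count_size _ _))// size_take; case: ifP => //; lia.
  apply/eqP; rewrite -leqn0 leqNgt -has_count; apply/hasPn => b /(nthP 0)[j].
  rewrite size_drop nth_drop => jl <-; rewrite -leNgt.
  have ijl : (i + j < size lb)%N by rewrite -ltn_subRL.
  by apply: (sorted_leq_nth tr (@lexx _ _)) => //; rewrite ?inE// leq_addr.
move=> hi; have := leq_trans ca (leq_trans hi (leq_add cb (leqnn r))).
by rewrite addnC ltnn.
Qed.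

(** The [r] largest entries of [la] cost at most 1 each; the others are matched in order with the
    entries of [lb]. *)
Lemma sum_monotone (la lb : seq R) (s : R) (r : nat) (g : R -> R) : 0 < s ->
  sorted >=%R la -> sorted >=%R lb -> (size la <= r + size lb)%N ->
  (forall y, (count (fun a => s * y < a)%R la <= count (fun b => y < b)%R lb + r)%N) ->
  {homo g : x y / x <= y} -> (forall x, 0 <= g x <= 1) ->
  \sum_(a <- la) g a <= r%:R + \sum_(b <- lb) g (s * b).
Proof.
move=> s0 sla slb sz h gm g01.
have g0 x : 0 <= g x by case/andP: (g01 x).
have g1 x : g x <= 1 by case/andP: (g01 x).
rewrite -(cat_take_drop r la) big_cat/= lerD//.
  apply: (@le_trans _ _ (\sum_(a <- take r la) 1)); first by apply: ler_sum.
  by rewrite big_const_seq count_predT iter_addr_0 ler_nat size_take; case: ifP => //; lia.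
rewrite -[in leRHS](cat_take_drop (size la - r) lb) big_cat/=.
apply: (@le_trans _ _ (\sum_(b <- take (size la - r) lb) g (s * b))); last first.
  by rewrite lerDl sumr_ge0.
have szt : size (take (size la - r) lb) = (size la - r)%N by rewrite size_takel//; lia.
rewrite (big_nth 0) [leRHS](big_nth 0) szt size_drop.
rewrite big_nat [leRHS]big_nat; apply: ler_sum => i /andP[_ ilt].
rewrite nth_drop nth_take//; apply: gm.
apply: (sorted_shift s0 sla slb h); rewrite -?ltn_subRL//.
by rewrite -(ltn_add2l r) (leq_trans _ sz)// -ltn_subRL.
Qed.

Lemma size_eigenvalues n (A : 'M[R]_n) : size (eigenvalues A) = n.
Proof. by rewrite size_tuple. Qed.

Lemma sum_eigenvalues_compression n N w (A : 'M[R]_n) (B : 'M[R]_N)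
    (W : 'M[R]_(w, n)) (W' : 'M[R]_(w, N)) (s : R) (g : R -> R) :
  A^T = A -> B^T = B -> row_free W -> row_free W' -> 0 < s ->
  W *m A *m W^T = s *: (W' *m B *m W'^T) -> W *m W^T = W' *m W'^T ->
  {homo g : x y / x <= y} -> (forall x, 0 <= g x <= 1) ->
  `|\sum_(a <- eigenvalues A) g a - \sum_(b <- eigenvalues B) g (s * b)| <=
  (maxn n N - w)%:R.
Proof.
move=> sA sB fW fW' s0 qAB nAB gm g01.
have wn : (w <= n)%N by rewrite -(eqP fW) rank_leq_col.
have wN : (w <= N)%N by rewrite -(eqP fW') rank_leq_col.
have [sortA _] := eigenvaluesP sA; have [sortB _] := eigenvaluesP sB.
have cAB y := eig_above_compression y sA sB fW s0 qAB nAB.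
have s'0 : 0 < s^-1 by rewrite invr_gt0.
have qBA : W' *m B *m W'^T = s^-1 *: (W *m A *m W^T).
  by rewrite qAB scalerA mulVf ?scale1r ?gt_eqF.
have cBA y := eig_above_compression y sB sA fW' s'0 qBA (esym nAB).
have r1 : (n - w <= maxn n N - w)%N by rewrite leq_sub2r// leq_maxl.
have r2 : (N - w <= maxn n N - w)%N by rewrite leq_sub2r// leq_maxr.
rewrite ler_norml; apply/andP; split; last first.
  rewrite lerBlDr; apply: (@le_trans _ _ ((n - w)%:R + \sum_(b <- eigenvalues B) g (s * b))); last first.
    by rewrite lerD2r ler_nat.
  by apply: sum_monotone => //; rewrite !size_eigenvalues; lia.
rewrite lerBrDr addrC lerBlDr.
(* The reverse bound has scale [s^-1]; with the test function g (s * x) the two scalings cancel on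
   the side of [A]. *)
have h := @sum_monotone (eigenvalues B) (eigenvalues A) s^-1 (N - w) (fun x => g (s * x)) s'0 sortB sortA.
rewrite !size_eigenvalues in h.
have {h}h : \sum_(b <- eigenvalues B) g (s * b) <=
    (N - w)%:R + \sum_(a <- eigenvalues A) g (s * (s^-1 * a)).
  by apply: h => //; [lia|move=> x y xy; apply: gm; rewrite ler_pM2l].
apply: le_trans h _; rewrite [leRHS]addrC.
have -> : \sum_(a <- eigenvalues A) g (s * (s^-1 * a)) = \sum_(a <- eigenvalues A) g a.
  by apply: eq_bigr => a _; rewrite mulVKf// gt_eqF.
by rewrite lerD2r ler_nat.
Qed.

End SortedSums.

Section Comparison.
Variables (R : realType) (I : choiceType) (S : nat -> nat -> I).
Hypothesis HS : C_condition R S.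

(** The rows span the vectors orthogonal to the constants, on which the rank-one matrix removed by
    centring vanishes. *)
Lemma ones_complement N : exists w (W : 'M[R]_(w, N)),
  [/\ row_free W, (N <= w.+1)%N & W *m (const_mx 1 : 'cV_N) = 0].
Proof.
pose c : 'cV[R]_N := const_mx 1; pose K := kermx c.
exists (\rank K), (row_base K); split; first exact: row_base_free.
  by rewrite mxrank_ker; have := rank_leq_col c; lia.
by apply/sub_kermxP; rewrite eq_row_base.
Qed.

Lemma tr_patterned (x : I -> R) n :
  (patterned_matrix S x n)^T = patterned_matrix S x n.
Proof. by apply/matrixP => i j; rewrite !mxE (C_symmetric HS). Qed.

(* On the vectors of R^N orthogonal to the constants the two matrices define
   the same quadratic form up to scaling. *)
Lemma patterned_comparison (x : I -> R) (m a b : R) (N n : nat) (g : R -> R) :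
  (N <= n)%N -> 0 < a -> 0 < b ->
  {homo g : x y / x <= y} -> (forall x, 0 <= g x <= 1) ->
  `|\sum_(l <- eigenvalues (a *: patterned_matrix S x n)) g l -
    \sum_(l <- eigenvalues (b *: patterned_matrix S (fun i => x i - m) N)) g (a / b * l)|
  <= (n - N).+1%:R.
Proof.
move=> Nn a0 b0 gm g01.
have [w [W' [fW' Nw W1]]] := ones_complement N.
(* Conjugation by [Q] extracts the upper left corner of size [N]. *)
pose Q : 'M[R]_(N, n) := \matrix_(i, j) (i == j :> nat)%:R.
have QA p (A : 'M[R]_(n, p)) (i : 'I_N) (j : 'I_p) (ni : (i < n)%N) : (Q *m A) i j = A (Ordinal ni) j.
  rewrite mxE (bigD1 (Ordinal ni))//= !mxE eqxx mul1r big1 ?addr0// => k ki.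
  by rewrite mxE; case: eqP => [ik|]; rewrite ?mul0r//; case/eqP: ki; apply: val_inj.
have QE (A : 'M[R]_n) (i j : 'I_N) (ni : (i < n)%N) (nj : (j < n)%N) :
    (Q *m A *m Q^T) i j = A (Ordinal ni) (Ordinal nj).
  transitivity ((Q *m (Q *m A)^T) j i); last by rewrite QA mxE QA.
  transitivity ((Q *m A *m Q^T)^T j i); first by rewrite [RHS]mxE.
  by rewrite [(Q *m A *m Q^T)^T]trmx_mul trmxK.
have wid (i : 'I_N) : (i < n)%N := leq_trans (ltn_ord i) Nn.
have QQ : Q *m Q^T = 1%:M.
  apply/matrixP => i j; have := QE 1%:M i j (wid i) (wid j); rewrite mulmx1 => ->.
  by rewrite !mxE.
have QH : Q *m patterned_matrix S x n *m Q^T =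
    patterned_matrix S (fun i => x i - m) N + m *: (const_mx 1 *m (const_mx 1 : 'cV[R]_N)^T).
  apply/matrixP => i j; rewrite (QE _ _ _ (wid i) (wid j)) !mxE.
  by rewrite big_ord1 !mxE !mulr1 subrK.
pose W := W' *m Q.
have WQ : W *m Q^T = W' by rewrite -mulmxA QQ mulmx1.
have fW : row_free W.
  rewrite /row_free eqn_leq rank_leq_row /= -[w in (w <= _)%N](eqP fW') -{1}WQ.
  exact: mxrankM_maxl.
have := @sum_eigenvalues_compression R n N w (a *: patterned_matrix S x n)
  (b *: patterned_matrix S (fun i => x i - m) N) W W' (a / b) g.
move=> cmp; apply: le_trans (cmp _ _ _ _ _ _ _ _ _) _ => //.
- by rewrite linearZ /= tr_patterned.
- by rewrite linearZ /= tr_patterned.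
- by rewrite divr_gt0.
- rewrite -!scalemxAr -!scalemxAl scalerA divfK ?gt_eqF//; congr (_ *: _).
  rewrite /W trmx_mul.
  have -> : W' *m Q *m patterned_matrix S x n *m (Q^T *m W'^T) =
      W' *m (Q *m patterned_matrix S x n *m Q^T) *m W'^T by rewrite !mulmxA.
  by rewrite QH mulmxDr -scalemxAr mulmxA W1 mul0mx scaler0 addr0.
- by rewrite /W trmx_mul mulmxA -[W' *m Q *m _]mulmxA QQ mulmx1.
- rewrite ler_nat (maxn_idPl Nn); lia.
Qed.

End Comparison.

(** * Polynomial approximation *)

Section Bernstein.
Variable R : realType.

(* The expectation of [phi] under the binomial law of parameters [n] and 'X,
   defined by conditioning on the first trial. *)
Fixpoint bernstein (n : nat) (phi : nat -> R) : {poly R} :=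
  if n is n'.+1 then
    (1 - 'X) * bernstein n' phi + 'X * bernstein n' (fun i => phi i.+1)
  else (phi 0%N)%:P.

Lemma bernsteinS n phi t : (bernstein n.+1 phi).[t] =
  (1 - t) * (bernstein n phi).[t] + t * (bernstein n (fun i => phi i.+1)).[t].
Proof. by rewrite /= !hornerE. Qed.

Lemma bernstein_le n (phi psi : nat -> R) t : 0 <= t <= 1 ->
  (forall i, (i <= n)%N -> phi i <= psi i) ->
  (bernstein n phi).[t] <= (bernstein n psi).[t].
Proof.
move=> /andP[t0 t1]; elim: n phi psi => [|n IH] phi psi h.
  by rewrite /= !hornerC h.
rewrite !bernsteinS lerD// ler_wpM2l ?subr_ge0//; apply: IH => i ni; apply: h => //.
exact: leqW.
Qed.

(** Second moment of a shifted binomial variable: square of the mean plus the variance n t (1 - t).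
    The shift [c] is general because conditioning on a success replaces i by i + 1. *)
Lemma bernstein_sqr n (a b c : R) t :
  (bernstein n (fun i => a * (i%:R + c) ^+ 2 + b)).[t] =
  a * ((n%:R * t + c) ^+ 2 + n%:R * t * (1 - t)) + b.
Proof.
elim: n c => [|n IH] c; first by rewrite /= hornerC; ring.
rewrite bernsteinS IH.
under [X in _ + _ * (bernstein n X).[t]]eq_fun => i do rewrite -natr1 -addrA.
rewrite IH -natr1; ring.
Qed.

Lemma uniform_continuity01 (h : R -> R) (e : R) : continuous h -> 0 < e ->
  exists2 d : R, 0 < d & forall s t, 0 <= s <= 1 -> `|s - t| < d -> `|h s - h t| < e.
Proof.
move=> ch e0; have /compact_near_coveringP cov := @segment_compact R 0 1.
have near_cov : \forall d \near 0^'+, `[0, 1]%classic `<=`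
    (fun s => forall t, `|s - t| < d -> `|h s - h t| < e).
  apply: cov => x _; have e20 : 0 < e / 2 by rewrite divr_gt0.
  have := ch x; move=> /cvgrPdist_lt /(_ _ e20) [r /= r0 hr].
  exists (ball x (r / 2), [set d | d < r / 2]) => /=.
    split; first by apply: nbhsx_ballx; rewrite divr_gt0.
    by apply: nbhs_right_lt; rewrite divr_gt0.
  move=> [y d] /= [xy dr] t yt; rewrite /ball /= in xy.
  have xt : `|x - t| < r.
    rewrite (_ : x - t = (x - y) + (y - t)); last by ring.
    by rewrite (le_lt_trans (ler_normD _ _))//; lra.
  have xy' : `|x - y| < r by lra.
  have hy := hr _ xy'; have ht := hr _ xt.
  rewrite (_ : h y - h t = (h x - h t) - (h x - h y)); last by ring.
  by rewrite (le_lt_trans (ler_normB _ _))// [e]splitr ltrD.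
have [d [d0 hd]] : exists d : R, 0 < d /\ `[0, 1]%classic `<=`
    (fun s => forall t, `|s - t| < d -> `|h s - h t| < e).
  have : \forall d \near 0^'+, 0 < d /\ `[0, 1]%classic `<=`
      (fun s => forall t, `|s - t| < d -> `|h s - h t| < e).
    by apply: filterS2 near_cov (nbhs_right_gt 0) => d ? ?; split.
  by move/filter_ex.
by exists d => // s t s01; apply: hd; rewrite /= in_itv.
Qed.

Lemma bounded01 (h : R -> R) : continuous h ->
  exists2 M, 0 < M & forall t, 0 <= t <= 1 -> `|h t| <= M.
Proof.
move=> ch; have cw : {within `[0, 1], continuous h} by exact: continuous_subspaceT.
have [a _ amax] := @EVT_max R h 0 1 ler01 cw.
have [b _ bmin] := @EVT_min R h 0 1 ler01 cw.
exists (`|h a| + `|h b| + 1) => [|t t01]; first by rewrite ltr_pwDr// addr_ge0.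
have tI : t \in `[0, 1]%R by rewrite in_itv.
have := amax _ tI; have := bmin _ tI; have := ler_norm (h a).
have := ler_norm (- h b); rewrite normrN => ? ? ? ?.
have := normr_ge0 (h a); have := normr_ge0 (h b).
by rewrite ler_norml => ? ?; apply/andP; split; lra.
Qed.

(** The Bernstein operator is monotone, so the quadratic bounds on [h] around [t] pass to the
    polynomial, where [bernstein_sqr] evaluates them. *)
Lemma weierstrass01 (h : R -> R) (e : R) : continuous h -> 0 < e ->
  exists p : {poly R}, forall t, 0 <= t <= 1 -> `|h t - p.[t]| <= e.
Proof.
move=> ch e0.
have e20 : 0 < e / 2 by rewrite divr_gt0.
have [d d0 hd] := uniform_continuity01 ch e20.
have [M M0 hM] := bounded01 ch.
(* As in Chebyshev's inequality: for |s - t| >= d the factor (s - t)^2 / d^2 is at least 1 and the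
   bound 2M suffices. *)
have bnd s t : 0 <= s <= 1 -> 0 <= t <= 1 ->
    `|h s - h t| <= 2 * M / d ^+ 2 * (s - t) ^+ 2 + e / 2.
  move=> s01 t01; have [st|st] := ltP (`|s - t|) d.
    apply: le_trans (ltW (hd _ _ s01 st)) _.
    by rewrite lerDr mulr_ge0 ?sqr_ge0// divr_ge0 ?sqr_ge0// mulr_ge0// ltW.
  apply: (@le_trans _ _ (2 * M)).
    by rewrite (le_trans (ler_normB _ _))// mulr_natl mulr2n lerD// hM.
  apply: (@le_trans _ _ (2 * M / d ^+ 2 * (s - t) ^+ 2)); last by rewrite lerDl ltW.
  rewrite -mulrA ler_peMr ?mulr_ge0 ?(ltW M0)// mulrC ler_pdivlMr ?exprn_gt0// mul1r.
  by rewrite -[leRHS]real_normK ?num_real// ler_pXn2r// nnegrE ltW.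
pose K := 2 * M / d ^+ 2.
have K0 : 0 < K by rewrite divr_gt0 ?exprn_gt0// mulr_gt0.
(* Makes the variance term K t (1 - t) / n at most e / 2. *)
pose n := (Num.truncn (2 * K / e)).+1.
have nP : 2 * K / e < n%:R by exact: truncnS_gt.
have n0 : 0 < n%:R :> R by [].
exists (bernstein n (fun i => h (i%:R / n%:R))) => t t01.
have i01 i : (i <= n)%N -> 0 <= (i%:R : R) / n%:R <= 1.
  by move=> ni; rewrite divr_ge0//= ler_pdivrMr// mul1r ler_nat.
have close : K / n%:R ^+ 2 * (n%:R * t * (1 - t)) <= e / 2.
  have -> : K / n%:R ^+ 2 * (n%:R * t * (1 - t)) = K / n%:R * (t * (1 - t)).
    by field; rewrite gt_eqF.
  apply: (@le_trans _ _ (K / n%:R)).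
    rewrite ler_piMr ?divr_ge0 ?(ltW K0)//; nra.
  rewrite ler_pdivrMr//; move: nP; rewrite ltr_pdivrMr//; lra.
have KE i : K / n%:R ^+ 2 * (i%:R - n%:R * t) ^+ 2 = K * (i%:R / n%:R - t) ^+ 2.
  by field; rewrite gt_eqF.
have E (a b : R) : (bernstein n (fun i => a * (i%:R - n%:R * t) ^+ 2 + b)).[t] =
    a * (n%:R * t * (1 - t)) + b.
  by rewrite (bernstein_sqr n a b (- (n%:R * t))) subrr expr0n add0r.
have up : (bernstein n (fun i => h (i%:R / n%:R))).[t] <= h t + e.
  have := E (K / n%:R ^+ 2) (h t + e / 2); set b := (bernstein _ _).[t] => bE.
  have : (bernstein n (fun i => h (i%:R / n%:R))).[t] <= b.
    apply: bernstein_le => // i ni; have := bnd _ _ (i01 _ ni) t01.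
    by rewrite ler_norml KE -/K => /andP[_]; lra.
  by rewrite bE; lra.
have down : h t - e <= (bernstein n (fun i => h (i%:R / n%:R))).[t].
  have := E (- (K / n%:R ^+ 2)) (h t - e / 2); set b := (bernstein _ _).[t] => bE.
  have : b <= (bernstein n (fun i => h (i%:R / n%:R))).[t].
    apply: bernstein_le => // i ni; have := bnd _ _ (i01 _ ni) t01.
    by rewrite ler_norml mulNr KE -/K => /andP[+ _]; lra.
  by rewrite bE mulNr; lra.
by rewrite ler_norml; apply/andP; split; lra.
Qed.

Lemma weierstrass (h : R -> R) (K e : R) : continuous h -> 0 < K -> 0 < e ->
  exists p : {poly R}, forall x, `|x| <= K -> `|h x - p.[x]| <= e.
Proof.
move=> ch K0 e0.
have ch' : continuous (fun t => h (2 * K * t - K)).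
  move=> t; apply: (@continuous_comp _ _ _ (fun t => 2 * K * t - K) h); last exact: ch.
  by apply: cvgB; [apply: cvgM; [exact: cvg_cst|exact: cvg_id]|exact: cvg_cst].
have [p hp] := weierstrass01 ch' e0.
exists (p \Po ((2 * K)^-1 *: 'X + (2^-1)%:P)) => x.
rewrite ler_norml => /andP[Kx xK].
have K2 : 0 < 2 * K by rewrite mulr_gt0.
have t01 : 0 <= (2 * K)^-1 * x + 2^-1 <= 1.
  have -> : (2 * K)^-1 * x + 2^-1 = (x + K) / (2 * K) by field; rewrite gt_eqF.
  by rewrite divr_ge0 ?ler_pdivrMr// ?(ltW K2)//=; lra.
have := hp _ t01; rewrite horner_comp !hornerE.
by rewrite (_ : 2 * K * ((2 * K)^-1 * x + 2^-1) - K = x)//; field; rewrite gt_eqF.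
Qed.

End Bernstein.

(** * Moments of the semicircle law *)

Section SemicircleMoments.
Variable R : realType.
Local Notation leb := (@lebesgue_measure R).
Local Notation arc f := (Rintegral leb `[0, pi] f).

Lemma continuous_integrable (f : R -> R) (a b : R) : continuous f ->
  leb.-integrable `[a, b] (EFin \o f).
Proof.
move=> cf; apply: continuous_compact_integrable; first exact: segment_compact.
exact: continuous_subspaceT.
Qed.

Lemma arcD (f g : R -> R) : continuous f -> continuous g ->
  arc (fun t => f t + g t) = arc f + arc g.
Proof. by move=> cf cg; rewrite RintegralD//; exact: continuous_integrable. Qed.

Lemma arcB (f g : R -> R) : continuous f -> continuous g ->
  arc (fun t => f t - g t) = arc f - arc g.
Proof. by move=> cf cg; rewrite RintegralB//; exact: continuous_integrable. Qed.

Lemma arcZ (c : R) (f : R -> R) : continuous f -> arc (fun t => c * f t) = c * arc f.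
Proof. by move=> cf; rewrite RintegralZl//; exact: continuous_integrable. Qed.

Lemma continuous_sinM (m : R) : continuous (fun t : R => sin (m * t)).
Proof.
move=> t; apply: (@continuous_comp _ _ _ ( *%R m) sin); last exact: continuous_sin.
exact: mulrl_continuous.
Qed.

Lemma continuous_cosM (m : R) : continuous (fun t : R => cos (m * t)).
Proof.
move=> t; apply: (@continuous_comp _ _ _ ( *%R m) cos); last exact: continuous_cos.
exact: mulrl_continuous.
Qed.

Lemma sin_natpi (m : nat) : sin (m%:R * pi) = 0 :> R.
Proof.
elim: m => [|m IH]; first by rewrite mul0r sin0.
by rewrite -natr1 mulrDl mul1r sinD sinpi IH mul0r mulr0 addr0.
Qed.

Lemma arc_cos (m : nat) : arc (fun t => cos (m%:R * t)) = if m == 0%N then pi else 0.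
Proof.
have [->|m0] := eqVneq m 0%N.
  under eq_Rintegral do rewrite mul0r cos0.
  rewrite Rintegral_cst//= lebesgue_measure_itv/= lte_fin pi_gt0 /=.
  by rewrite subr0 mul1r.
have mR : m%:R != 0 :> R by rewrite pnatr_eq0.
have dF (t : R) : is_derive t (1 : R) (fun t : R => sin (m%:R * t) / m%:R) (cos (m%:R * t)).
  have dm : is_derive t (1 : R) ( *%R (m%:R : R)) m%:R.
    have := is_deriveZ m%:R (is_derive_id t (1 : R)).
    by rewrite /GRing.scale /= mulr1.
  have := is_deriveZ m%:R^-1 (is_derive1_comp (is_derive_sin (m%:R * t)) dm).
  rewrite /GRing.scale /= mulrCA mulVf// mulr1.
  by under eq_fun do rewrite mulrC.
have cF : continuous (fun t : R => sin (m%:R * t) / m%:R).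
  by move=> t; apply: cvgM; [exact: continuous_sinM|exact: cvg_cst].
rewrite /Rintegral (@continuous_FTC2 _ _ (fun t => sin (m%:R * t) / m%:R) 0 pi).
- by rewrite sin_natpi mulr0 sin0 mul0r /= subrr.
- exact: pi_gt0.
- by apply: continuous_subspaceT; exact: continuous_cosM.
- split; first by move=> t _; exact: ex_derive.
    by apply: cvg_at_right_filter; exact: cF.
  by apply: cvg_at_left_filter; exact: cF.
- by move=> t _; rewrite derive1E derive_val.
Qed.

(* Under [x = 2 cos t] the Chebyshev polynomial [U_j] becomes
   [sin ((j + 1) t) / sin t], so this is the integral of [x ^ k * U_j] and
   [x * U_j = U_(j+1) + U_(j-1)] is the recurrence of [half_line_walks]. *)
Definition arc_moment (k j : nat) : R :=
  arc (fun t => (2 * cos t) ^+ k * (2 / pi * (sin (j.+1%:R * t) * sin t))).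

Lemma continuous_arc_moment k j :
  continuous (fun t : R => (2 * cos t) ^+ k * (2 / pi * (sin (j.+1%:R * t) * sin t))).
Proof.
move=> t; apply: cvgM.
  apply: (@continuous_comp _ _ _ (fun t => 2 * cos t) (fun x => x ^+ k)).
    by apply: cvgM; [exact: cvg_cst|exact: continuous_cos].
  exact: exprn_continuous.
apply: cvgM; first exact: cvg_cst.
by apply: cvgM; [exact: continuous_sinM|exact: continuous_sin].
Qed.

Lemma arc_momentE k j : arc_moment k j = (half_line_walks k j)%:R.
Proof.
elim: k j => [|k IH] j.
  rewrite /arc_moment.
  have -> : (fun t : R => (2 * cos t) ^+ 0 * (2 / pi * (sin (j.+1%:R * t) * sin t))) =
      (fun t => pi^-1 * (cos (j%:R * t) - cos (j.+2%:R * t))).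
    apply/funext => t; rewrite expr0 mul1r.
    have -> : j%:R * t = j.+1%:R * t - t by rewrite -natr1; ring.
    have -> : j.+2%:R * t = j.+1%:R * t + t by rewrite -[j.+2%:R]natr1; ring.
    by rewrite cosB cosD; ring.
  have cc : continuous (fun t : R => cos (j%:R * t) - cos (j.+2%:R * t)).
    by move=> t; apply: cvgB; exact: continuous_cosM.
  rewrite arcZ// arcB; [|exact: continuous_cosM|exact: continuous_cosM].
  rewrite !arc_cos/= subr0; case: ifP => _; last by rewrite mulr0.
  by rewrite mulVf// gt_eqF// pi_gt0.
(* The last term is not written as an [arc_moment]: for i = 0 it vanishes because sin 0 = 0, which
   is the boundary of the half line. *)
have step i : arc_moment k.+1 i = arc_moment k i.+1 +
    arc (fun t => (2 * cos t) ^+ k * (2 / pi * (sin (i%:R * t) * sin t))).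
  rewrite /arc_moment -arcD.
  - congr (Rintegral _ _ _); apply/funext => t.
    have -> : i.+2%:R * t = i.+1%:R * t + t by rewrite -[i.+2%:R]natr1; ring.
    have -> : i%:R * t = i.+1%:R * t - t by rewrite -natr1; ring.
    by rewrite sinB sinD exprS; ring.
  - exact: continuous_arc_moment.
  - case: i => [|i]; last exact: continuous_arc_moment.
    by move=> t; under eq_fun do rewrite mul0r sin0 mul0r !mulr0; exact: cvg_cst.
rewrite step IH; case: j => [|j] /=; last by rewrite -/(arc_moment k j) IH natrD addrC.
under eq_Rintegral do rewrite mul0r sin0 mul0r !mulr0.
by rewrite Rintegral_cst//= mul0r addr0.
Qed.

(** The semicircle integral in the angle variable x = 2 cos t. On a compact interval continuity
    gives integrability, also for unbounded [f] such as powers. *)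
Definition semicircle_mean (f : R -> R) : R :=
  arc (fun t => f (2 * cos t) * (2 / pi * sin t ^+ 2)).

Lemma semicircle_meanX k : semicircle_mean (fun x => x ^+ k) = (half_line_walks k 0)%:R.
Proof.
rewrite -arc_momentE; congr (Rintegral _ _ _); apply/funext => t.
by rewrite mul1r expr2.
Qed.

Lemma semicircle_substitution (f : R -> R) : continuous f ->
  (\int[leb]_(x in `[(-2)%R, 2%R]) (f x * (Num.sqrt (4 - x ^+ 2) / (2 * pi)))%:E)%E =
  (semicircle_mean f)%:E.
Proof.
move=> cf; pose G x := f x * (Num.sqrt (4 - x ^+ 2) / (2 * pi)).
pose F t : R := 2 * cos t.
have F0 : F 0 = 2 by rewrite /F cos0 mulr1.
have Fpi : F pi = -2 by rewrite /F cospi mulrN1.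
have dF (t : R) : is_derive t (1 : R) F (- (2 * sin t)).
  have := is_deriveZ 2 (is_derive_cos t).
  by rewrite /GRing.scale /= mulrN.
have F'E : (derive1 F) = (fun t => - (2 * sin t)).
  by apply/funext => t; rewrite derive1E derive_val.
have cF : continuous F.
  by move=> t; apply: cvgM; [exact: cvg_cst|exact: continuous_cos].
have cF' : continuous (derive1 F).
  rewrite F'E => t; apply: cvgN; apply: cvgM; first exact: cvg_cst.
  exact: continuous_sin.
have cG : continuous G.
  move=> x; apply: cvgM; first exact: cf.
  apply: cvgM; last exact: cvg_cst.
  apply: (@continuous_comp _ _ _ (fun x : R => 4 - x ^+ 2) (@Num.sqrt R)); last exact: sqrt_continuous.
  by apply: cvgB; [exact: cvg_cst|exact: exprn_continuous].
have := @integration_by_substitution_decreasing R F G 0 pi (pi_ge0 R).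
rewrite F0 Fpi => ->.
- rewrite /semicircle_mean /Rintegral fineK; last first.
    apply: integrable_fin_num => //; apply: continuous_integrable => t.
    apply: cvgM; first by apply: (@continuous_comp _ _ _ F f); [exact: cF|exact: cf].
    apply: cvgM; first exact: cvg_cst.
    by apply: (@continuous_comp _ _ _ sin (fun x => x ^+ 2)); [exact: continuous_sin|exact: exprn_continuous].
  apply: eq_integral => t; rewrite inE /= in_itv /= => t0; congr EFin.
  rewrite fctE /= F'E /G /F /= opprK.
  have -> : 4 - (2 * cos t) ^+ 2 = (2 * sin t) ^+ 2.
    by rewrite exprMn [RHS]exprMn sin2cos2; ring.
  rewrite sqrtr_sqr ger0_norm ?mulr_ge0 ?sin_ge0_pi//.
  have pi0 : pi != 0 :> R by rewrite gt_eqF // pi_gt0.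
  by move: pi0; move: (sin t) (f _) pi => a b p p0; field.
- by move=> x y xI yI xy; rewrite /F ltr_pM2l// ltr_cos.
- by move=> t _; exact: cF'.
- by apply/cvg_ex; exists ((derive1 F) 0); apply: cvg_at_right_filter; exact: cF'.
- by apply/cvg_ex; exists ((derive1 F) pi); apply: cvg_at_left_filter; exact: cF'.
- split; first by move=> t _; exact: ex_derive.
    by apply: cvg_at_right_filter; exact: cF.
  by apply: cvg_at_left_filter; exact: cF.
- exact: continuous_subspaceT.
Qed.

End SemicircleMoments.

Section SemicircleProbability.
Variable R : realType.
Local Notation leb := (@lebesgue_measure R).

Lemma integral_semicircle_pdf (f : R -> R) : continuous f ->
  (\int[leb]_x (f x * semicircle_pdf x)%:E)%E = (semicircle_mean f)%:E.
Proof.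
move=> cf; rewrite -semicircle_substitution// [RHS]integral_mkcond.
apply: eq_integral => x _; rewrite patchE /semicircle_pdf indicE.
by case: ifP => _; rewrite ?mul1r// mul0r mulr0.
Qed.

Lemma semicircle_mean_cst (c : R) : semicircle_mean (fun=> c) = c.
Proof.
have := @semicircle_meanX R 0; under [X in semicircle_mean X]eq_fun do rewrite expr0.
rewrite /semicircle_mean => m1.
transitivity (Rintegral leb `[0, pi] (fun t => c * (1 * (2 / pi * sin t ^+ 2)))).
  by apply: eq_Rintegral => t _; rewrite mul1r.
rewrite RintegralZl ?m1 ?mulr1//.
apply: continuous_integrable => t; apply: cvgM; first exact: cvg_cst.
apply: cvgM; first exact: cvg_cst.
by apply: (@continuous_comp _ _ _ (@sin R) (fun x => x ^+ 2)); [exact: continuous_sin|exact: exprn_continuous].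
Qed.

Lemma semicircle_setT : semicircle [set: R] = 1%E.
Proof.
transitivity (\int[leb]_x ((fun=> 1) x * semicircle_pdf x)%:E)%E.
  by apply: eq_integral => x _; rewrite mul1r.
by rewrite integral_semicircle_pdf ?semicircle_mean_cst// => x; exact: cvg_cst.
Qed.

HB.instance Definition _ := Measure_isProbability.Build _ _ R (@semicircle R) semicircle_setT.

Lemma integrable_semicircle_pdf : leb.-integrable setT (EFin \o @semicircle_pdf R).
Proof.
apply/integrableP; split; first by apply/measurable_EFinP; exact: measurable_semicircle_pdf.
apply: (@le_lt_trans _ _ (semicircle [set: R])); last by rewrite semicircle_setT ltry.
rewrite le_eqVlt; apply/orP; left; apply/eqP; apply: eq_integral => x _.
by rewrite /= ger0_norm// semicircle_pdf_ge0.
Qed.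

Lemma integrable_semicircle_pdfM (f : R -> R) : bounded_measurable f ->
  leb.-integrable setT (EFin \o (fun x => f x * semicircle_pdf x)).
Proof.
move=> [mf [M fM]].
have iM : leb.-integrable setT (fun x => (M * semicircle_pdf x)%:E).
  have := integrableZl measurableT M integrable_semicircle_pdf.
  by apply: eq_integrable.
apply: (le_integrable _ _ _ iM) => //.
  by apply/measurable_EFinP; apply: measurable_funM => //; exact: measurable_semicircle_pdf.
move=> x _ /=; rewrite lee_fin !normrM ler_wpM2r//.
by rewrite (le_trans (fM x))// ler_norm.
Qed.

(** The difference of the two sides is a bounded functional of [f]; on indicators it is 0 by the
    definition of [semicircle]. *)
Lemma Rintegral_semicircle (f : R -> R) : bounded_measurable f ->
  Rintegral semicircle setT f = Rintegral leb setT (fun x => f x * semicircle_pdf x).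
Proof.
move=> bf.
pose L (f : R -> R) := Rintegral semicircle setT f -
  Rintegral leb setT (fun x => f x * semicircle_pdf x).
suff : L f = 0 by move/eqP; rewrite subr_eq0 => /eqP.
have ipdf g := @integrable_semicircle_pdfM g.
apply: bounded_functional_eq0 => //; last first.
  move=> B mB; rewrite /L Ex_indic//.
  suff -> : Rintegral leb setT (fun x => \1_B x * semicircle_pdf x) = fine (semicircle B).
    by rewrite subrr.
  rewrite /Rintegral; congr fine; rewrite /semicircle [RHS]integral_mkcond.
  apply: eq_integral => x _; rewrite patchE indicE.
  by case: ifP => _; rewrite ?mul1r ?mul0r.
rewrite /L; split.
- move=> g h bg bh; rewrite ExD//.
  under [X in _ - X]eq_Rintegral do rewrite mulrDl.
  by rewrite RintegralD//; [ring|exact: ipdf..].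
- move=> c g bg; rewrite ExZ//.
  under [X in _ - X]eq_Rintegral do rewrite -mulrA.
  by rewrite RintegralZl//; [ring|exact: ipdf].
- exists 2 => g M bg gM; rewrite (le_trans (ler_normB _ _))// mulr_natl mulr2n lerD//.
    exact: Ex_norm.
  apply: le_trans (le_normr_Rintegral _ (ipdf _ bg)) _ => //.
  rewrite -[leRHS]mulr1.
  have -> : 1 = Rintegral leb setT (@semicircle_pdf R).
    by rewrite -[LHS]/(fine 1%E) -semicircle_setT.
  rewrite -RintegralZl//; last exact: integrable_semicircle_pdf.
  apply: le_Rintegral => //.
  + have bng : bounded_measurable (fun x => `|g x|).
      split; first by apply: measurableT_comp => //; exact: bg.1.
      by exists M => x; rewrite normr_id.
    apply: eq_integrable (ipdf _ bng) => // x _ /=.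
    by rewrite normrM [X in _ = (_ * X)%:E]ger0_norm ?semicircle_pdf_ge0.
  + by have := integrableZl measurableT M integrable_semicircle_pdf; apply: eq_integrable.
  + by move=> x _; rewrite normrM [X in _ * X]ger0_norm ?semicircle_pdf_ge0// ler_wpM2r ?semicircle_pdf_ge0.
Qed.

Lemma continuous_bounded_measurable (f : R -> R) : continuous f ->
  bounded_fun (f : R -> R^o) -> bounded_measurable f.
Proof.
move=> cf [M [_ fM]]; split; first exact: continuous_measurable_fun.
by exists (M + 1) => x; apply: fM => //; rewrite ltrDl.
Qed.

Lemma integral_semicircle (f : R -> R) : continuous f ->
  bounded_fun (f : R -> R^o) ->
  (\int[semicircle]_x (f x)%:E)%E = (semicircle_mean f)%:E.
Proof.
move=> cf bf; have bm := continuous_bounded_measurable cf bf.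
have fi := bounded_measurable_integrable semicircle bm.
rewrite -[LHS]fineK; last exact: integrable_fin_num fi.
congr EFin; have := Rintegral_semicircle bm; rewrite {1}/Rintegral => ->.
by rewrite /Rintegral integral_semicircle_pdf.
Qed.

End SemicircleProbability.

(** * From moments to weak convergence *)

Section SpectralIntegral.
Variable R : realType.

Definition average (s : seq R) (f : R -> R) : R := (\sum_(l <- s) f l) / (size s)%:R.

Lemma integral_spectral_measure_ge0 n (A : 'M[R]_n) (f : R -> R) :
  measurable_fun setT f -> (forall x, 0 <= f x) ->
  (\int[spectral_measure A]_x (f x)%:E)%E = (average (eigenvalues A) f)%:E.
Proof.
move=> mf f0; have mfE : measurable_fun setT (EFin \o f) by exact/measurable_EFinP.
rewrite ge0_integral_mscale//; last by move=> x _; rewrite lee_fin.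
rewrite ge0_integral_measure_sum//; last by move=> x _; rewrite lee_fin.
under eq_bigr => j _ do rewrite integral_dirac//= diracT mul1e.
rewrite sumEFin -EFinM /average size_eigenvalues mulrC; congr (_ / _)%:E.
by rewrite [RHS](big_nth 0) size_eigenvalues big_mkord.
Qed.

Lemma averageB (s : seq R) (f g : R -> R) :
  average s (fun x => f x - g x) = average s f - average s g.
Proof. by rewrite /average sumrB mulrBl. Qed.

Lemma integral_spectral_measure n (A : 'M[R]_n) (f : R -> R) :
  measurable_fun setT f ->
  (\int[spectral_measure A]_x (f x)%:E)%E = (average (eigenvalues A) f)%:E.
Proof.
move=> mf; rewrite integralE.
have pE : (fun x => (f x)%:E)^\+%E = (fun x => (f^\+ x)%:E).
  by apply/funext => x; rewrite unlock /funrpos EFin_max.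
have nE : (fun x => (f x)%:E)^\-%E = (fun x => (f^\- x)%:E).
  by apply/funext => x; rewrite unlock /funrneg EFin_max.
rewrite pE nE !integral_spectral_measure_ge0//.
- rewrite -EFinB -averageB; congr ((_ : R)%:E); congr (_ / _); apply: eq_bigr => x _.
  by rewrite -[in RHS](funrposBneg f).
- exact: measurable_funrneg.
- exact: measurable_funrpos.
Qed.

End SpectralIntegral.

Section SemicircleMean.
Variable R : realType.
Local Notation Gam := (@semicircle_mean R).

Lemma continuous_semicircle_mean (f : R -> R) : continuous f ->
  continuous (fun t : R => f (2 * cos t) * (2 / pi * sin t ^+ 2)).
Proof.
move=> cf t; apply: cvgM.
  apply: (@continuous_comp _ _ _ (fun t : R => 2 * cos t) f); last exact: cf.
  by apply: cvgM; [exact: cvg_cst|exact: continuous_cos].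
apply: cvgM; first exact: cvg_cst.
by apply: (@continuous_comp _ _ _ (@sin R) (fun x => x ^+ 2)); [exact: continuous_sin|exact: exprn_continuous].
Qed.

Lemma semicircle_meanD (f g : R -> R) : continuous f -> continuous g ->
  Gam (fun x => f x + g x) = Gam f + Gam g.
Proof.
move=> cf cg; rewrite -arcD; [|exact: continuous_semicircle_mean..].
by congr (Rintegral _ _ _); apply/funext => t; rewrite mulrDl.
Qed.

Lemma semicircle_meanZ (c : R) (f : R -> R) : continuous f ->
  Gam (fun x => c * f x) = c * Gam f.
Proof.
move=> cf; rewrite -arcZ; last exact: continuous_semicircle_mean.
by congr (Rintegral _ _ _); apply/funext => t; rewrite mulrA.
Qed.

Lemma semicircle_meanB (f g : R -> R) : continuous f -> continuous g ->
  Gam (fun x => f x - g x) = Gam f - Gam g.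
Proof.
move=> cf cg; rewrite -arcB; [|exact: continuous_semicircle_mean..].
by congr (Rintegral _ _ _); apply/funext => t; rewrite mulrBl.
Qed.

Lemma semicircle_mean_le (f g : R -> R) : continuous f -> continuous g ->
  (forall x, `|x| <= 2 -> f x <= g x) -> Gam f <= Gam g.
Proof.
move=> cf cg fg; apply: le_Rintegral => //.
- by apply: continuous_integrable; exact: continuous_semicircle_mean.
- by apply: continuous_integrable; exact: continuous_semicircle_mean.
- move=> t _; have t0 : 0 <= 2 / pi * sin t ^+ 2 by rewrite mulr_ge0 ?sqr_ge0// divr_ge0 ?pi_ge0.
  apply: (ler_wpM2r t0); apply: fg.
  by rewrite normrM ger0_norm// ler_piMr// cos_max.
Qed.

Lemma semicircle_mean_norm (f : R -> R) (M : R) : continuous f ->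
  (forall x, `|x| <= 2 -> `|f x| <= M) -> `|Gam f| <= M.
Proof.
move=> cf fM; rewrite ler_norml -{1}(semicircle_mean_cst (- M)) -{2}(semicircle_mean_cst M).
have cc (c : R) : continuous (fun _ : R => c) by move=> x; exact: cvg_cst.
by apply/andP; split; apply: semicircle_mean_le => // x /fM; rewrite ler_norml => /andP[].
Qed.

End SemicircleMean.

Section Averages.
Variables (R : realType) (s : nat -> seq R).
Local Notation Gam := (@semicircle_mean R).
Hypothesis s_gt0 : \forall n \near \oo, (0 < size (s n))%N.

Definition average_cvg (f : R -> R) : Prop :=
  (fun n => average (s n) f) @ \oo --> Gam f.

Lemma averageD (u : seq R) (f g : R -> R) :
  average u (fun x => f x + g x) = average u f + average u g.
Proof. by rewrite /average big_split mulrDl. Qed.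

Lemma averageZ (u : seq R) c (f : R -> R) :
  average u (fun x => c * f x) = c * average u f.
Proof. by rewrite /average -mulr_sumr mulrA. Qed.

Lemma average_le (u : seq R) (f g : R -> R) : (forall x, f x <= g x) ->
  average u f <= average u g.
Proof. by move=> fg; rewrite /average ler_wpM2r// ler_sum. Qed.

Lemma average_cst (u : seq R) c : (0 < size u)%N -> average u (fun=> c) = c.
Proof.
move=> u0; rewrite /average big_const_seq count_predT iter_addr_0 -[c *+ _]mulr_natr mulfK//.
by rewrite pnatr_eq0 -lt0n.
Qed.

Lemma average_cvgD (f g : R -> R) : continuous f -> continuous g ->
  average_cvg f -> average_cvg g -> average_cvg (fun x => f x + g x).
Proof.
move=> cf cg hf hg; rewrite /average_cvg semicircle_meanD//.
by under eq_fun do rewrite averageD; exact: cvgD.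
Qed.

Lemma average_cvgZ c (f : R -> R) : continuous f ->
  average_cvg f -> average_cvg (fun x => c * f x).
Proof.
move=> cf hf; rewrite /average_cvg semicircle_meanZ//.
by under eq_fun do rewrite averageZ; apply: cvgM => //; exact: cvg_cst.
Qed.

Lemma average_cvg_cst c : average_cvg (fun=> c).
Proof.
rewrite /average_cvg semicircle_mean_cst; apply: cvg_near_cst.
by apply: filterS s_gt0 => n; exact: average_cst.
Qed.

(** The approximation is uniform only on [-2, 2]. Elsewhere the error is dominated by [h], whose
    averages tend to a small limit; this bounds the contribution of eigenvalues far from the
    support. *)
Lemma average_cvg_approx (f : R -> R) : continuous f ->
  (forall e, 0 < e -> exists p h : R -> R, [/\ continuous p, average_cvg p,
     average_cvg h, Gam h <= e & (forall x, `|f x - p x| <= e + h x) /\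
       (forall x, `|x| <= 2 -> `|f x - p x| <= e)]) ->
  average_cvg f.
Proof.
move=> cf happ; apply/cvgrPdist_le => e e0.
(* Five errors: between the means of f and p, in the averages of p and of h, the mean of h, and the
   uniform error. *)
have e50 : 0 < e / 5 by rewrite divr_gt0.
have [p [h [cp hp hh Gh [fp fp2]]]] := happ _ e50.
move/cvgrPdist_le : hp => /(_ _ e50) hp.
move/cvgrPdist_le : hh => /(_ _ e50) hh.
near=> n.
have n0 : (0 < size (s n))%N by near: n.
have hpn : `|Gam p - average (s n) p| <= e / 5 by near: n.
have hhn : `|Gam h - average (s n) h| <= e / 5 by near: n.
have G : `|Gam f - Gam p| <= e / 5.
  by rewrite -semicircle_meanB//; apply: semicircle_mean_norm => // x; apply: cvgB; [exact: cf|exact: cp].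
have up : average (s n) f - average (s n) p <= e / 5 + average (s n) h.
  rewrite -averageB -[X in _ <= X + _](average_cst (e / 5) n0) -averageD.
  by apply: average_le => x; exact: le_trans (ler_norm _) (fp x).
have down : average (s n) p - average (s n) f <= e / 5 + average (s n) h.
  rewrite -averageB -[X in _ <= X + _](average_cst (e / 5) n0) -averageD.
  by apply: average_le => x; apply: le_trans (ler_norm _) _; rewrite distrC.
move: G hpn hhn; rewrite !ler_norml => /andP[? ?] /andP[? ?] /andP[? ?].
by apply/andP; split; lra.
Unshelve. all: by end_near. Qed.

End Averages.

Section Polynomials.
Variable R : realType.

(** The unit 4 suits tail functions of the form (x / 4)^(2q), at least 1 outside [-4, 4] and at most
    4^(-q) on [-2, 2]. *)
Lemma poly_growth (p : {poly R}) : exists C D, 0 <= C /\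
  forall x, 4 <= `|x| -> `|p.[x]| <= C * (`|x| / 4) ^+ D.
Proof.
elim/poly_ind: p => [|p c [C [D [C0 h]]]].
  by exists 0, 0%N; split => // x _; rewrite horner0 normr0 mul0r.
exists (4 * C + `|c|), D.+1; split; first by rewrite addr_ge0 ?mulr_ge0.
move=> x x4; rewrite !hornerE (le_trans (ler_normD _ _))// mulrDl lerD//.
  rewrite normrM exprSr.
  have -> : 4 * C * ((`|x| / 4) ^+ D * (`|x| / 4)) = C * (`|x| / 4) ^+ D * `|x| by field.
  by rewrite ler_wpM2r// h.
by rewrite ler_peMr// exprn_ege1// ler_pdivlMr// mul1r.
Qed.

Lemma poly_lipschitz_on (p : {poly R}) (K : R) : 0 <= K -> exists2 L, 0 <= L &
  forall x y, `|x| <= K -> `|y| <= K -> `|p.[x] - p.[y]| <= L * `|x - y|.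
Proof.
move=> K0; elim/poly_ind: p => [|p c [L L0 h]].
  by exists 0 => // x y _ _; rewrite !horner0 subrr normr0 mul0r.
exists (`|p.[0]| + L * K + K * L) => [|x y xK yK]; first by rewrite !addr_ge0 ?mulr_ge0.
rewrite !hornerE.
have -> : p.[x] * x + c - (p.[y] * y + c) = p.[x] * (x - y) + y * (p.[x] - p.[y]) by ring.
rewrite (le_trans (ler_normD _ _))// mulrDl lerD// normrM; last first.
  by rewrite -mulrA ler_pM// h.
rewrite ler_wpM2r//.
have := h x 0 xK; rewrite normr0 subr0 => /(_ K0) px.
rewrite -[p.[x]](subrK p.[0]) addrC (le_trans (ler_normD _ _))// lerD2l.
by rewrite (le_trans px)// ler_wpM2l.
Qed.

Lemma continuous_horner (p : {poly R}) : continuous (fun x => p.[x]).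
Proof.
elim/poly_ind: p => [|p c h] x.
  by under eq_fun do rewrite horner0; exact: cvg_cst.
under eq_fun do rewrite !hornerE.
by apply: cvgD; [apply: cvgM; [exact: h|exact: cvg_id]|exact: cvg_cst].
Qed.

End Polynomials.

(** * The moment method *)

Section MomentMethod.
Variables (R : realType) (s : nat -> seq R).
Local Notation Gam := (@semicircle_mean R).
Hypothesis s_gt0 : \forall n \near \oo, (0 < size (s n))%N.
Hypothesis moments : forall k, average_cvg s (fun x => x ^+ k).

Lemma continuous_expr k : continuous (fun x : R => x ^+ k).
Proof. exact: exprn_continuous. Qed.

Lemma average_cvg_poly (p : {poly R}) : average_cvg s (fun x => p.[x]).
Proof.
suff h k : average_cvg s (fun x => p.[x] * x ^+ k).
  by have := h 0%N; under eq_fun do rewrite mulr1.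
elim/poly_ind: p k => [|p c IH] k.
  by under eq_fun do rewrite horner0 mul0r; exact: average_cvg_cst.
have -> : (fun x => (p * 'X + c%:P).[x] * x ^+ k) =
    (fun x => p.[x] * x ^+ k.+1 + c * x ^+ k).
  by apply/funext => x; rewrite !hornerE exprS; ring.
apply: average_cvgD => //.
- by move=> x; apply: cvgM; [exact: continuous_horner|exact: continuous_expr].
- by move=> x; apply: cvgM; [exact: cvg_cst|exact: continuous_expr].
- by apply: average_cvgZ => //; exact: continuous_expr.
Qed.

Lemma average_cvg_moments (f : R -> R) (M : R) : continuous f ->
  (forall x, `|f x| <= M) -> average_cvg s f.
Proof.
move=> cf fM; apply: average_cvg_approx => // e e0.
have M0 : 0 <= M by exact: le_trans (fM 0).
have four : 0 < 4 :> R by [].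
have [p fp] := weierstrass cf four e0.
have [C1 [D [C10 growth]]] := poly_growth p.
pose C := M + C1; have C0 : 0 <= C by rewrite addr_ge0.
(* q >= D makes the tail function dominate the polynomial outside [-4, 4]; q > C / e together with
   2^(2q) >= q makes its semicircle mean at most [e]. *)
pose q := (D + (Num.truncn (C / e)).+1)%N.
pose a := C / 4 ^+ (q + q).
have aE x : a * x ^+ (q + q) = C * (x / 4) ^+ (q + q).
  by rewrite /a expr_div_n mulrAC mulrA.
have even_ge0 (x : R) : 0 <= x ^+ (q + q) by rewrite exprn_even_ge0// oddD addbb.
exists (fun x => p.[x]), (fun x => a * x ^+ (q + q)); split.
- exact: continuous_horner.
- exact: average_cvg_poly.
- by apply: average_cvgZ => //; exact: continuous_expr.
- rewrite -(semicircle_mean_cst e); apply: semicircle_mean_le.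
  + by move=> x; apply: cvgM; [exact: cvg_cst|exact: continuous_expr].
  + by move=> x; exact: cvg_cst.
  move=> x x2; rewrite aE.
  have x4 : (x / 4) ^+ (q + q) <= (2^-1) ^+ (q + q).
    rewrite -[leLHS]ger0_norm// normrX ler_pXn2r ?nnegrE//; last by rewrite addn_gt0 /q; lia.
    by rewrite normrM [X in _ * X]gtr0_norm//; lra.
  apply: le_trans (ler_wpM2l C0 x4) _.
  rewrite exprVn ler_pdivrMr ?exprn_gt0// mulrC -ler_pdivrMr//.
  apply: (@le_trans _ _ q%:R).
    by rewrite (le_trans (ltW (truncnS_gt _)))// ler_nat leq_addl.
  by rewrite -natrX ler_nat (leq_trans (ltnW (ltn_expl q (ltnSn 1))))// leq_exp2l// leq_addr.
- split=> x; last by move=> x2; apply: fp; lra.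
  have [x4|x4] := leP `|x| 4.
    by apply: le_trans (fp _ x4) _; rewrite lerDl mulr_ge0// divr_ge0// exprn_ge0.
  apply: (@le_trans _ _ (a * x ^+ (q + q))); last by rewrite lerDr ltW.
  have x41 : 1 <= `|x| / 4 by rewrite ler_pdivlMr// mul1r ltW.
  rewrite aE; have -> : (x / 4) ^+ (q + q) = (`|x| / 4) ^+ (q + q).
    by rewrite -[LHS]ger0_norm// normrX normrM [X in _ * X]gtr0_norm.
  rewrite (le_trans (ler_normB _ _))// mulrDl lerD//.
    by rewrite (le_trans (fM x))// ler_peMr// exprn_ege1.
  rewrite (le_trans (growth _ (ltW x4)))// ler_wpM2l// ler_weXn2l//.
  by rewrite /q; lia.
Qed.

End MomentMethod.

(** * From monotone Lipschitz functions to bounded continuous functions *)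

Section Extension.
Variables (R : realType) (s : nat -> seq R).
Hypothesis s_gt0 : \forall n \near \oo, (0 < size (s n))%N.
Hypothesis monotone_cvg : forall (g : R -> R) (L : R), 0 <= L ->
  {homo g : x y / x <= y} -> (forall x, 0 <= g x <= 1) ->
  (forall x y, `|g x - g y| <= L * `|x - y|) -> average_cvg s g.

Lemma lipschitz_continuous (g : R -> R) (L : R) : 0 <= L ->
  (forall x y, `|g x - g y| <= L * `|x - y|) -> continuous g.
Proof.
move=> L0 gL x; apply/cvgrPdist_le => e e0.
have d0 : 0 < e / (L + 1) by rewrite divr_gt0// ltr_wpDl.
near=> y; apply: le_trans (gL _ _) _.
have xy : `|x - y| <= e / (L + 1) by near: y; exact: cvgr_dist_le.
apply: le_trans (ler_wpM2l L0 xy) _.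
by rewrite mulrCA ler_piMr ?(ltW e0)// ler_pdivrMr ?ltr_wpDl// mul1r lerDl.
Unshelve. all: by end_near. Qed.

Lemma bounded_monotone_cvg (g : R -> R) (L M : R) : 0 <= L -> 0 < M ->
  {homo g : x y / x <= y} -> (forall x, `|g x| <= M) ->
  (forall x y, `|g x - g y| <= L * `|x - y|) -> average_cvg s g.
Proof.
move=> L0 M0 gm gM gL; have cg := lipschitz_continuous L0 gL.
pose g1 x := (2 * M)^-1 * (g x + M).
have M20 : 0 < (2 * M)^-1 by rewrite invr_gt0 mulr_gt0.
have c1 : continuous g1.
  by move=> x; apply: cvgM; [exact: cvg_cst|apply: cvgD; [exact: cg|exact: cvg_cst]].
have h1 : average_cvg s g1.
  apply: (monotone_cvg (L := (2 * M)^-1 * L)).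
  - by rewrite mulr_ge0// ltW.
  - by move=> x y xy; rewrite ler_pM2l// lerD2r gm.
  - move=> x; have := gM x; rewrite ler_norml => /andP[? ?].
    rewrite mulr_ge0 ?(ltW M20)//=; last by lra.
    by rewrite /g1 mulrC ler_pdivrMr ?mulr_gt0//; lra.
  - move=> x y; rewrite /g1 -mulrBr normrM gtr0_norm// -mulrA ler_pM2l//.
    by rewrite opprD addrACA subrr addr0.
have -> : g = (fun x => (2 * M) * g1 x + (- M)).
  by apply/funext => x; rewrite /g1 mulVKf ?addrK// gt_eqF// mulr_gt0.
apply: average_cvgD.
- by move=> x; apply: cvgM; [exact: cvg_cst|exact: c1].
- by move=> x; exact: cvg_cst.
- exact: average_cvgZ.
- exact: average_cvg_cst.
Qed.

Definition clamp (K x : R) : R := Num.max (- K) (Num.min K x).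

Lemma clamp_norm K x : 0 <= K -> `|clamp K x| <= K.
Proof.
move=> K0; rewrite /clamp ler_norml le_max lexx /= ge_max ge_min lexx /=.
by rewrite andbT lerNl (le_trans _ K0)// oppr_le0.
Qed.

Lemma clamp_id K x : `|x| <= K -> clamp K x = x.
Proof.
rewrite ler_norml => /andP[Kx xK]; rewrite /clamp.
by rewrite (min_idPr xK) (max_idPr Kx).
Qed.

Lemma clamp_homo K : {homo clamp K : x y / x <= y}.
Proof.
by move=> x y xy; rewrite /clamp /Num.max /Num.min; case: (ltP K x) => ?; case: (ltP K y) => ?; do 2?[case: ltP => ?]; lra.
Qed.

Lemma clamp_lipschitz K x y : `|clamp K x - clamp K y| <= `|x - y|.
Proof.
have := ler_norm (x - y); have := ler_norm (y - x); rewrite [ `|y - x|]distrC => ? ?.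
by rewrite ler_norml /clamp /Num.max /Num.min; apply/andP; split; case: (ltP K x) => ?; case: (ltP K y) => ?; do 2?[case: ltP => ?]; lra.
Qed.

(** If [L] is a Lipschitz constant of [p] on [-K, K], adding L * clamp makes the clamped polynomial
    nondecreasing. It is thus a difference of two bounded nondecreasing Lipschitz functions. *)
Lemma average_cvg_clamped_poly (p : {poly R}) (K : R) : 0 < K ->
  average_cvg s (fun x => p.[clamp K x]) /\ continuous (fun x => p.[clamp K x]).
Proof.
move=> K0; have K0' := ltW K0.
have [L L0 pL] := poly_lipschitz_on p K0'.
have lip x y : `|p.[clamp K x] - p.[clamp K y]| <= L * `|x - y|.
  apply: le_trans (pL _ _ (clamp_norm _ K0') (clamp_norm _ K0')) _.
  by rewrite ler_wpM2l// clamp_lipschitz.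
have bnd x : `|p.[clamp K x]| <= `|p.[0]| + L * K.
  have := pL (clamp K x) 0 (clamp_norm _ K0'); rewrite normr0 subr0 => /(_ K0') h.
  rewrite -[p.[clamp K x]](subrK p.[0]) addrC (le_trans (ler_normD _ _))// lerD2l.
  by rewrite (le_trans h)// ler_wpM2l// clamp_norm.
pose M := `|p.[0]| + L * K + L * K + 1.
have M0 : 0 < M by rewrite ltr_wpDl// !addr_ge0// mulr_ge0.
have c1 := lipschitz_continuous L0 lip.
split=> //.
pose g1 x := p.[clamp K x] + L * clamp K x.
pose g2 x := L * clamp K x.
have Lc x : `|L * clamp K x| <= L * K.
  by rewrite normrM ger0_norm// ler_wpM2l// clamp_norm.
have lip2 x y : `|g2 x - g2 y| <= L * `|x - y|.
  by rewrite /g2 -mulrBr normrM ger0_norm// ler_wpM2l// clamp_lipschitz.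
have h1 : average_cvg s g1.
  apply: (@bounded_monotone_cvg g1 (L + L) M) => //.
  - by rewrite addr_ge0.
  - move=> x y xy; rewrite /g1 -subr_ge0.
    have cxy := clamp_homo K xy.
    have := pL (clamp K x) (clamp K y) (clamp_norm _ K0') (clamp_norm _ K0').
    rewrite [ `|clamp K x - _|]distrC [ `|clamp K y - _|]ger0_norm ?subr_ge0//.
    by rewrite ler_norml => /andP[? ?]; lra.
  - move=> x; rewrite (le_trans (ler_normD _ _))// /M.
    by have := bnd x; have := Lc x; lra.
  - move=> x y; rewrite /g1 mulrDl opprD addrACA (le_trans (ler_normD _ _))//.
    by rewrite lerD// lip2.
have h2 : average_cvg s g2.
  apply: (@bounded_monotone_cvg g2 L M) => //.
  - by move=> x y xy; rewrite ler_wpM2l// clamp_homo.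
  - move=> x; have := Lc x; rewrite /M /g2; have := normr_ge0 p.[0].
    by have := mulr_ge0 L0 K0'; lra.
have -> : (fun x => p.[clamp K x]) = (fun x => g1 x + (- 1) * g2 x).
  by apply/funext => x; rewrite /g1 /g2; ring.
have cg2 := lipschitz_continuous L0 lip2.
apply: average_cvgD => //.
- by move=> x; apply: cvgD; [exact: c1|exact: cg2].
- by move=> x; apply: cvgM; [exact: cvg_cst|exact: cg2].
- exact: average_cvgZ.
Qed.

(** Counterpart of [average_cvg_moments] without moments. Clamping keeps the polynomial bounded, and
    the tail function is a combination of two nondecreasing functions with semicircle mean 0, as it
    vanishes on [-2, 2]. *)
Lemma average_cvg_bounded (f : R -> R) (M : R) : continuous f ->
  (forall x, `|f x| <= M) -> average_cvg s f.
Proof.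
move=> cf fM; apply: average_cvg_approx => // e e0.
have M0 : 0 <= M by exact: le_trans (fM 0).
have four : 0 < 4 :> R by [].
have [p fp] := weierstrass cf four e0.
have [cvp cp] := average_cvg_clamped_poly p four.
(* [tent] vanishes on [-3, 3] and is 1 outside of [-4, 4]. *)
pose u (x : R) := Num.max 0 (Num.min 1 (x - 3)).
pose tent x := u x + (- 1) * (- u (- x)).
have u_homo : {homo u : x y / x <= y}.
  by move=> x y xy; rewrite /u /Num.max /Num.min; case: (ltP 1 (x - 3)) => ?; case: (ltP 1 (y - 3)) => ?; do 2?[case: ltP => ?]; lra.
have u01 x : 0 <= u x <= 1.
  by rewrite /u le_max lexx ge_max ge_min lexx ler01.
have u_lip x y : `|u x - u y| <= 1 * `|x - y|.
  rewrite mul1r.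
  have := ler_norm (x - y); have := ler_norm (y - x); rewrite [ `|y - x|]distrC => ? ?.
  by rewrite ler_norml /u /Num.max /Num.min; apply/andP; split; case: (ltP 1 (x - 3)) => ?; case: (ltP 1 (y - 3)) => ?; do 2?[case: ltP => ?]; lra.
have u0 x : x <= 3 -> u x = 0.
  by move=> x3; rewrite /u; apply/max_idPl; rewrite ge_min subr_le0 x3 orbT.
have u1 x : 4 <= x -> u x = 1.
  by move=> x4; rewrite /u (min_idPl _) ?(max_idPr _)//; lra.
have cvu : average_cvg s u by exact: (monotone_cvg ler01).
have uN_lip x y : `|- u (- x) - - u (- y)| <= 1 * `|x - y|.
  by rewrite opprK addrC (le_trans (u_lip _ _))// opprK addrC.
have cvuN : average_cvg s (fun x => - u (- x)).
  apply: (@bounded_monotone_cvg _ 1 1) => //.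
  - by move=> x y xy; rewrite lerN2 u_homo// lerN2.
  - by move=> x; rewrite normrN ger0_norm; case/andP: (u01 (- x)).
have cu := lipschitz_continuous ler01 u_lip.
have cuN := lipschitz_continuous ler01 uN_lip.
have ct : continuous tent.
  by move=> x; apply: cvgD; [exact: cu|apply: cvgM; [exact: cvg_cst|exact: cuN]].
have cvt : average_cvg s tent.
  apply: average_cvgD => //; last exact: average_cvgZ.
  by move=> x; apply: cvgM; [exact: cvg_cst|exact: cuN].
have tent0 x : `|x| <= 2 -> tent x = 0.
  by rewrite ler_norml => /andP[? ?]; rewrite /tent !u0; [ring|lra|lra].
have tent_ge0 x : 0 <= tent x.
  by rewrite /tent mulN1r opprK addr_ge0//; case/andP: (u01 x); case/andP: (u01 (- x)).
have tent1 x : 4 <= `|x| -> 1 <= tent x.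
  rewrite /tent mulN1r opprK; case/andP: (u01 x) => ? ?; case/andP: (u01 (- x)) => ? ?.
  have [x0|x0] := ger0P x => x4; first by rewrite (u1 x)//; lra.
  by rewrite (u1 (- x))//; lra.
(* Outside [-4, 4] the error is at most M for [f] plus M + e for the clamped polynomial. *)
exists (fun x => p.[clamp 4 x]), (fun x => (2 * M + e) * tent x); split => //.
- exact: average_cvgZ.
- rewrite semicircle_meanZ//.
  suff -> : semicircle_mean tent = 0 by rewrite mulr0 ltW.
  apply/eqP; rewrite -normr_le0; apply: semicircle_mean_norm => // x /tent0 ->.
  by rewrite normr0.
have close x : `|x| <= 4 -> `|f x - p.[clamp 4 x]| <= e.
  by move=> x4; rewrite clamp_id// fp.
split=> x; last by move=> x2; apply: close; lra.
have [x4|x4] := leP `|x| 4.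
  by apply: le_trans (close _ x4) _; rewrite lerDl mulr_ge0// addr_ge0 ?(ltW e0)// mulr_ge0.
have pc : `|p.[clamp 4 x]| <= M + e.
  have := fp (clamp 4 x) (clamp_norm _ (ler0n _ 4)); rewrite distrC => h.
  rewrite -[p.[_]](subrK (f (clamp 4 x))) addrC (le_trans (ler_normD _ _))// lerD//.
apply: (@le_trans _ _ (2 * M + e)).
  by rewrite (le_trans (ler_normB _ _))//; have := fM x; lra.
apply: (@le_trans _ _ ((2 * M + e) * tent x)); last by rewrite lerDr ltW.
by rewrite ler_peMr ?tent1 ?(ltW x4)// addr_ge0 ?(ltW e0)// mulr_ge0.
Qed.

End Extension.

(** * Interpolation between consecutive squares *)

Section Interpolation.
Variables (R : realType) (I : choiceType) (S : nat -> nat -> I).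
Hypothesis HS : C_condition R S.
Variables (x : I -> R) (m : R).
Local Notation Gam := (@semicircle_mean R).

Definition scaled_spectrum (y : I -> R) (n : nat) : seq R :=
  eigenvalues ((Num.sqrt n%:R)^-1 *: patterned_matrix S y n).

Let y i := x i - m.
Let sub j : nat := (j.+1 ^ 2)%N.

Hypothesis trace_cvg : forall k, (0 < k)%N ->
  (fun j : nat => \tr (mxpow (patterned_matrix S y (sub j)) k) /
     ((sub j)%:R * Num.sqrt (sub j)%:R ^+ k)) @ \oo
  --> ((half_line_walks k 0)%:R : R).

Lemma mxpowZ n (c : R) (A : 'M[R]_n) k : mxpow (c *: A) k = c ^+ k *: mxpow A k.
Proof.
elim: k => [|k IH] /=; first by rewrite expr0 scale1r.
by rewrite IH -scalemxAl -scalemxAr scalerA exprS.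
Qed.

Lemma size_scaled_spectrum z n : size (scaled_spectrum z n) = n.
Proof. exact: size_eigenvalues. Qed.

Lemma average_scaled_spectrum z n k :
  average (scaled_spectrum z n) (fun l => l ^+ k) =
  \tr (mxpow (patterned_matrix S z n) k) / (n%:R * Num.sqrt n%:R ^+ k).
Proof.
rewrite /average -mxtrace_eigenvalues ?size_scaled_spectrum; last first.
  by rewrite linearZ /= (tr_patterned HS).
by rewrite mxpowZ mxtraceZ exprVn invfM; ring.
Qed.

Lemma sub_gt0 : \forall j \near \oo, (0 < size (scaled_spectrum y (sub j)))%N.
Proof. by apply: nearW => j; rewrite size_scaled_spectrum expn_gt0. Qed.

Lemma subsequence_cvg (f : R -> R) (M : R) : continuous f -> (forall l, `|f l| <= M) ->
  average_cvg (fun j => scaled_spectrum y (sub j)) f.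
Proof.
apply: average_cvg_moments; first exact: sub_gt0.
move=> [|k].
  have -> : (fun l : R => l ^+ 0) = fun=> 1 by apply/funext => l.
  exact: average_cvg_cst sub_gt0 _.
rewrite /average_cvg semicircle_meanX.
by under eq_fun do rewrite average_scaled_spectrum; exact: trace_cvg.
Qed.

(** Not an instance of [subsequence_cvg], the square being unbounded. It controls the error of
    rescaling the eigenvalues. *)
Lemma second_moment_cvg :
  average_cvg (fun j => scaled_spectrum y (sub j)) (fun l => l ^+ 2).
Proof.
rewrite /average_cvg semicircle_meanX.
by under eq_fun do rewrite average_scaled_spectrum; exact: trace_cvg.
Qed.

(** Three errors of order 1 / sqrt n: the comparison of the spectra, with n - r^2 <= 2 sqrt n; the
    ratio c = r / sqrt n of the scalings, handled by the Lipschitz bound and |l| <= 1 + l^2; and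
    dividing by n instead of r^2. *)
Lemma spectrum_interpolation (g : R -> R) (L : R) (n r : nat) : 0 <= L ->
  {homo g : a b / a <= b} -> (forall a, 0 <= g a <= 1) ->
  (forall a b, `|g a - g b| <= L * `|a - b|) ->
  (0 < r)%N -> r%:R <= Num.sqrt (n%:R : R) < r.+1%:R ->
  `|average (scaled_spectrum x n) g - average (scaled_spectrum y (r ^ 2)) g| <=
  (6 + L * (1 + average (scaled_spectrum y (r ^ 2)) (fun l => l ^+ 2))) / Num.sqrt n%:R.
Proof.
move=> L0 gm g01 gL r0 /andP[rn nr].
have sE : n%:R = Num.sqrt n%:R ^+ 2 :> R by rewrite sqr_sqrtr.
have rR : 1 <= r%:R :> R by rewrite ler1n.
have sq : Num.sqrt (r ^ 2)%:R = r%:R :> R by rewrite natrX sqrtr_sqr ger0_norm.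
have Nn : (r ^ 2 <= n)%N.
  by rewrite -(ler_nat R) sE natrX ler_pXn2r// nnegrE ?sqrtr_ge0.
set q := Num.sqrt n%:R in sE rn nr *; have q1 : 1 <= q by exact: le_trans rn.
have q0 : 0 < q by exact: lt_le_trans q1.
have nq : n%:R = q ^+ 2 :> R by [].
have N0 : 0 < (r ^ 2)%:R :> R by rewrite ltr0n expn_gt0 r0.
have n0 : 0 < n%:R :> R by rewrite nq exprn_gt0.
have gap : (n - r ^ 2)%:R <= 2 * q :> R.
  rewrite natrB// natrX nq; have := nr; rewrite -natr1 => nr'.
  have : q ^+ 2 - r%:R ^+ 2 = (q - r%:R) * (q + r%:R) by ring.
  move=> ->; apply: (@le_trans _ _ (1 * (q + r%:R))); last by rewrite mul1r; lra.
  by rewrite ler_wpM2r; lra.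
set sn := scaled_spectrum x n; set sN := scaled_spectrum y (r ^ 2).
pose c := q^-1 * r%:R.
have cmp : `|\sum_(l <- sn) g l - \sum_(l <- sN) g (c * l)| <= (n - r ^ 2).+1%:R.
  have -> : c = q^-1 / (Num.sqrt (r ^ 2)%:R)^-1 by rewrite invrK sq.
  apply: (@patterned_comparison R I S HS x m) => //; first by rewrite invr_gt0.
  by rewrite invr_gt0 sq (lt_le_trans ltr01).
have avn : average sn g = (\sum_(l <- sn) g l) / n%:R.
  by rewrite /average /sn size_scaled_spectrum.
have avN f : average sN f = (\sum_(l <- sN) f l) / (r ^ 2)%:R.
  by rewrite /average /sN size_scaled_spectrum.
have sumN f : \sum_(l <- sN) f l = (r ^ 2)%:R * average sN f.
  by rewrite avN mulrC divfK ?gt_eqF.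
have szN : (0 < size sN)%N by rewrite size_scaled_spectrum expn_gt0 r0.
have avg1 : 0 <= average sN g <= 1.
  apply/andP; split.
    by rewrite avN divr_ge0 ?(ltW N0)// sumr_ge0// => l _; case/andP: (g01 l).
  rewrite -[X in _ <= X](average_cst 1 szN); apply: average_le => l.
  by case/andP: (g01 l).
have c1 : 0 <= 1 - c <= q^-1.
  have -> : 1 - c = (q - r%:R) * q^-1 by rewrite /c; field; rewrite gt_eqF.
  rewrite mulr_ge0 ?invr_ge0 ?(ltW q0) ?subr_ge0//= ler_piMl ?invr_ge0 ?(ltW q0)//.
  by move: nr; rewrite -natr1; lra.
case/andP: c1 => c0 cq.
have A2_ge0 : 0 <= average sN (fun l => l ^+ 2).
  by rewrite avN divr_ge0 ?(ltW N0)// sumr_ge0// => l _; exact: sqr_ge0.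
have d2 : `|\sum_(l <- sN) g (c * l) - \sum_(l <- sN) g l| <=
    (r ^ 2)%:R * (L * q^-1 * (1 + average sN (fun l => l ^+ 2))).
  rewrite -sumrB; apply: le_trans (ler_norm_sum _ _ _) _.
  apply: (@le_trans _ _ (\sum_(l <- sN) L * q^-1 * (1 + l ^+ 2))).
    apply: ler_sum => l _; apply: le_trans (gL _ _) _.
    rewrite -mulrA ler_wpM2l//.
    have -> : c * l - l = - ((1 - c) * l) by ring.
    rewrite normrN normrM ger0_norm// ler_pM//.
    have : 0 <= (`|l| - 1) ^+ 2 by exact: sqr_ge0.
    by rewrite -[l ^+ 2]real_normK ?num_real//; have := normr_ge0 l; nra.
  by rewrite sumN averageZ averageD average_cst.
have Nn' : (r ^ 2)%:R <= n%:R :> R by rewrite ler_nat.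
have -> : average sn g - average sN g =
   ((\sum_(l <- sn) g l - \sum_(l <- sN) g (c * l)) +
    (\sum_(l <- sN) g (c * l) - \sum_(l <- sN) g l)) / n%:R -
   average sN g * (n - r ^ 2)%:R / n%:R.
  by rewrite avn (sumN g) natrB//; field; rewrite gt_eqF.
apply: le_trans (ler_normB _ _) _.
have nV : `|n%:R^-1| = n%:R^-1 :> R by rewrite gtr0_norm ?invr_gt0.
rewrite [X in X + _]normrM [X in _ + X]normrM nV [ `|average sN g * _|]normrM.
have b1 : `|(\sum_(l <- sn) g l - \sum_(l <- sN) g (c * l)) +
    (\sum_(l <- sN) g (c * l) - \sum_(l <- sN) g l)| / n%:R <=
    (2 * q + 1) / n%:R + L * q^-1 * (1 + average sN (fun l => l ^+ 2)).
  rewrite ler_pdivrMr// mulrDl divfK ?gt_eqF//.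
  apply: le_trans (ler_normD _ _) _; apply: lerD.
    by apply: le_trans cmp _; rewrite -natr1 lerD2r.
  apply: le_trans d2 _; rewrite mulrC ler_wpM2l// !mulr_ge0 ?invr_ge0 ?(ltW q0)//.
  by rewrite addr_ge0.
have b2 : `|average sN g| * `|(n - r ^ 2)%:R| / n%:R <= 2 * q / n%:R.
  rewrite ler_wpM2r ?invr_ge0 ?(ltW n0)//.
  case/andP: avg1 => a0 a1; rewrite !ger0_norm//.
  by apply: le_trans gap; rewrite ler_piMl.
apply: le_trans (lerD b1 b2) _.
rewrite nq.
have -> : (2 * q + 1) / q ^+ 2 + L / q * (1 + average sN (fun l => l ^+ 2)) + 2 * q / q ^+ 2 =
  (4 + q^-1 + L * (1 + average sN (fun l => l ^+ 2))) / q.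
  by field; rewrite gt_eqF.
rewrite ler_wpM2r ?invr_ge0 ?(ltW q0)// lerD2r.
have : q^-1 <= 1 by rewrite invf_le1.
by lra.
Qed.

Lemma truncn_sqrt (n : nat) :
  (Num.truncn (Num.sqrt n%:R : R))%:R <= Num.sqrt (n%:R : R) < (Num.truncn (Num.sqrt n%:R : R)).+1%:R.
Proof. by rewrite truncn_le sqrtr_ge0 truncnS_gt. Qed.

Lemma monotone_average_cvg (g : R -> R) (L : R) : 0 <= L ->
  {homo g : a b / a <= b} -> (forall a, 0 <= g a <= 1) ->
  (forall a b, `|g a - g b| <= L * `|a - b|) ->
  average_cvg (scaled_spectrum x) g.
Proof.
move=> L0 gm g01 gL.
have cg := lipschitz_continuous L0 gL.
have g1 l : `|g l| <= 1 by case/andP: (g01 l) => ? ?; rewrite ger0_norm.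
(* The predecessor compensates for the shift in [sub], whose index [j] stands for the square of
   [j.+1]. *)
pose r (n : nat) := (Num.truncn (Num.sqrt n%:R : R)).-1.
have rinf : r @ \oo --> \oo.
  apply/cvgnyPge => A; near=> n.
  have nA : (A.+1 ^ 2 <= n)%N by near: n; exact: nbhs_infty_ge.
  rewrite /r -ltnS (leq_trans _ (leqSpred _))// truncn_ge_nat ?sqrtr_ge0//.
  by rewrite -[leLHS]ger0_norm// -sqrtr_sqr ler_wsqrtr// -natrX ler_nat.
have main := cvg_comp _ _ rinf (subsequence_cvg cg g1).
have second := cvg_comp _ _ rinf second_moment_cvg.
have err : (fun n => (6 + L * (1 + average (scaled_spectrum y (sub (r n))) (fun l => l ^+ 2))) /
    Num.sqrt n%:R) @ \oo --> (0 : R).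
  rewrite -[X in _ --> X](mulr0 (6 + L * (1 + Gam (fun l => l ^+ 2)))).
  apply: cvgM; last exact: cvg_sqrt_natV.
  apply: cvgD; first exact: cvg_cst.
  apply: cvgM; first exact: cvg_cst.
  by apply: cvgD; [exact: cvg_cst|exact: second].
apply/cvgrPdist_le => e e0.
have e20 : 0 < e / 2 by rewrite divr_gt0.
move/cvgrPdist_le : main => /(_ _ e20) main.
move/cvgrPdist_le : err => /(_ _ e20) err.
near=> n.
have n0 : (0 < n)%N by near: n; exact: nbhs_infty_gt.
have main_n : `|Gam g - average (scaled_spectrum y (sub (r n))) g| <= e / 2 by near: n.
have err_n : `|0 - (6 + L * (1 + average (scaled_spectrum y (sub (r n))) (fun l => l ^+ 2))) /
    Num.sqrt n%:R| <= e / 2 by near: n.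
have t0 : (0 < Num.truncn (Num.sqrt n%:R : R))%N.
  by rewrite truncn_gt0 -[leLHS]sqrtr1 ler_wsqrtr// ler1n.
have := spectrum_interpolation L0 gm g01 gL t0 (truncn_sqrt n).
have -> : (Num.truncn (Num.sqrt n%:R : R) ^ 2)%N = sub (r n) by rewrite /sub /r prednK.
move=> int_n.
rewrite (_ : Gam g - _ = (Gam g - average (scaled_spectrum y (sub (r n))) g) -
  (average (scaled_spectrum x n) g - average (scaled_spectrum y (sub (r n))) g)); last by ring.
rewrite [e]splitr (le_trans (ler_normB _ _))// lerD// (le_trans int_n)//.
by move: err_n; rewrite sub0r normrN; exact: le_trans (ler_norm _).
Unshelve. all: by end_near. Qed.

Lemma spectral_weak_cvg :
  weak_cvg (fun n => spectral_measure ((Num.sqrt n%:R)^-1 *: patterned_matrix S x n))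
    semicircle.
Proof.
move=> f cf bf; rewrite integral_semicircle//.
have [mf [M fM]] := continuous_bounded_measurable cf bf.
under eq_fun do rewrite integral_spectral_measure//.
apply: cvg_EFin; first by apply: nearW => n.
have sz : \forall n \near \oo, (0 < size (scaled_spectrum x n))%N.
  by near=> n; rewrite size_scaled_spectrum; near: n; exact: nbhs_infty_gt.
exact: (average_cvg_bounded sz monotone_average_cvg cf fM).
Unshelve. all: by end_near. Qed.

End Interpolation.

(** * Clipping, identical laws and conclusion *)

Lemma bounded_measurable_clamp (R : realType) (K : R) : 0 <= K ->
  bounded_measurable (clamp K).
Proof.
move=> K0; split; last by exists K => x; exact: clamp_norm.
apply: continuous_measurable_fun; apply: (lipschitz_continuous ler01) => x y.
by rewrite mul1r clamp_lipschitz.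
Qed.

Section SameLaw.
Context d (T : measurableType d) d0 (T0 : measurableType d0) (R : realType).
Variables (P : probability T R) (P0 : probability T0 R).
Variables (Y : {RV P >-> R}) (X : {RV P0 >-> R}).
Hypothesis YX : same_law Y X.

Lemma same_law_expectation (f : R -> R) : bounded_measurable f ->
  Rintegral P setT (fun w => f (Y w)) = Rintegral P0 setT (fun w => f (X w)).
Proof.
move=> bf; have mfE : measurable_fun setT (EFin \o f) by apply/measurable_EFinP; exact: bf.1.
have iY : P.-integrable setT ((EFin \o f) \o Y).
  by apply: (@bounded_measurable_integrable _ _ _ P (fun w => f (Y w))); exact: bounded_measurable_comp.
have iX : P0.-integrable setT ((EFin \o f) \o X).
  by apply: (@bounded_measurable_integrable _ _ _ P0 (fun w => f (X w))); exact: bounded_measurable_comp.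
rewrite /Rintegral; congr fine.
have := integral_distribution mfE iY; have := integral_distribution mfE iX.
rewrite /comp => <- <-.
by apply: eq_measure_integral => A mA _; exact: YX.
Qed.

Lemma same_law_ae_bounded (M : R) : {ae P0, forall w, `|X w| <= M} ->
  {ae P, forall w, `|Y w| <= M}.
Proof.
have mS : measurable [set y : R | ~ `|y| <= M].
  have mn : measurable_fun setT (Num.norm : R -> R) by exact: normr_measurable.
  have := mn measurableT _ (measurable_itv `]M, +oo[); rewrite setTI.
  congr (measurable _); apply/seteqP; split => y /=; rewrite in_itv/= andbT ltNge.
    by move=> /negP.
  by move=> /negP.
have mpre d' (T' : measurableType d') (Z : T' -> R) : measurable_fun setT Z ->
    measurable (~` [set w | `|Z w| <= M]).
  by move=> mZ; have := mZ measurableT _ mS; rewrite setTI.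
have mX : measurable_fun setT X by [].
have mY : measurable_fun setT Y by [].
move=> /(negligibleP _ (mpre _ _ _ mX)) X0; apply/(negligibleP _ (mpre _ _ _ mY)).
by rewrite -X0; exact: YX mS.
Qed.

End SameLaw.

Section Standardization.
Context d0 (T0 : measurableType d0) (R : realType) (P0 : probability T0 R).
Variables (X : {RV P0 >-> R}) (M : R).
Hypothesis M0 : 0 <= M.
Hypothesis X_bounded : {ae P0, forall w, `|X w| <= M}.
Hypothesis X_var : 'V_P0[X] = 1%:E.

Definition clamped_mean : R := Rintegral P0 setT (fun w => clamp M (X w)).

(** Clipping at an almost sure bound changes [X] on a null set only, so mean and variance are those
    of [X]. *)
Lemma clamped_variance :
  Rintegral P0 setT (fun w => (clamp M (X w) - clamped_mean) ^+ 2) = 1.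
Proof.
have mX : measurable_fun setT X by [].
have bc := bounded_measurable_clamp M0.
have bcX : bounded_measurable (fun w => clamp M (X w)) by exact: bounded_measurable_comp.
have ae_eqX : ae_eq P0 setT (EFin \o X) (fun w => (clamp M (X w))%:E).
  by apply: filterS X_bounded => w wM _ /=; rewrite clamp_id.
have EX : ('E_P0[X] = clamped_mean%:E)%E.
  rewrite unlock (ae_eq_integral (fun w => (clamp M (X w))%:E))//.
  - by rewrite /clamped_mean /Rintegral fineK//; exact: integrable_fin_num (bounded_measurable_integrable P0 bcX).
  - exact/measurable_EFinP.
  - by apply/measurable_EFinP; exact: bcX.1.
have := X_var; rewrite /variance unlock EX /= unlock => V1.
rewrite /Rintegral -[RHS]/(fine 1%:E) -V1; congr fine; apply: ae_eq_integral => //.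
- apply/measurable_EFinP; apply: measurable_funX; apply: measurable_funB => //.
  exact: bcX.1.
- by apply/measurable_EFinP; apply: measurable_funM; apply: measurable_funB.
- by apply: filterS X_bounded => w wM _ /=; rewrite clamp_id// expr2.
Qed.

Lemma clamped_centered :
  Rintegral P0 setT (fun w => clamp M (X w) - clamped_mean) = 0.
Proof.
have bcX : bounded_measurable (fun w => clamp M (X w)).
  by apply: bounded_measurable_comp => //; exact: bounded_measurable_clamp.
rewrite ExB//; last exact: bounded_measurable_cst.
by rewrite Ex_cst subrr.
Qed.

End Standardization.

Theorem theorem1p2 (R : realType) (I : choiceType) (S : nat -> nat -> I)
    (HS : C_condition R S)
    (d0 : measure_display) (T0 : measurableType d0) (P0 : probability T0 R)
    (X : {RV P0 >-> R}) (X_bounded : as_bounded X) (X_var : 'V_P0[X] = 1%:E)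
    (d : measure_display) (T : measurableType d) (P : probability T R)
    (Xi : I -> {RV P >-> R})
    (Xi_indep : mutually_independent Xi)
    (Xi_copies : forall i : I, same_law (Xi i) X) :
  {ae P, forall w : T,
    weak_cvg
      (fun n : nat => spectral_measure
         ((Num.sqrt n%:R)^-1 *: patterned_matrix S (fun i => Xi i w) n))
      semicircle}.
Proof.
have [M1 XM1] := X_bounded; pose M := `|M1|.
have M0 : 0 <= M by exact: normr_ge0.
have XM : {ae P0, forall w, `|X w| <= M}.
  by apply: filterS XM1 => w h; exact: le_trans (ler_norm _).
pose mean := clamped_mean X M; pose psi y := clamp M y - mean.
have bpsi : bounded_measurable psi.
  by apply: bounded_measurableB; [exact: bounded_measurable_clamp|exact: bounded_measurable_cst].
have [B psiB] := bpsi.2.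
pose mu p := Rintegral P0 setT (fun w => psi (X w) ^+ p).
have muE i p : Rintegral P setT (fun w => psi (Xi i w) ^+ p) = mu p.
  by apply: (same_law_expectation (Xi_copies i) (f := fun y => psi y ^+ p)); exact: bounded_measurableX.
have mu1 : mu 1 = 0 by exact: clamped_centered.
have mu2 : mu 2 = 1 by exact: clamped_variance.
have traces : {ae P, forall w, forall k : nat, (0 < k)%N ->
   (fun j : nat => trace_power Xi psi S k (j.+1 ^ 2)%N w /
      ((j.+1 ^ 2)%:R * Num.sqrt (j.+1 ^ 2)%:R ^+ k)) @ \oo
   --> ((half_line_walks k 0)%:R : R)}.
  apply/ae_foralln => -[|k]; first by apply: nearW.
  have := ae_cvg_trace_power Xi_indep bpsi.1 psiB muE mu1 mu2 HS (ltn0Sn k).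
  by apply: filterS => w h _.
(* [I] may be uncountable; exceptional null sets are collected only over the countably many pairs
   (i, j). *)
have entries : {ae P, forall w, forall i j : nat, `|Xi (S i j) w| <= M}.
  apply/ae_foralln => i; apply/ae_foralln => j.
  exact: (same_law_ae_bounded (Xi_copies (S i j)) XM).
apply: filterS2 traces entries => w tr_w en_w.
(* The matrix is clipped but not centred here; the mean is passed to the interpolation as the shift
   [m]. *)
have -> : (fun n => spectral_measure ((Num.sqrt n%:R)^-1 *: patterned_matrix S (fun i => Xi i w) n)) =
    (fun n => spectral_measure ((Num.sqrt n%:R)^-1 *: patterned_matrix S (fun i => clamp M (Xi i w)) n)).
  apply/funext => n; congr (spectral_measure (_ *: _)).
  by apply/matrixP => i j; rewrite !mxE clamp_id.
exact: (spectral_weak_cvg HS (m := mean)).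
Qed.
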